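(* Let $(\Lambda_f,\eta)$ and $(\Lambda_{\widetilde f},\widetilde\eta)$ be two admissible irrational polygonal gratings, and let $\mathbf{G}$ be the unbounded connected component of $\Omega_f\cap\Omega_{\widetilde f}$. Fix $k>0$ and two distinct directions $\mathbf{d}_\ell=(\sin\theta_\ell,-\cos\theta_\ell)^\top$, $\theta_\ell\in(-\pi/2,\pi/2)$, $\ell=1,2$. Let $u(\cdot;k,\mathbf{d}_\ell)$, $\widetilde u(\cdot;k,\mathbf{d}_\ell)$ be the total fields for the two gratings. If $u(\mathbf{x};k,\mathbf{d}_\ell)=\widetilde u(\mathbf{x};k,\mathbf{d}_\ell)$ for all $\mathbf{x}\in\Gamma_b$ and $\ell=1,2$, then there is no corner point of $\Lambda_f$ lying on $\partial\mathbf{G}\setminus\Lambda_{\widetilde f}$, and no corner point of $\Lambda_{\widetilde f}$ lying on $\partial\mathbf{G}\setminus\Lambda_f$.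
   Context: For a $2\pi$-periodic Lipschitz $f:\mathbb{R}\to\mathbb{R}$, $\Lambda_f=\{(x_1,x_2):x_2=f(x_1)\}$ and $\Omega_f=\{x_2>f(x_1)\}$. For incident $u^i=e^{\mathrm{i}k\mathbf{d}\cdot\mathbf{x}}$, $\mathbf{d}=(\sin\theta,-\cos\theta)^\top$, $\theta\in(-\pi/2,\pi/2)$, the total field $u$ solves $\Delta u+k^2u=0$ in $\Omega_f$, $\partial_\nu u+\eta u=0$ on $\Lambda_f$ (with $u=0$ where $\eta=\infty$), is $\alpha$-quasiperiodic with $\alpha=k\sin\theta$, i.e. $u(x_1+2\pi,x_2)=e^{2\mathrm{i}\alpha\pi}u(x_1,x_2)$, and $u^s=u-u^i$ has the Rayleigh expansion $u^s=\sum_{n\in\mathbb{Z}}u_ne^{\mathrm{i}(\alpha_nx_1+\beta_nx_2)}$ for $x_2>\max f$, where $\alpha_n=n+k\sin\theta$, $\beta_n=\sqrt{k^2-\alpha_n^2}$ if $|\alpha_n|\le k$ and $\beta_n=\mathrm{i}\sqrt{\alpha_n^2-k^2}$ otherwise; this forward problem is assumed uniquely solvable. An admissible polygonal grating $(\Lambda_f,\eta)$: $f$ is piecewise linear in each period, and on each linear piece $\eta$ is a constant (possibly zero) or $\infty$. The intersection point of two adjacent pieces $\Gamma^\pm$ is a corner point and $\angle(\Gamma^+,\Gamma^-)$ the corner angle; the grating is irrational if every corner angle $\theta$ has $\theta/\pi$ irrational. $\Gamma_b=\{(x_1,b):0\le x_1\le2\pi\}$ with $b>\max|f|$ and $b>\max|\widetilde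 f|$. *)

(* Defs.v *)
From Stdlib Require Import Reals Lra ZArith List.
From Coquelicot Require Import Coquelicot.
Open Scope R_scope.

Definition pt := (R * R)%type.

Definition cexp (z : C) : C := (exp (fst z) * cos (snd z), exp (fst z) * sin (snd z)).
Definition Ci : C := (0, 1).

Definition dist2 (p q : pt) : R := sqrt ((fst p - fst q)^2 + (snd p - snd q)^2).
Definition open2 (U : pt -> Prop) : Prop :=
  forall p, U p -> exists e, 0 < e /\ forall q, dist2 p q < e -> U q.
Definition closure2 (A : pt -> Prop) (p : pt) : Prop :=
  forall e, 0 < e -> exists q, A q /\ dist2 p q < e.
Definition interior2 (A : pt -> Prop) (p : pt) : Prop :=
  exists e, 0 < e /\ forall q, dist2 p q < e -> A q.
Definition boundary2 (A : pt -> Prop) (p : pt) : Prop :=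
  closure2 A p /\ ~ interior2 A p.
Definition connected2 (S : pt -> Prop) : Prop :=
  ~ exists U V : pt -> Prop, open2 U /\ open2 V /\
      (forall p, S p -> U p \/ V p) /\
      (exists p, S p /\ U p) /\ (exists p, S p /\ V p) /\
      (forall p, S p -> U p -> V p -> False).
Definition conn_component (A G : pt -> Prop) : Prop :=
  exists p0, A p0 /\
    forall x, G x <-> exists S, connected2 S /\ (forall q, S q -> A q) /\ S p0 /\ S x.
Definition unbounded2 (G : pt -> Prop) : Prop :=
  forall M, exists p, G p /\ M < dist2 (0, 0) p.

(** Polygonal grating data: breakpoints t_0 < ... < t_{m-1} in [0,2pi) of one period,
    the profile f, and the impedance of piece j (from t_j to t_{j+1}, with
    t_m := t_0 + 2 pi); [None] encodes eta = infinity (Dirichlet). *)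
Record pgrating := PGrating { bp : list R; gf : R -> R; geta : nat -> option C }.

Definition nbp (g : pgrating) : nat := length (bp g).
Definition T (g : pgrating) (j : nat) : R :=
  if (j <? nbp g)%nat then nth j (bp g) 0 else nth 0 (bp g) 0 + 2 * PI.
Definition Tprev (g : pgrating) (j : nat) : R :=
  if (j =? 0)%nat then nth (nbp g - 1) (bp g) 0 - 2 * PI else nth (j - 1) (bp g) 0.

Definition admissible (g : pgrating) : Prop :=
  (forall x, gf g (x + 2 * PI) = gf g x) /\
  (forall j, (j < nbp g)%nat -> 0 <= nth j (bp g) 0 < 2 * PI) /\
  (forall j, (S j < nbp g)%nat -> nth j (bp g) 0 < nth (S j) (bp g) 0) /\
  (nbp g = 0%nat -> forall x y, gf g x = gf g y) /\
  (forall j, (j < nbp g)%nat ->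
     exists a c, forall x, T g j <= x <= T g (S j) -> gf g x = a * x + c).

Definition on_piece (g : pgrating) (j : nat) (x1 : R) : Prop :=
  (nbp g = 0%nat /\ j = 0%nat) \/
  ((j < nbp g)%nat /\ exists n : Z, T g j < x1 + 2 * PI * IZR n < T g (S j)).

Definition Omega (g : pgrating) (p : pt) : Prop := snd p > gf g (fst p).
Definition Lambda (g : pgrating) (p : pt) : Prop := snd p = gf g (fst p).

Definition corner (g : pgrating) (p : pt) : Prop :=
  exists (j : nat) (n : Z), (j < nbp g)%nat /\
    p = (T g j + 2 * PI * IZR n, gf g (T g j)).

Definition corner_angle (g : pgrating) (j : nat) : R :=
  let vx := Tprev g j - T g j in
  let vy := gf g (Tprev g j) - gf g (T g j) in
  let wx := T g (S j) - T g j in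
  let wy := gf g (T g (S j)) - gf g (T g j) in
  acos ((vx * wx + vy * wy) / (sqrt (vx^2 + vy^2) * sqrt (wx^2 + wy^2))).

Definition irrational_grating (g : pgrating) : Prop :=
  forall j, (j < nbp g)%nat ->
    forall p q : Z, q <> 0%Z -> corner_angle g j * IZR q <> IZR p * PI.

Definition D1 (h : pt -> R) (p : pt) : R := Derive (fun t => h (t, snd p)) (fst p).
Definition D2 (h : pt -> R) (p : pt) : R := Derive (fun t => h (fst p, t)) (snd p).
Definition ex_D1 (h : pt -> R) (p : pt) : Prop := ex_derive (fun t => h (t, snd p)) (fst p).
Definition ex_D2 (h : pt -> R) (p : pt) : Prop := ex_derive (fun t => h (fst p, t)) (snd p).

Definition C2_at (h : pt -> R) (p : pt) : Prop :=
  ex_D1 h p /\ ex_D2 h p /\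
  ex_D1 (D1 h) p /\ ex_D2 (D1 h) p /\ ex_D1 (D2 h) p /\ ex_D2 (D2 h) p /\
  continuous h p /\ continuous (D1 h) p /\ continuous (D2 h) p /\
  continuous (D1 (D1 h)) p /\ continuous (D2 (D1 h)) p /\
  continuous (D1 (D2 h)) p /\ continuous (D2 (D2 h)) p.

Definition ReF (u : pt -> C) : pt -> R := fun p => fst (u p).
Definition ImF (u : pt -> C) : pt -> R := fun p => snd (u p).
Definition D1c (u : pt -> C) (p : pt) : C := (D1 (ReF u) p, D1 (ImF u) p).
Definition D2c (u : pt -> C) (p : pt) : C := (D2 (ReF u) p, D2 (ImF u) p).

Definition helmholtz_on (Om : pt -> Prop) (k : R) (u : pt -> C) : Prop :=
  forall p, Om p ->
    C2_at (ReF u) p /\ C2_at (ImF u) p /\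
    D1 (D1 (ReF u)) p + D2 (D2 (ReF u)) p + k^2 * ReF u p = 0 /\
    D1 (D1 (ImF u)) p + D2 (D2 (ImF u)) p + k^2 * ImF u p = 0.

(** boundary condition at the boundary point (x1, f x1) lying on piece j:
    u = 0 if eta = infinity, d_nu u + eta u = 0 otherwise, boundary values of u and
    of its gradient being the limits from inside Omega_f. nu is the unit normal
    (f'(x1), -1)/sqrt(1+f'(x1)^2). *)
Definition bc_at (g : pgrating) (j : nat) (u : pt -> C) (x1 : R) : Prop :=
  let p : pt := (x1, gf g x1) in
  let s := Derive (gf g) x1 in
  let nu1 := s / sqrt (1 + s^2) in
  let nu2 := -1 / sqrt (1 + s^2) in
  match geta g j with
  | None => filterlim u (within (Omega g) (locally p)) (locally (RtoC 0))
  | Some eta =>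
      exists a d1 d2 : C,
        filterlim u (within (Omega g) (locally p)) (locally a) /\
        filterlim (D1c u) (within (Omega g) (locally p)) (locally d1) /\
        filterlim (D2c u) (within (Omega g) (locally p)) (locally d2) /\
        Cplus (Cplus (Cmult (RtoC nu1) d1) (Cmult (RtoC nu2) d2)) (Cmult eta a) = RtoC 0
  end.

Definition uinc (k theta : R) (p : pt) : C :=
  cexp (0, k * (sin theta * fst p - cos theta * snd p)).
Definition alpha_n (k theta : R) (n : Z) : R := IZR n + k * sin theta.
Definition beta_n (k theta : R) (n : Z) : C :=
  let a := alpha_n k theta n in
  if Rle_dec (Rabs a) k then (sqrt (k^2 - a^2), 0) else (0, sqrt (a^2 - k^2)).

Fixpoint zsum (F : Z -> C) (N : nat) : C :=
  match N with
  | O => F 0%Z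
  | S M => Cplus (Cplus (zsum F M) (F (Z.of_nat (S M)))) (F (- Z.of_nat (S M))%Z)
  end.

Definition rayleigh_term (k theta : R) (c : Z -> C) (p : pt) (n : Z) : C :=
  Cmult (c n) (cexp (Cmult Ci (Cplus (RtoC (alpha_n k theta n * fst p))
                                       (Cmult (beta_n k theta n) (RtoC (snd p)))))).

Definition total_field (g : pgrating) (k theta : R) (u : pt -> C) : Prop :=
  helmholtz_on (Omega g) k u /\
  (forall (j : nat) (x1 : R), on_piece g j x1 -> bc_at g j u x1) /\
  (forall p : pt, Omega g p ->
     u (fst p + 2 * PI, snd p) = Cmult (cexp (0, 2 * (k * sin theta) * PI)) (u p)) /\
  (exists c : Z -> C, forall p : pt, (forall t, gf g t < snd p) ->
     filterlim (fun N => zsum (rayleigh_term k theta c p) N) eventually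
       (locally (Cminus (u p) (uinc k theta p)))).

(* Main.v *)
Require Import Defs.
From Stdlib Require Import Reals Lra Lia ZArith List Psatz FunctionalExtensionality Classical.
From Coquelicot Require Import Coquelicot.
Open Scope R_scope.

(* Equality on [Gamma_b] determines the Rayleigh coefficients, so [u = ut] above [b], and by unique
   continuation on the whole of [Omega_f ∩ Omega_ft].  If a corner [p] of [Lambda_f] lay in
   [Omega_ft], some nontrivial combination [w] of [ut1], [ut2] would vanish at [p], solve the
   Helmholtz equation near [p] and satisfy the boundary conditions on both edges.  The lowest order
   homogeneous Taylor polynomial of [w] at [p], of degree [N >= 1], is harmonic, and each edge of
   direction [phi] gives one relation [cos psi * A + sin psi * B = 0] between its two coefficients,
   with [psi = N phi] (Dirichlet) or [psi = N phi - PI / 2] (impedance).  Irrationality of the angle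
   makes the two relations independent; hence [w] is flat at [p], so [w = 0], which contradicts the
   presence of two different incident waves.

   Regularity and unique continuation come from the mean value property: the mean of [h] over a
   circle of radius [r] is [h p] times the one of [cos (k x1)] over a circle about 0.
   Differentiating it expresses the gradient of [h] as a circle integral of [h] itself. *)

(** * Plane calculus and circle integrals *)

(** The circle means of a solution and those of cos (k x1) obey one and the same Bessel equation of
    order 0, so no special function has to be built. The Rayleigh series is only known to converge
    pointwise and in symmetric partial sums, which does not allow term by term integration. Its
    coefficients are therefore reached through a linear bound on the terms at a slightly lower
    height, which the evanescent factors turn into geometric decay; averages over equidistant nodes
    then read them off. At the corner, [u] carries the boundary conditions of Lambda_f but [ut] is
    the function that is smooth across Lambda_f; equality on the common domain moves the conditions
    to [ut]. An impedance condition by itself does not fix the value at [p], so the induction on the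
    degree can start only once w p = 0: a combination of two fields achieves this, whence the two
    directions. If one edge is Dirichlet and the other impedance, their phases differ by an extra PI
    / 2, and irrationality is applied to twice the angle. *)

Definition box (p : pt) (r : R) (q : pt) : Prop :=
  Rabs (fst q - fst p) < r /\ Rabs (snd q - snd p) < r.

(** [box p e] is, up to conversion, the ball of the product uniform structure, which makes squares
    handier than discs. *)
Lemma locally_box (p : pt) (P : pt -> Prop) :
  locally p P <-> exists e, 0 < e /\ forall q, box p e q -> P q.
Proof.
  split.
  - intros [e He]. exists e. split; [apply cond_pos|]. intros q Hq. now apply He.
  - intros [e [He H]]. exists (mkposreal e He). intros q Hq. now apply H.
Qed.

Lemma box_open (p : pt) (r : R) : open (box p r).
Proof.
  intros [q1 q2] [H1 H2]. apply locally_box. simpl in H1, H2.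
  exists (Rmin (r - Rabs (q1 - fst p)) (r - Rabs (q2 - snd p))). split.
  - apply Rmin_glb_lt; lra.
  - intros [z1 z2] [Z1 Z2]. simpl in Z1, Z2.
    pose proof (Rmin_l (r - Rabs (q1 - fst p)) (r - Rabs (q2 - snd p))).
    pose proof (Rmin_r (r - Rabs (q1 - fst p)) (r - Rabs (q2 - snd p))).
    split; simpl.
    + replace (z1 - fst p) with ((z1 - q1) + (q1 - fst p)) by ring.
      eapply Rle_lt_trans; [apply Rabs_triang|]. lra.
    + replace (z2 - snd p) with ((z2 - q2) + (q2 - snd p)) by ring.
      eapply Rle_lt_trans; [apply Rabs_triang|]. lra.
Qed.

Lemma box_trans (p q z : pt) (r s : R) : box p r q -> box q s z -> box p (r + s) z.
Proof.
  intros [H1 H2] [H3 H4]. split.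
  - replace (fst z - fst p) with ((fst z - fst q) + (fst q - fst p)) by ring.
    eapply Rle_lt_trans; [apply Rabs_triang|]. lra.
  - replace (snd z - snd p) with ((snd z - snd q) + (snd q - snd p)) by ring.
    eapply Rle_lt_trans; [apply Rabs_triang|]. lra.
Qed.

Lemma box_center (p : pt) (r : R) : 0 < r -> box p r p.
Proof. intros; split; unfold Rminus; rewrite Rplus_opp_r, Rabs_R0; lra. Qed.

Lemma box_le (p q : pt) (r s : R) : r <= s -> box p r q -> box p s q.
Proof. intros ? [? ?]; split; lra. Qed.

Lemma locally_slice1 (p : pt) (P : pt -> Prop) :
  locally p P -> locally (fst p) (fun t => P (t, snd p)).
Proof.
  intros [e He]. exists e. intros t Ht. apply He. split; [exact Ht|].
  apply ball_center.
Qed.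

Lemma locally_slice2 (p : pt) (P : pt -> Prop) :
  locally p P -> locally (snd p) (fun t => P (fst p, t)).
Proof.
  intros [e He]. exists e. intros t Ht. apply He. split; [|exact Ht].
  apply ball_center.
Qed.

Lemma D1_ext_loc (f g : pt -> R) (p : pt) :
  locally p (fun q => f q = g q) -> D1 f p = D1 g p.
Proof.
  intros H. unfold D1. apply Derive_ext_loc.
  now apply (locally_slice1 p (fun q => f q = g q)).
Qed.

Lemma D2_ext_loc (f g : pt -> R) (p : pt) :
  locally p (fun q => f q = g q) -> D2 f p = D2 g p.
Proof.
  intros H. unfold D2. apply Derive_ext_loc.
  now apply (locally_slice2 p (fun q => f q = g q)).
Qed.

Definition C1on (Om : pt -> Prop) (h : pt -> R) : Prop :=
  forall p, Om p ->
    ex_D1 h p /\ ex_D2 h p /\ continuous h p /\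
    continuous (D1 h) p /\ continuous (D2 h) p.

Definition C2on (Om : pt -> Prop) (h : pt -> R) : Prop :=
  C1on Om h /\ C1on Om (D1 h) /\ C1on Om (D2 h).

Definition eqon (Om : pt -> Prop) (f g : pt -> R) : Prop := forall p, Om p -> f p = g p.

Lemma eqon_loc (Om : pt -> Prop) (f g : pt -> R) :
  open Om -> eqon Om f g -> forall p, Om p -> locally p (fun q => f q = g q).
Proof.
  intros HO H p Hp. generalize (HO p Hp). apply filter_imp. exact H.
Qed.

Lemma eqon_sym (Om : pt -> Prop) (f g : pt -> R) : eqon Om f g -> eqon Om g f.
Proof. intros H p Hp. symmetry. now apply H. Qed.

Lemma eqon_D1 (Om : pt -> Prop) (f g : pt -> R) :
  open Om -> eqon Om f g -> eqon Om (D1 f) (D1 g).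
Proof. intros HO H p Hp. apply D1_ext_loc. now apply (eqon_loc Om). Qed.

Lemma eqon_D2 (Om : pt -> Prop) (f g : pt -> R) :
  open Om -> eqon Om f g -> eqon Om (D2 f) (D2 g).
Proof. intros HO H p Hp. apply D2_ext_loc. now apply (eqon_loc Om). Qed.

Lemma continuous_eqon (Om : pt -> Prop) (f g : pt -> R) (p : pt) :
  open Om -> eqon Om f g -> Om p -> continuous f p -> continuous g p.
Proof.
  intros HO H Hp. apply continuous_ext_loc. now apply (eqon_loc Om).
Qed.

Lemma C1on_ext (Om : pt -> Prop) (f g : pt -> R) :
  open Om -> eqon Om f g -> C1on Om f -> C1on Om g.
Proof.
  intros HO H Hf p Hp. destruct (Hf p Hp) as (a & b & c & d & e).
  pose proof (eqon_loc Om f g HO H p Hp) as HL.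
  repeat split.
  - unfold ex_D1 in *. eapply ex_derive_ext_loc; [|exact a].
    now apply (locally_slice1 p (fun q => f q = g q)).
  - unfold ex_D2 in *. eapply ex_derive_ext_loc; [|exact b].
    now apply (locally_slice2 p (fun q => f q = g q)).
  - now apply (continuous_eqon Om f g).
  - apply (continuous_eqon Om (D1 f) (D1 g)); trivial. now apply eqon_D1.
  - apply (continuous_eqon Om (D2 f) (D2 g)); trivial. now apply eqon_D2.
Qed.

Lemma C2on_ext (Om : pt -> Prop) (f g : pt -> R) :
  open Om -> eqon Om f g -> C2on Om f -> C2on Om g.
Proof.
  intros HO H (a & b & c). split; [|split].
  - now apply (C1on_ext Om f g).
  - apply (C1on_ext Om (D1 f)); trivial. now apply eqon_D1.
  - apply (C1on_ext Om (D2 f)); trivial. now apply eqon_D2.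
Qed.

Lemma C1on_sub (O1 O2 : pt -> Prop) (f : pt -> R) :
  (forall p, O1 p -> O2 p) -> C1on O2 f -> C1on O1 f.
Proof. intros H Hf p Hp. apply Hf. now apply H. Qed.

Lemma C2on_sub (O1 O2 : pt -> Prop) (f : pt -> R) :
  (forall p, O1 p -> O2 p) -> C2on O2 f -> C2on O1 f.
Proof. intros H (a & b & c). split; [|split]; now apply (C1on_sub O1 O2). Qed.

Lemma C1on_cont (Om : pt -> Prop) (f : pt -> R) :
  C1on Om f -> forall p, Om p -> continuous f p.
Proof. intros H p Hp. destruct (H p Hp) as (_ & _ & c & _ & _). exact c. Qed.

Lemma C1on_cont1 (Om : pt -> Prop) (f : pt -> R) :
  C1on Om f -> forall p, Om p -> continuous (D1 f) p.
Proof. intros H p Hp. destruct (H p Hp) as (_ & _ & _ & c & _). exact c. Qed.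

Lemma C1on_cont2 (Om : pt -> Prop) (f : pt -> R) :
  C1on Om f -> forall p, Om p -> continuous (D2 f) p.
Proof. intros H p Hp. destruct (H p Hp) as (_ & _ & _ & _ & c). exact c. Qed.

Lemma C1on_differentiable (Om : pt -> Prop) (h : pt -> R) (x y : R) :
  open Om -> C1on Om h -> Om (x, y) ->
  differentiable_pt_lim (fun u v => h (u, v)) x y (D1 h (x, y)) (D2 h (x, y)).
Proof.
  intros HO Hh Hp. apply filterdiff_differentiable_pt_lim.
  apply (is_derive_filterdiff (fun u v => h (u, v)) x y (fun u v => D1 h (u, v))).
  - generalize (HO (x, y) Hp). apply filter_imp. intros [u v] Hu.
    destruct (Hh (u, v) Hu) as [E _]. apply Derive_correct in E. exact E.
  - destruct (Hh (x, y) Hp) as (_ & E & _). apply Derive_correct in E. exact E.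
  - destruct (Hh (x, y) Hp) as (_ & _ & _ & E & _).
    apply (continuous_ext (D1 h)); [|exact E]. now intros [? ?].
Qed.

Lemma is_derive_curve (Om : pt -> Prop) (h : pt -> R) (a b : R -> R) (t la lb : R) :
  open Om -> C1on Om h -> Om (a t, b t) ->
  is_derive a t la -> is_derive b t lb ->
  is_derive (fun s => h (a s, b s)) t (la * D1 h (a t, b t) + lb * D2 h (a t, b t)).
Proof.
  intros HO Hh Hp Ha Hb. apply is_derive_Reals.
  rewrite (Rmult_comm la), (Rmult_comm lb).
  apply (derivable_pt_lim_comp_2d (fun u v => h (u, v))).
  - now apply (C1on_differentiable Om).
  - now apply is_derive_Reals.
  - now apply is_derive_Reals.
Qed.

Lemma D1D2_comm (Om : pt -> Prop) (h : pt -> R) :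
  open Om -> C2on Om h -> eqon Om (D1 (D2 h)) (D2 (D1 h)).
Proof.
  intros HO (A & B & C) [x y] Hp. unfold D1, D2; simpl.
  apply (Schwarz (fun u v => h (u, v)) x y).
  - destruct (proj1 (locally_box (x, y) Om) (HO _ Hp)) as [e [He Hb]].
    exists (mkposreal e He). intros u v Hu Hv.
    assert (Hq : Om (u, v)) by (apply Hb; split; assumption).
    destruct (A _ Hq) as (a1 & a2 & _). destruct (B _ Hq) as (b1 & b2 & _).
    destruct (C _ Hq) as (c1 & c2 & _). repeat split; assumption.
  - apply continuity_2d_pt_filterlim. destruct (C _ Hp) as (_ & _ & _ & c & _).
    apply (continuous_ext (D1 (D2 h))); [|exact c]. now intros [? ?].
  - apply continuity_2d_pt_filterlim. destruct (B _ Hp) as (_ & _ & _ & _ & c).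
    apply (continuous_ext (D2 (D1 h))); [|exact c]. now intros [? ?].
Qed.

Lemma continuous_pair_comp (T : UniformSpace) (h : pt -> R) (a b : T -> R) (t : T) :
  continuous a t -> continuous b t -> continuous h (a t, b t) ->
  continuous (fun s => h (a s, b s)) t.
Proof.
  intros Ha Hb Hh. apply (continuous_comp_2 a b (fun u v => h (u, v)) t Ha Hb).
  apply (continuous_ext h); [now intros [? ?]|exact Hh].
Qed.

(** Without a factor [r] and without normalisation it makes sense for [r = 0] and for negative [r],
    so that it can be differentiated in [r] at 0. The weights [cos] and [sin] extract the first
    angular Fourier coefficients. *)
Definition circ (h : pt -> R) (p : pt) (r : R) (w : R -> R) : R :=
  RInt (fun t => h (fst p + r * cos t, snd p + r * sin t) * w t) 0 (2 * PI).

(** The slack [e] makes this set open and leaves room to move the circle while differentiating. *)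
Definition inner (Om : pt -> Prop) (r : R) (p : pt) : Prop :=
  exists e, 0 < e /\ forall q, box p (r + e) q -> Om q.

Lemma inner_open (Om : pt -> Prop) (r : R) : open (inner Om r).
Proof.
  intros p (e & He & H). apply locally_box. exists (e / 2). split; [lra|].
  intros q Hq. exists (e / 2). split; [lra|]. intros z Hz. apply H.
  replace (r + e) with (e / 2 + (r + e / 2)) by lra. now apply (box_trans p q z).
Qed.

Lemma inner_mono (Om : pt -> Prop) (r s : R) (p : pt) : s <= r -> inner Om r p -> inner Om s p.
Proof.
  intros Hr (e & He & H). exists e. split; trivial. intros q Hq. apply H.
  apply (box_le p q (s + e)); trivial. lra.
Qed.

Lemma circle_in_box (p : pt) (r s t : R) :
  Rabs r < s -> box p s (fst p + r * cos t, snd p + r * sin t).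
Proof.
  intros Hr. split; simpl.
  - replace (fst p + r * cos t - fst p) with (r * cos t) by ring.
    rewrite Rabs_mult. pose proof (Rabs_pos r).
    assert (Rabs (cos t) <= 1) by (apply Rabs_le; apply COS_bound). nra.
  - replace (snd p + r * sin t - snd p) with (r * sin t) by ring.
    rewrite Rabs_mult. pose proof (Rabs_pos r).
    assert (Rabs (sin t) <= 1) by (apply Rabs_le; apply SIN_bound). nra.
Qed.

Lemma inner_circle (Om : pt -> Prop) (r s t : R) (p : pt) :
  Rabs r <= s -> inner Om s p -> Om (fst p + r * cos t, snd p + r * sin t).
Proof.
  intros Hr (e & He & H). apply H. apply circle_in_box. lra.
Qed.

Lemma continuous_cos_R (t : R) : continuous cos t.
Proof. apply continuity_pt_filterlim, continuity_cos. Qed.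

Lemma continuous_sin_R (t : R) : continuous sin t.
Proof. apply continuity_pt_filterlim, continuity_sin. Qed.

Lemma circ_integrand_continuous (Om : pt -> Prop) (h : pt -> R) (p : pt) (r s t : R) (w : R -> R) :
  (forall q, Om q -> continuous h q) -> inner Om s p -> Rabs r <= s -> continuous w t ->
  continuous (fun t => h (fst p + r * cos t, snd p + r * sin t) * w t) t.
Proof.
  intros Hh Hp Hr Hw.
  apply (continuous_mult (fun t => h (fst p + r * cos t, snd p + r * sin t)) w); trivial.
  apply (continuous_pair_comp R_UniformSpace h).
  - apply (continuous_plus (fun _ => fst p)); [apply continuous_const|].
    apply (continuous_mult (fun _ => r)); [apply continuous_const|]. apply continuous_cos_R.
  - apply (continuous_plus (fun _ => snd p)); [apply continuous_const|].
    apply (continuous_mult (fun _ => r)); [apply continuous_const|]. apply continuous_sin_R.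
  - apply Hh. now apply (inner_circle Om r s).
Qed.

Lemma circ_ex (Om : pt -> Prop) (h : pt -> R) (p : pt) (r s : R) (w : R -> R) :
  (forall q, Om q -> continuous h q) -> inner Om s p -> Rabs r <= s ->
  (forall t, continuous w t) ->
  ex_RInt (fun t => h (fst p + r * cos t, snd p + r * sin t) * w t) 0 (2 * PI).
Proof.
  intros Hh Hp Hr Hw. apply (ex_RInt_continuous (V := R_CompleteNormedModule)).
  intros t _. now apply (circ_integrand_continuous Om h p r s).
Qed.

Lemma circ_plus_weight (Om : pt -> Prop) (h : pt -> R) (p : pt) (r s : R) (w1 w2 : R -> R) :
  (forall q, Om q -> continuous h q) -> inner Om s p -> Rabs r <= s ->
  (forall t, continuous w1 t) -> (forall t, continuous w2 t) ->
  circ h p r (fun t => w1 t + w2 t) = circ h p r w1 + circ h p r w2.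
Proof.
  intros Hh Hp Hr H1 H2. unfold circ.
  rewrite <- (RInt_plus (V := R_CompleteNormedModule)) by now apply (circ_ex Om h p r s).
  apply RInt_ext. intros. unfold plus; simpl. ring.
Qed.

Lemma circ_plus (Om : pt -> Prop) (h1 h2 : pt -> R) (p : pt) (r s : R) (w : R -> R) :
  (forall q, Om q -> continuous h1 q) -> (forall q, Om q -> continuous h2 q) ->
  inner Om s p -> Rabs r <= s -> (forall t, continuous w t) ->
  circ (fun q => h1 q + h2 q) p r w = circ h1 p r w + circ h2 p r w.
Proof.
  intros Hh1 Hh2 Hp Hr H1. unfold circ.
  rewrite <- (RInt_plus (V := R_CompleteNormedModule)) by now apply (circ_ex Om _ p r s).
  apply RInt_ext. intros. unfold plus; simpl. ring.
Qed.

Lemma circ_scal (Om : pt -> Prop) (h : pt -> R) (p : pt) (r s c : R) (w : R -> R) :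
  (forall q, Om q -> continuous h q) ->
  inner Om s p -> Rabs r <= s -> (forall t, continuous w t) ->
  circ (fun q => c * h q) p r w = c * circ h p r w.
Proof.
  intros Hh1 Hp Hr H1. unfold circ.
  rewrite <- (RInt_scal (V := R_CompleteNormedModule)) by now apply (circ_ex Om _ p r s).
  apply RInt_ext. intros. unfold scal; simpl. unfold mult; simpl. ring.
Qed.

Lemma circ_ext (Om : pt -> Prop) (h1 h2 : pt -> R) (p : pt) (r s : R) (w : R -> R) :
  eqon Om h1 h2 -> inner Om s p -> Rabs r <= s -> circ h1 p r w = circ h2 p r w.
Proof.
  intros H Hp Hr. unfold circ. apply RInt_ext. intros t _. f_equal. apply H.
  now apply (inner_circle Om r s).
Qed.

Lemma circ_weight_ext (h : pt -> R) (p : pt) (r : R) (w1 w2 : R -> R) :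
  (forall t, w1 t = w2 t) -> circ h p r w1 = circ h p r w2.
Proof. intros H. unfold circ. apply RInt_ext. intros t _. now rewrite H. Qed.

Lemma circ_bound (Om : pt -> Prop) (h : pt -> R) (p : pt) (r s M : R) (w : R -> R) :
  (forall q, Om q -> continuous h q) -> inner Om s p -> Rabs r <= s ->
  (forall t, continuous w t) -> (forall t, Rabs (w t) <= 1) ->
  (forall q, Om q -> Rabs (h q) <= M) ->
  Rabs (circ h p r w) <= 2 * PI * M.
Proof.
  intros Hh Hp Hr Hw Hw1 HM. unfold circ.
  replace (2 * PI * M) with ((2 * PI - 0) * M) by ring.
  apply abs_RInt_le_const.
  - pose proof PI_RGT_0; lra.
  - now apply (circ_ex Om h p r s).
  - intros t _. rewrite Rabs_mult.
    pose proof (HM _ (inner_circle Om r s t p Hr Hp)). pose proof (Hw1 t).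
    pose proof (Rabs_pos (w t)).
    pose proof (Rabs_pos (h (fst p + r * cos t, snd p + r * sin t))). nra.
Qed.

(** Centre and radius move together along a line, so that one differentiation under the integral
    yields the derivatives in the radius and in both coordinates of the centre. *)
Lemma is_derive_circ (Om : pt -> Prop) (h : pt -> R) (p : pt) (r v1 v2 v3 s0 rho : R) (w : R -> R) :
  open Om -> C1on Om h -> (forall t, continuous w t) ->
  inner Om rho (fst p + s0 * v1, snd p + s0 * v2) -> Rabs (r + s0 * v3) <= rho ->
  is_derive (fun s => circ h (fst p + s * v1, snd p + s * v2) (r + s * v3) w) s0
    (circ (D1 h) (fst p + s0 * v1, snd p + s0 * v2) (r + s0 * v3) (fun t => (v1 + v3 * cos t) * w t)
     + circ (D2 h) (fst p + s0 * v1, snd p + s0 * v2) (r + s0 * v3) (fun t => (v2 + v3 * sin t) * w t)).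
Proof.
  intros HO Hh Hw Hi Hr.
  set (a := fun s t => fst p + s * v1 + (r + s * v3) * cos t).
  set (b := fun s t => snd p + s * v2 + (r + s * v3) * sin t).
  set (df := fun s t => ((v1 + v3 * cos t) * D1 h (a s t, b s t)
                         + (v2 + v3 * sin t) * D2 h (a s t, b s t)) * w t).
  destruct Hi as (e & He & Hi).
  (* [N] bounds the speed of the moving circle, and the 1 keeps it positive; for [s] within
     [e / (2 * N)] of [s0] at most half of the slack is used up. *)
  set (N := Rabs v1 + Rabs v2 + Rabs v3 + 1).
  assert (HN : 0 < N) by (unfold N; pose proof (Rabs_pos v1); pose proof (Rabs_pos v2);
    pose proof (Rabs_pos v3); lra).
  assert (Hd : 0 < e / (2 * N)) by (apply Rdiv_lt_0_compat; lra).
  assert (HNe : N * (e / (2 * N)) = e / 2) by (field; lra).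
  assert (Hin : forall s, Rabs (s - s0) < e / (2 * N) ->
            inner Om (Rabs (r + s * v3)) (fst p + s * v1, snd p + s * v2)).
  { intros s Hs. exists (e / 2). split; [lra|]. intros q Hq. apply Hi.
    set (k := e / (2 * N)) in *.
    pose proof (Rabs_pos v1); pose proof (Rabs_pos v2); pose proof (Rabs_pos v3).
    pose proof (Rabs_pos (s - s0)) as Hp0.
    assert (B1 : Rabs ((s - s0) * v1) <= Rabs v1 * k) by (rewrite Rabs_mult; nra).
    assert (B2 : Rabs ((s - s0) * v2) <= Rabs v2 * k) by (rewrite Rabs_mult; nra).
    assert (B3 : Rabs ((s - s0) * v3) <= Rabs v3 * k) by (rewrite Rabs_mult; nra).
    assert (Hrr : Rabs (r + s * v3) <= rho + Rabs v3 * k).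
    { replace (r + s * v3) with ((r + s0 * v3) + (s - s0) * v3) by ring.
      eapply Rle_trans; [apply Rabs_triang|]. lra. }
    assert (P1 : 0 <= Rabs v1 * k) by nra. assert (P2 : 0 <= Rabs v2 * k) by nra.
    assert (P3 : 0 <= Rabs v3 * k) by nra.
    assert (HS : Rabs v1 * k + Rabs v2 * k + Rabs v3 * k + k = e / 2)
      by (rewrite <- HNe; unfold N; ring).
    destruct Hq as [q1 q2]. simpl in *. split; simpl.
    - replace (fst q - (fst p + s0 * v1)) with ((fst q - (fst p + s * v1)) + (s - s0) * v1) by ring.
      eapply Rle_lt_trans; [apply Rabs_triang|]. lra.
    - replace (snd q - (snd p + s0 * v2)) with ((snd q - (snd p + s * v2)) + (s - s0) * v2) by ring.
      eapply Rle_lt_trans; [apply Rabs_triang|]. lra. }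
  assert (Hab : forall s t, Rabs (s - s0) < e / (2 * N) -> Om (a s t, b s t)).
  { intros s t Hs. apply (inner_circle Om (r + s * v3) (Rabs (r + s * v3)) t
      (fst p + s * v1, snd p + s * v2)); [lra|]. now apply Hin. }
  assert (Hdf : forall s t, Rabs (s - s0) < e / (2 * N) ->
    is_derive (fun s => h (a s t, b s t) * w t) s (df s t)).
  { intros s t Hs. unfold df.
    apply (is_derive_ext (fun s => scal (w t) (h (a s t, b s t)))).
    { intros; unfold scal; simpl; unfold mult; simpl; ring. }
    replace ((_ + _) * w t) with (scal (w t) ((v1 + v3 * cos t) * D1 h (a s t, b s t)
                         + (v2 + v3 * sin t) * D2 h (a s t, b s t)))
      by (unfold scal; simpl; unfold mult; simpl; ring).
    apply (is_derive_scal (fun s => h (a s t, b s t))).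
    apply (is_derive_curve Om h (fun s => a s t) (fun s => b s t)); trivial.
    - now apply Hab.
    - unfold a. auto_derive; trivial. ring.
    - unfold b. auto_derive; trivial. ring. }
  assert (Hloc : locally s0 (fun s => Rabs (s - s0) < e / (2 * N))).
  { exists (mkposreal _ Hd). intros s Hs. exact Hs. }
  assert (Hs0 : Rabs (s0 - s0) < e / (2 * N))
    by (unfold Rminus; rewrite Rplus_opp_r, Rabs_R0; exact Hd).
  assert (Hmain : is_derive (fun s => RInt (fun t => h (a s t, b s t) * w t) 0 (2 * PI)) s0
     (RInt (fun t => Derive (fun s => h (a s t, b s t) * w t) s0) 0 (2 * PI))).
  { apply (is_derive_RInt_param (fun s t => h (a s t, b s t) * w t)).
    - revert Hloc. apply filter_imp. intros s Hs t _. exists (df s t). now apply Hdf.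
    - intros t _. apply (continuity_2d_pt_ext_loc df).
      + exists (mkposreal _ Hd). intros u v Hu _. symmetry. apply is_derive_unique.
        now apply Hdf.
      + apply continuity_2d_pt_filterlim.
        assert (C1 : continuous (fun z : R * R => fst z) (s0, t)) by apply continuous_fst.
        assert (C2 : continuous (fun z : R * R => snd z) (s0, t)) by apply continuous_snd.
        assert (Cc : continuous (fun z : R * R => cos (snd z)) (s0, t))
          by (apply (continuous_comp snd cos); [exact C2|apply continuous_cos_R]).
        assert (Cs : continuous (fun z : R * R => sin (snd z)) (s0, t))
          by (apply (continuous_comp snd sin); [exact C2|apply continuous_sin_R]).
        assert (Cl : forall c d, continuous (fun z : R * R => c + fst z * d) (s0, t)).
        { intros c d. apply (continuous_plus (fun _ => c)); [apply continuous_const|].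
          apply (continuous_mult fst (fun _ => d)); [exact C1|apply continuous_const]. }
        assert (Ca : continuous (fun z : R * R => a (fst z) (snd z)) (s0, t)).
        { unfold a. apply (continuous_plus (fun z : R * R => fst p + fst z * v1)); [apply Cl|].
          apply (continuous_mult (fun z : R * R => r + fst z * v3)); [apply Cl|exact Cc]. }
        assert (Cb : continuous (fun z : R * R => b (fst z) (snd z)) (s0, t)).
        { unfold b. apply (continuous_plus (fun z : R * R => snd p + fst z * v2)); [apply Cl|].
          apply (continuous_mult (fun z : R * R => r + fst z * v3)); [apply Cl|exact Cs]. }
        destruct (Hh _ (Hab s0 t Hs0)) as (_ & _ & _ & c1 & c2).
        change (continuous (fun z : R * R => df (fst z) (snd z)) (s0, t)).
        unfold df.
        apply (continuous_mult (fun z : R * R => (v1 + v3 * cos (snd z)) * D1 h (a (fst z) (snd z), b (fst z) (snd z)) +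
           (v2 + v3 * sin (snd z)) * D2 h (a (fst z) (snd z), b (fst z) (snd z)))).
        2:{ apply (continuous_comp snd w); [exact C2|apply Hw]. }
        apply (continuous_plus (fun z : R * R => (v1 + v3 * cos (snd z)) * D1 h (a (fst z) (snd z), b (fst z) (snd z)))).
        * apply (continuous_mult (fun z : R * R => (v1 + v3 * cos (snd z)))).
          -- apply (continuous_plus (fun _ => v1)); [apply continuous_const|].
             apply (continuous_mult (fun _ => v3)); [apply continuous_const|exact Cc].
          -- now apply (continuous_pair_comp _ (D1 h)).
        * apply (continuous_mult (fun z : R * R => (v2 + v3 * sin (snd z)))).
          -- apply (continuous_plus (fun _ => v2)); [apply continuous_const|].
             apply (continuous_mult (fun _ => v3)); [apply continuous_const|exact Cs].
          -- now apply (continuous_pair_comp _ (D2 h)).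
    - revert Hloc. apply filter_imp. intros s Hs.
      apply (circ_ex Om h (fst p + s * v1, snd p + s * v2) (r + s * v3) (Rabs (r + s * v3))).
      + now apply C1on_cont.
      + now apply Hin.
      + lra.
      + exact Hw. }
  match type of Hmain with is_derive _ _ ?x =>
    match goal with |- is_derive _ _ ?y => replace y with x; [exact Hmain|] end end.
  unfold circ. rewrite <- (RInt_plus (V := R_CompleteNormedModule)).
  - apply RInt_ext. intros t _. transitivity (df s0 t).
    + apply is_derive_unique. now apply Hdf.
    + unfold df, plus; simpl. unfold a, b. ring.
  - apply (circ_ex Om (D1 h) (fst p + s0 * v1, snd p + s0 * v2) (r + s0 * v3) (Rabs (r + s0 * v3))).
    + now apply C1on_cont1.
    + now apply Hin.
    + lra.
    + intros t. apply (continuous_mult (fun t => v1 + v3 * cos t)); [|apply Hw].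
      apply (continuous_plus (fun _ => v1)); [apply continuous_const|].
      apply (continuous_mult (fun _ => v3)); [apply continuous_const|apply continuous_cos_R].
  - apply (circ_ex Om (D2 h) (fst p + s0 * v1, snd p + s0 * v2) (r + s0 * v3) (Rabs (r + s0 * v3))).
    + now apply C1on_cont2.
    + now apply Hin.
    + lra.
    + intros t. apply (continuous_mult (fun t => v2 + v3 * sin t)); [|apply Hw].
      apply (continuous_plus (fun _ => v2)); [apply continuous_const|].
      apply (continuous_mult (fun _ => v3)); [apply continuous_const|apply continuous_sin_R].
Qed.

Lemma RInt_ext_R (f g : R -> R) (a b : R) :
  (forall x, f x = g x) -> RInt f a b = RInt g a b.
Proof. intros H. apply RInt_ext. intros; apply H. Qed.

Lemma is_derive_circ_radius (Om : pt -> Prop) (h : pt -> R) (p : pt) (r rho : R) (w : R -> R) :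
  open Om -> C1on Om h -> (forall t, continuous w t) -> inner Om rho p -> Rabs r <= rho ->
  is_derive (fun s => circ h p s w) r
    (circ (D1 h) p r (fun t => cos t * w t) + circ (D2 h) p r (fun t => sin t * w t)).
Proof.
  intros HO Hh Hw Hp Hr. destruct p as [p1 p2].
  pose proof (is_derive_circ Om h (p1, p2) 0 0 0 1 r rho w HO Hh Hw) as H. simpl in H.
  rewrite !Rmult_0_r, !Rplus_0_r, Rplus_0_l, Rmult_1_r in H.
  specialize (H Hp Hr).
  rewrite (circ_weight_ext _ _ _ (fun t => cos t * w t) (fun t => (0 + 1 * cos t) * w t))
    by (intros; ring).
  rewrite (circ_weight_ext _ _ _ (fun t => sin t * w t) (fun t => (0 + 1 * sin t) * w t))
    by (intros; ring).
  eapply is_derive_ext; [|exact H]. intros t; simpl.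
  now rewrite Rmult_0_r, !Rplus_0_r, Rplus_0_l, Rmult_1_r.
Qed.

Lemma is_derive_circ1 (Om : pt -> Prop) (h : pt -> R) (p : pt) (r rho : R) (w : R -> R) :
  open Om -> C1on Om h -> (forall t, continuous w t) -> inner Om rho p -> Rabs r <= rho ->
  is_derive (fun s => circ h (s, snd p) r w) (fst p) (circ (D1 h) p r w).
Proof.
  intros HO Hh Hw Hp Hr. destruct p as [p1 p2].
  pose proof (is_derive_circ Om h (0, p2) r 1 0 0 p1 rho w HO Hh Hw) as H. simpl in H |- *.
  rewrite !Rmult_0_r, !Rplus_0_r, Rplus_0_l, Rmult_1_r in H.
  specialize (H Hp Hr).
  rewrite (circ_weight_ext _ _ _ (fun t => (1 + 0 * cos t) * w t) w) in H by (intros; ring).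
  replace (circ (D2 h) (p1, p2) r (fun t => (0 + 0 * sin t) * w t)) with 0 in H.
  - rewrite Rplus_0_r in H. eapply is_derive_ext; [|exact H]. intros t; simpl.
    now rewrite !Rmult_0_r, !Rplus_0_r, Rplus_0_l, Rmult_1_r.
  - unfold circ. rewrite (RInt_ext_R _ (fun _ => 0)) by (intros; ring).
    rewrite RInt_const. unfold scal; simpl; unfold mult; simpl. ring.
Qed.

Lemma is_derive_circ2 (Om : pt -> Prop) (h : pt -> R) (p : pt) (r rho : R) (w : R -> R) :
  open Om -> C1on Om h -> (forall t, continuous w t) -> inner Om rho p -> Rabs r <= rho ->
  is_derive (fun s => circ h (fst p, s) r w) (snd p) (circ (D2 h) p r w).
Proof.
  intros HO Hh Hw Hp Hr. destruct p as [p1 p2].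
  pose proof (is_derive_circ Om h (p1, 0) r 0 1 0 p2 rho w HO Hh Hw) as H. simpl in H |- *.
  rewrite !Rmult_0_r, !Rplus_0_r, Rplus_0_l, Rmult_1_r in H.
  specialize (H Hp Hr).
  rewrite (circ_weight_ext _ _ _ (fun t => (1 + 0 * sin t) * w t) w) in H by (intros; ring).
  replace (circ (D1 h) (p1, p2) r (fun t => (0 + 0 * cos t) * w t)) with 0 in H.
  - rewrite Rplus_0_l in H. eapply is_derive_ext; [|exact H]. intros t; simpl.
    now rewrite !Rmult_0_r, !Rplus_0_r, Rplus_0_l, Rmult_1_r.
  - unfold circ. rewrite (RInt_ext_R _ (fun _ => 0)) by (intros; ring).
    rewrite RInt_const. unfold scal; simpl; unfold mult; simpl. ring.
Qed.

(** Uniform continuity of [h] on the closed square of half-side [r + e / 2] controls the integrand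
    for all angles at once. *)
Lemma circ_continuous (Om : pt -> Prop) (h : pt -> R) (p : pt) (r : R) (w : R -> R) :
  (forall q, Om q -> continuous h q) -> (forall t, continuous w t) ->
  (forall t, Rabs (w t) <= 1) -> 0 <= r -> inner Om r p ->
  continuous (fun q => circ h q r w) p.
Proof.
  intros Hh Hw Hw1 Hr Hp. pose proof PI_RGT_0 as HPI.
  destruct p as [p1 p2]. destruct (Hp) as (e & He & Hi).
  apply filterlim_locally. intros eps.
  assert (Heps : 0 < eps / (4 * PI)) by (apply Rdiv_lt_0_compat; [apply cond_pos|lra]).
  set (m := r + e / 2).
  destruct (uniform_continuity_2d (fun u v => h (u, v)) (p1 - m) (p1 + m) (p2 - m) (p2 + m))
    with (eps := mkposreal _ Heps) as [d Hd].
  { intros x y Hx Hy. apply continuity_2d_pt_filterlim.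
    apply (continuous_ext h (fun z => h (fst z, snd z)) (x, y)); [now intros [? ?]|]. apply Hh, Hi.
    split; simpl; apply Rabs_def1; unfold m in *; lra. }
  assert (Hmin : 0 < Rmin d (e / 2)) by (apply Rmin_glb_lt; [apply cond_pos|lra]).
  apply locally_box. exists (Rmin d (e / 2)). split; trivial.
  intros [q1 q2] [Q1 Q2]. simpl in Q1, Q2.
  pose proof (Rmin_l d (e / 2)). pose proof (Rmin_r d (e / 2)).
  assert (Hq : inner Om r (q1, q2)).
  { exists (e / 2). split; [lra|]. intros z Hz. apply Hi.
    replace (r + e) with (e / 2 + (r + e / 2)) by lra. apply (box_trans _ (q1, q2)); trivial.
    split; simpl; lra. }
  change (Rabs (circ h (q1, q2) r w - circ h (p1, p2) r w) < eps).
  unfold circ.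
  assert (Habs : Rabs r <= r) by (rewrite Rabs_pos_eq; lra).
  match goal with |- Rabs (?x - ?y) < _ => replace (x - y) with (minus x y) by reflexivity end.
  rewrite <- (RInt_minus (V := R_CompleteNormedModule)).
  2: now apply (circ_ex Om h (q1, q2) r r).
  2: now apply (circ_ex Om h (p1, p2) r r).
  apply Rle_lt_trans with ((2 * PI - 0) * (eps / (4 * PI))).
  - apply abs_RInt_le_const; [lra| |].
    + apply (ex_RInt_minus (V := R_CompleteNormedModule)).
      * now apply (circ_ex Om h (q1, q2) r r).
      * now apply (circ_ex Om h (p1, p2) r r).
    + intros t _. unfold minus, plus, opp; simpl.
      set (x1 := r * cos t). set (x2 := r * sin t).
      assert (B1 : Rabs x1 <= r).
      { unfold x1. rewrite Rabs_mult, (Rabs_pos_eq r) by lra.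
        assert (Rabs (cos t) <= 1) by (apply Rabs_le; apply COS_bound). nra. }
      assert (B2 : Rabs x2 <= r).
      { unfold x2. rewrite Rabs_mult, (Rabs_pos_eq r) by lra.
        assert (Rabs (sin t) <= 1) by (apply Rabs_le; apply SIN_bound). nra. }
      apply Rabs_le_between in B1. apply Rabs_le_between in B2.
      apply Rabs_def2 in Q1. apply Rabs_def2 in Q2.
      replace (h (q1 + x1, q2 + x2) * w t + - (h (p1 + x1, p2 + x2) * w t))
        with ((h (q1 + x1, q2 + x2) - h (p1 + x1, p2 + x2)) * w t) by ring.
      rewrite Rabs_mult.
      assert (HD : Rabs (h (q1 + x1, q2 + x2) - h (p1 + x1, p2 + x2)) < eps / (4 * PI)).
      { apply (Hd (p1 + x1) (p2 + x2) (q1 + x1) (q2 + x2)); unfold m; try lra.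
        - apply Rabs_def1; lra.
        - apply Rabs_def1; lra. }
      pose proof (Hw1 t). pose proof (Rabs_pos (w t)).
      pose proof (Rabs_pos (h (q1 + x1, q2 + x2) - h (p1 + x1, p2 + x2))). nra.
  - replace ((2 * PI - 0) * (eps / (4 * PI))) with (eps / 2) by (field; lra).
    pose proof (cond_pos eps). lra.
Qed.

Section CircRegular.

Variables (Om : pt -> Prop) (w : R -> R) (r : R).
Hypothesis HO : open Om.
Hypothesis Hw : forall t, continuous w t.
Hypothesis Hw1 : forall t, Rabs (w t) <= 1.
Hypothesis Hr : 0 <= r.

Let Hrr : Rabs r <= r.
Proof. rewrite Rabs_pos_eq; lra. Qed.

Lemma D1_circ (h : pt -> R) :
  C1on Om h -> eqon (inner Om r) (D1 (fun q => circ h q r w)) (fun q => circ (D1 h) q r w).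
Proof.
  intros Hh p Hp. unfold D1 at 1. apply is_derive_unique.
  now apply (is_derive_circ1 Om h p r r).
Qed.

Lemma D2_circ (h : pt -> R) :
  C1on Om h -> eqon (inner Om r) (D2 (fun q => circ h q r w)) (fun q => circ (D2 h) q r w).
Proof.
  intros Hh p Hp. unfold D2 at 1. apply is_derive_unique.
  now apply (is_derive_circ2 Om h p r r).
Qed.

Lemma C1on_circ (h : pt -> R) :
  C1on Om h -> C1on (inner Om r) (fun q => circ h q r w).
Proof.
  intros Hh p Hp. split; [|split; [|split; [|split]]].
  - exists (circ (D1 h) p r w). now apply (is_derive_circ1 Om h p r r).
  - exists (circ (D2 h) p r w). now apply (is_derive_circ2 Om h p r r).
  - apply (circ_continuous Om); trivial. now apply C1on_cont.
  - apply (continuous_eqon (inner Om r) (fun q => circ (D1 h) q r w)); trivial.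
    + apply inner_open.
    + now apply eqon_sym, D1_circ.
    + apply (circ_continuous Om); trivial. now apply C1on_cont1.
  - apply (continuous_eqon (inner Om r) (fun q => circ (D2 h) q r w)); trivial.
    + apply inner_open.
    + now apply eqon_sym, D2_circ.
    + apply (circ_continuous Om); trivial. now apply C1on_cont2.
Qed.

Lemma C2on_circ (h : pt -> R) :
  C2on Om h -> C2on (inner Om r) (fun q => circ h q r w).
Proof.
  intros (A & B & C). split; [|split].
  - now apply C1on_circ.
  - apply (C1on_ext (inner Om r) (fun q => circ (D1 h) q r w)).
    + apply inner_open.
    + now apply eqon_sym, D1_circ.
    + now apply C1on_circ.
  - apply (C1on_ext (inner Om r) (fun q => circ (D2 h) q r w)).
    + apply inner_open.
    + now apply eqon_sym, D2_circ.
    + now apply C1on_circ.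
Qed.

End CircRegular.

(** * Green's identity for circle means of Helmholtz solutions *)

Definition sol (k : R) (Om : pt -> Prop) (h : pt -> R) : Prop :=
  C2on Om h /\ forall p, Om p -> D1 (D1 h) p + D2 (D2 h) p + k ^ 2 * h p = 0.

(** The derivative of [h * w] along the circle integrates to zero over a period; the tangential
    derivative of [h] contributes the factor [r]. *)
Lemma circ_by_parts (Om : pt -> Prop) (h : pt -> R) (p : pt) (r rho : R) (w dw : R -> R) :
  open Om -> C1on Om h -> inner Om rho p -> Rabs r <= rho ->
  (forall t, is_derive w t (dw t)) -> (forall t, continuous dw t) -> w (2 * PI) = w 0 ->
  circ h p r dw = r * (circ (D1 h) p r (fun t => sin t * w t) - circ (D2 h) p r (fun t => cos t * w t)).
Proof.
  intros HO Hh Hp Hr Hw Hdw Hper.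
  assert (Cw : forall t, continuous w t)
    by (intros t; apply (ex_derive_continuous (V := R_NormedModule) w t); exists (dw t); apply Hw).
  assert (Csw : forall t, continuous (fun t => sin t * w t) t)
    by (intros t; apply (continuous_mult sin w); [apply continuous_sin_R|apply Cw]).
  assert (Ccw : forall t, continuous (fun t => cos t * w t) t)
    by (intros t; apply (continuous_mult cos w); [apply continuous_cos_R|apply Cw]).
  set (a := fun t => fst p + r * cos t). set (b := fun t => snd p + r * sin t).
  set (df := fun t => plus (minus (h (a t, b t) * dw t)
     (scal r (D1 h (a t, b t) * (sin t * w t)))) (scal r (D2 h (a t, b t) * (cos t * w t)))).
  assert (E1 := circ_ex Om h p r rho dw (C1on_cont _ _ Hh) Hp Hr Hdw).
  assert (E2 := circ_ex Om (D1 h) p r rho _ (C1on_cont1 _ _ Hh) Hp Hr Csw).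
  assert (E3 := circ_ex Om (D2 h) p r rho _ (C1on_cont2 _ _ Hh) Hp Hr Ccw).
  assert (HI : RInt df 0 (2 * PI) = 0).
  { apply is_RInt_unique.
    replace 0 with (minus (h (a (2 * PI), b (2 * PI)) * w (2 * PI)) (h (a 0, b 0) * w 0)) at 2.
    2:{ unfold a, b. rewrite Hper, cos_2PI, sin_2PI, cos_0, sin_0. unfold minus, plus, opp; simpl. ring. }
    apply (is_RInt_derive (fun t => h (a t, b t) * w t)).
    - intros t _. unfold df.
      assert (Hc : is_derive (fun t => h (a t, b t)) t
         (- r * sin t * D1 h (a t, b t) + r * cos t * D2 h (a t, b t))).
      { apply (is_derive_curve Om h a b); trivial.
        - now apply (inner_circle Om r rho).
        - unfold a. auto_derive; trivial. ring.
        - unfold b. auto_derive; trivial. ring. }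
      pose proof (is_derive_mult (fun t => h (a t, b t)) w t _ _ Hc (Hw t) Rmult_comm) as Hm.
      match type of Hm with is_derive _ _ ?x =>
        match goal with |- is_derive _ _ ?y => replace y with x; [exact Hm|] end end.
      unfold plus, minus, scal, opp; simpl; unfold mult; simpl. unfold plus; simpl. ring.
    - intros t _. unfold df.
      apply (continuous_plus (V := R_NormedModule)); [apply (continuous_minus (V := R_NormedModule))|].
      + apply (circ_integrand_continuous Om h p r rho); trivial. now apply C1on_cont.
      + apply (continuous_scal_r (V := R_NormedModule)).
        apply (circ_integrand_continuous Om (D1 h) p r rho); trivial. now apply C1on_cont1.
      + apply (continuous_scal_r (V := R_NormedModule)).
        apply (circ_integrand_continuous Om (D2 h) p r rho); trivial. now apply C1on_cont2. }
  unfold df in HI.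
  rewrite (RInt_plus (V := R_CompleteNormedModule)), (RInt_minus (V := R_CompleteNormedModule)),
    !(RInt_scal (V := R_CompleteNormedModule)) in HI; trivial.
  - unfold plus, minus, opp, scal in HI; simpl in HI; unfold mult in HI; simpl in HI.
    unfold plus in HI; simpl in HI.
    unfold circ. unfold a, b in HI. lra.
  - now apply (ex_RInt_scal (V := R_NormedModule)).
  - apply (ex_RInt_minus (V := R_NormedModule)); trivial.
    now apply (ex_RInt_scal (V := R_NormedModule)).
  - now apply (ex_RInt_scal (V := R_NormedModule)).
Qed.

Definition cst1 (t : R) : R := 1.

Lemma continuous_cst1 (t : R) : continuous cst1 t.
Proof. apply continuous_const. Qed.

Lemma continuous_prod_R (f g : R -> R) (t : R) :
  continuous f t -> continuous g t -> continuous (fun t => f t * g t) t.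
Proof. intros; now apply (continuous_mult f g). Qed.

(** The integral of the radial derivative over the angle; [r * radial h p r] is the flux of the
    gradient through the circle. *)
Definition radial (h : pt -> R) (p : pt) (r : R) : R :=
  circ (D1 h) p r cos + circ (D2 h) p r sin.

Lemma is_derive_mean (Om : pt -> Prop) (h : pt -> R) (p : pt) (r rho : R) :
  open Om -> C1on Om h -> inner Om rho p -> Rabs r <= rho ->
  is_derive (fun s => circ h p s cst1) r (radial h p r).
Proof.
  intros HO Hh Hp Hr.
  pose proof (is_derive_circ_radius Om h p r rho cst1 HO Hh continuous_cst1 Hp Hr) as H.
  unfold radial.
  rewrite (circ_weight_ext _ _ _ cos (fun t => cos t * cst1 t)) by (intros; unfold cst1; ring).
  rewrite (circ_weight_ext _ _ _ sin (fun t => sin t * cst1 t)) by (intros; unfold cst1; ring).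
  exact H.
Qed.

Definition wcc (t : R) := cos t * cos t.
Definition wss (t : R) := sin t * sin t.
Definition wsc (t : R) := sin t * cos t.

Lemma continuous_wcc (t : R) : continuous wcc t.
Proof. apply continuous_prod_R; apply continuous_cos_R. Qed.
Lemma continuous_wss (t : R) : continuous wss t.
Proof. apply continuous_prod_R; apply continuous_sin_R. Qed.
Lemma continuous_wsc (t : R) : continuous wsc t.
Proof. apply continuous_prod_R; [apply continuous_sin_R|apply continuous_cos_R]. Qed.

Lemma circ_cos_by_parts (Om : pt -> Prop) (h : pt -> R) (p : pt) (r rho : R) :
  open Om -> C1on Om h -> inner Om rho p -> Rabs r <= rho ->
  circ h p r cos = r * (circ (D1 h) p r wss - circ (D2 h) p r wsc).
Proof.
  intros HO Hh Hp Hr.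
  rewrite (circ_by_parts Om h p r rho sin cos); trivial.
  - f_equal. f_equal. apply circ_weight_ext. intros; unfold wsc; ring.
  - intros; auto_derive; trivial; ring.
  - intros; apply continuous_cos_R.
  - now rewrite sin_2PI, sin_0.
Qed.

Lemma circ_sin_by_parts (Om : pt -> Prop) (h : pt -> R) (p : pt) (r rho : R) :
  open Om -> C1on Om h -> inner Om rho p -> Rabs r <= rho ->
  circ h p r sin = r * (circ (D2 h) p r wcc - circ (D1 h) p r wsc).
Proof.
  intros HO Hh Hp Hr.
  rewrite (circ_by_parts Om h p r rho (fun t => - cos t) sin); trivial.
  - unfold circ. f_equal.
    rewrite (RInt_ext_R _ (fun t => opp (D1 h (fst p + r * cos t, snd p + r * sin t) * wsc t)))
      by (intros; unfold opp, wsc; simpl; ring).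
    rewrite (RInt_opp (V := R_CompleteNormedModule)).
    2: apply (circ_ex Om (D1 h) p r rho); trivial; [now apply C1on_cont1|apply continuous_wsc].
    rewrite (RInt_ext_R (fun t => D2 h (fst p + r * cos t, snd p + r * sin t) * (cos t * - cos t))
       (fun t => opp (D2 h (fst p + r * cos t, snd p + r * sin t) * wcc t)))
      by (intros; unfold opp, wcc; simpl; ring).
    rewrite (RInt_opp (V := R_CompleteNormedModule)).
    2: apply (circ_ex Om (D2 h) p r rho); trivial; [now apply C1on_cont2|apply continuous_wcc].
    unfold opp; simpl. ring.
  - intros; auto_derive; trivial; ring.
  - intros; apply continuous_sin_R.
  - now rewrite cos_2PI, cos_0.
Qed.

(** The explicit factor [r] gives the value 0 at radius 0 and spares [is_derive_flux] a division by
    [r]. *)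
Lemma radial_by_parts (Om : pt -> Prop) (h : pt -> R) (p : pt) (r rho : R) :
  open Om -> C2on Om h -> inner Om rho p -> Rabs r <= rho ->
  radial h p r = r * (circ (D1 (D1 h)) p r wss - circ (D2 (D1 h)) p r wsc
                      + circ (D2 (D2 h)) p r wcc - circ (D1 (D2 h)) p r wsc).
Proof.
  intros HO (A & B & C) Hp Hr. unfold radial.
  rewrite (circ_cos_by_parts Om (D1 h) p r rho), (circ_sin_by_parts Om (D2 h) p r rho); trivial.
  ring.
Qed.

(** Bessel's equation (r M')' = - k^2 r M for the circle mean M. The weights that come from
    differentiating [radial] and those of [radial_by_parts] are complementary: the pure second
    derivatives add up to the Laplacian and the mixed ones cancel. *)
Lemma is_derive_flux (k : R) (Om : pt -> Prop) (h : pt -> R) (p : pt) (r rho : R) :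
  open Om -> sol k Om h -> inner Om rho p -> Rabs r <= rho ->
  is_derive (fun s => s * radial h p s) r (- k ^ 2 * r * circ h p r cst1).
Proof.
  intros HO [(A & B & C) HE] Hp Hr.
  assert (H1 := is_derive_circ_radius Om (D1 h) p r rho cos HO B continuous_cos_R Hp Hr).
  assert (H2 := is_derive_circ_radius Om (D2 h) p r rho sin HO C continuous_sin_R Hp Hr).
  assert (H3 := is_derive_plus _ _ _ _ _ H1 H2).
  assert (Hid : is_derive (fun s : R => s) r 1) by (auto_derive; trivial).
  assert (H4 := is_derive_mult (fun s : R => s) _ r _ _ Hid H3 Rmult_comm).
  match type of H4 with is_derive _ _ ?x =>
    match goal with |- is_derive _ _ ?y => replace y with x; [exact H4|] end end.
  unfold plus, mult; simpl. unfold mult; simpl.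
  fold (radial h p r).
  rewrite (radial_by_parts Om h p r rho); trivial; [|now split].
  change (circ (D2 (D1 h)) p r (fun t => sin t * cos t)) with (circ (D2 (D1 h)) p r wsc).
  change (circ (D1 (D1 h)) p r (fun t => cos t * cos t)) with (circ (D1 (D1 h)) p r wcc).
  change (circ (D2 (D2 h)) p r (fun t => sin t * sin t)) with (circ (D2 (D2 h)) p r wss).
  rewrite (circ_weight_ext (D1 (D2 h)) _ _ (fun t => cos t * sin t) wsc) by (intros; unfold wsc; ring).
  assert (S : forall f, (forall q, Om q -> continuous f q) ->
     circ f p r wcc + circ f p r wss = circ f p r cst1).
  { intros f Hf. rewrite <- (circ_plus_weight Om f p r rho); trivial;
      [|apply continuous_wcc|apply continuous_wss].
    apply circ_weight_ext. intros t. unfold wcc, wss, cst1.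
    pose proof (sin2_cos2 t) as Q. unfold Rsqr in Q. lra. }
  assert (HL : circ (D1 (D1 h)) p r cst1 + circ (D2 (D2 h)) p r cst1 = - k ^ 2 * circ h p r cst1).
  { rewrite <- (circ_plus Om _ _ p r rho); trivial;
      [|now apply C1on_cont1|now apply C1on_cont2|apply continuous_cst1].
    rewrite <- (circ_scal Om h p r rho); trivial; [|now apply C1on_cont|apply continuous_cst1].
    apply (circ_ext Om) with rho; trivial. intros q Hq. specialize (HE q Hq). lra. }
  pose proof (S (D1 (D1 h)) (C1on_cont1 _ _ B)) as S1.
  pose proof (S (D2 (D2 h)) (C1on_cont2 _ _ C)) as S2.
  transitivity (r * (- k ^ 2 * circ h p r cst1)); [|ring].
  rewrite <- HL, <- S1, <- S2. ring.
Qed.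

(** * Mean value property *)

Lemma sol_C2 (k : R) (Om : pt -> Prop) (h : pt -> R) : sol k Om h -> C2on Om h.
Proof. intros H. exact (proj1 H). Qed.

Lemma sol_C1 (k : R) (Om : pt -> Prop) (h : pt -> R) : sol k Om h -> C1on Om h.
Proof. intros H. exact (proj1 (proj1 H)). Qed.

Lemma radial_0 (Om : pt -> Prop) (h : pt -> R) (p : pt) (rho : R) :
  open Om -> C2on Om h -> 0 <= rho -> inner Om rho p -> radial h p 0 = 0.
Proof.
  intros HO Hh Hr Hp. rewrite (radial_by_parts Om h p 0 rho); trivial; [ring|].
  rewrite Rabs_R0; lra.
Qed.

Lemma circ_0 (h : pt -> R) (p : pt) : circ h p 0 cst1 = 2 * PI * h p.
Proof.
  unfold circ. rewrite (RInt_ext_R _ (fun _ => h p)).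
  - rewrite RInt_const. unfold scal; simpl; unfold mult; simpl. ring.
  - intros t. rewrite !Rmult_0_l, !Rplus_0_r. destruct p. unfold cst1. simpl. ring.
Qed.

Definition plane (p : pt) : Prop := True.

Lemma plane_open : open plane.
Proof. intros p _. apply filter_forall. intros; exact I. Qed.

Lemma inner_plane (r : R) (p : pt) : inner plane r p.
Proof. exists 1. split; [lra|]. intros; exact I. Qed.

(** A reference solution whose derivatives are explicit and whose circle means are easily bounded
    below. *)
Definition wave (k : R) (q : pt) : R := cos (k * fst q).

Lemma C1on_fst (f df : R -> R) :
  (forall t, is_derive f t (df t)) -> (forall t, continuous df t) ->
  C1on plane (fun q => f (fst q)) /\ D1 (fun q => f (fst q)) = (fun q => df (fst q))
  /\ D2 (fun q => f (fst q)) = (fun _ => 0).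
Proof.
  intros Hf Hdf.
  assert (E1 : D1 (fun q => f (fst q)) = (fun q => df (fst q))).
  { apply functional_extensionality. intros q. unfold D1. simpl.
    apply is_derive_unique. apply Hf. }
  assert (E2 : D2 (fun q => f (fst q)) = (fun _ => 0)).
  { apply functional_extensionality. intros q. unfold D2. simpl. apply Derive_const. }
  split; [|split; trivial]. intros p _. rewrite E1, E2.
  split; [|split; [|split; [|split]]].
  - exists (df (fst p)). apply Hf.
  - apply (ex_derive_const (f (fst p))).
  - apply (continuous_comp fst f); [apply continuous_fst|].
    apply (ex_derive_continuous (V := R_NormedModule) f). exists (df (fst p)). apply Hf.
  - apply (continuous_comp fst df); [apply continuous_fst|apply Hdf].
  - apply continuous_const.
Qed.

Lemma wave_sol (k : R) : sol k plane (wave k).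
Proof.
  assert (D : forall t, is_derive (fun t => cos (k * t)) t (- k * sin (k * t)))
    by (intros; auto_derive; trivial; ring).
  assert (D' : forall t, is_derive (fun t => - k * sin (k * t)) t (- k ^ 2 * cos (k * t)))
    by (intros; auto_derive; trivial; ring).
  assert (D'' : forall t, is_derive (fun t => - k ^ 2 * cos (k * t)) t (k ^ 3 * sin (k * t)))
    by (intros; auto_derive; trivial; ring).
  assert (Z : forall t, is_derive (fun _ : R => 0) t 0)
    by (intros; auto_derive; trivial; ring).
  assert (Cz : forall t : R, continuous (fun _ : R => 0) t) by (intros; apply continuous_const).
  assert (C : forall t, continuous (fun t => - k * sin (k * t)) t).
  { intros t. apply (ex_derive_continuous (V := R_NormedModule) (fun t => - k * sin (k * t))).
    eexists; apply D'. }
  assert (C' : forall t, continuous (fun t => - k ^ 2 * cos (k * t)) t).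
  { intros t. apply (ex_derive_continuous (V := R_NormedModule) (fun t => - k ^ 2 * cos (k * t))).
    eexists; apply D''. }
  destruct (C1on_fst _ _ D C) as (A1 & A2 & A3).
  destruct (C1on_fst _ _ D' C') as (B1 & B2 & B3).
  destruct (C1on_fst _ _ Z Cz) as (Z1 & Z2 & Z3).
  unfold sol, C2on, wave. rewrite A2, A3.
  split; [split; [exact A1|split; [exact B1|exact Z1]]|].
  intros p _. rewrite B2. unfold D2. rewrite Derive_const. ring.
Qed.

(** This is 2 PI J_0 (k r). *)
Definition bessel_mean (k r : R) : R := circ (wave k) (0, 0) r cst1.

Lemma cos_ge_half (x : R) : Rabs x <= 1 -> 1 / 2 <= cos x.
Proof.
  intros Hx. pose proof PI2_3_2. rewrite <- cos_PI3.
  assert (Ec : cos x = cos (Rabs x)).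
  { unfold Rabs. destruct (Rcase_abs x); trivial. now rewrite cos_neg. }
  rewrite Ec. apply cos_decr_1; try lra. apply Rabs_pos.
Qed.

(** On circles with [k * r <= 1] the cosine stays above 1 / 2, so that one may divide by the
    reference mean; this is the origin of the later conditions [k * r <= 1]. *)
Lemma bessel_mean_ge (k r : R) : 0 < k -> 0 <= r -> k * r <= 1 -> PI <= bessel_mean k r.
Proof.
  intros Hk Hr Hkr. pose proof PI_RGT_0 as HPI. unfold bessel_mean, circ.
  replace PI with (RInt (fun _ => 1 / 2) 0 (2 * PI)) at 1.
  2:{ rewrite RInt_const. unfold scal; simpl; unfold mult; simpl. lra. }
  apply RInt_le; [lra|apply ex_RInt_const| |].
  - apply (circ_ex plane (wave k) (0, 0) r (Rabs r)); [|apply inner_plane|lra|apply continuous_cst1].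
    apply (C1on_cont plane). exact (sol_C1 _ _ _ (wave_sol k)).
  - intros t _. unfold cst1, wave. simpl. rewrite Rmult_1_r, Rplus_0_l.
    set (x := k * (r * cos t)).
    assert (Hx : Rabs x <= 1).
    { unfold x. rewrite !Rabs_mult, (Rabs_pos_eq k), (Rabs_pos_eq r) by lra.
      assert (Rabs (cos t) <= 1) by (apply Rabs_le; apply COS_bound).
      pose proof (Rabs_pos (cos t)). nra. }
    now apply cos_ge_half.
Qed.

(** The means of [h] and of [wave k] solve the same singular equation and both have zero flux at
    radius 0; their Wronskian vanishes, hence their quotient is constant. *)
Lemma mean_value (k : R) (Om : pt -> Prop) (h : pt -> R) (p : pt) (r : R) :
  0 < k -> open Om -> sol k Om h -> 0 <= r -> k * r <= 1 -> inner Om r p ->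
  circ h p r cst1 = h p * bessel_mean k r.
Proof.
  intros Hk HO Hh Hr Hkr Hp. pose proof PI_RGT_0 as HPI.
  destruct (Req_dec r 0) as [E|E].
  { subst. unfold bessel_mean. rewrite !circ_0. unfold wave. simpl. rewrite Rmult_0_r, cos_0.
    assert (X : 2 * PI * h p = h p * (2 * PI * 1)) by ring. exact X. }
  assert (Hr0 : 0 < r) by lra. clear E.
  set (M := fun s => circ h p s cst1). set (P := fun s => radial h p s).
  set (PJ := fun s => radial (wave k) (0, 0) s).
  assert (dM : forall s, 0 <= s <= r -> is_derive M s (P s)).
  { intros s Hs. apply (is_derive_mean Om h p s r); trivial; [now apply (sol_C1 k)|].
    rewrite Rabs_pos_eq; lra. }
  assert (dJ : forall s, 0 <= s <= r -> is_derive (bessel_mean k) s (PJ s)).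
  { intros s Hs. apply (is_derive_mean plane (wave k) (0, 0) s r);
      [apply plane_open|exact (sol_C1 _ _ _ (wave_sol k))|apply inner_plane|rewrite Rabs_pos_eq; lra]. }
  assert (dP : forall s, 0 <= s <= r -> is_derive (fun s => s * P s) s (- k ^ 2 * s * M s)).
  { intros s Hs. apply (is_derive_flux k Om h p s r); trivial. rewrite Rabs_pos_eq; lra. }
  assert (dPJ : forall s, 0 <= s <= r -> is_derive (fun s => s * PJ s) s (- k ^ 2 * s * bessel_mean k s)).
  { intros s Hs. apply (is_derive_flux k plane (wave k) (0, 0) s r);
      [apply plane_open|apply wave_sol|apply inner_plane|rewrite Rabs_pos_eq; lra]. }
  (* The Wronskian times the radius: the factor [s] removes the singularity at 0, and the flux
     equations make the derivative vanish. *)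
  set (W := fun s => (s * P s) * bessel_mean k s - M s * (s * PJ s)).
  assert (dW : forall s, 0 <= s <= r -> is_derive W s zero).
  { intros s Hs. unfold W.
    pose proof (is_derive_minus _ _ _ _ _
      (is_derive_mult (fun s => s * P s) (bessel_mean k) s _ _ (dP s Hs) (dJ s Hs) Rmult_comm)
      (is_derive_mult M (fun s => s * PJ s) s _ _ (dM s Hs) (dPJ s Hs) Rmult_comm)) as X.
    match type of X with is_derive _ _ ?x =>
      match goal with |- is_derive _ _ ?y => replace y with x; [exact X|] end end.
    unfold minus, plus, opp, mult, zero; simpl. unfold mult; simpl. ring. }
  assert (W0 : forall s, 0 <= s <= r -> W s = 0).
  { intros s Hs. assert (W 0 = 0) by (unfold W; ring).
    destruct (Req_dec s 0) as [->|E]; trivial.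
    rewrite <- H. symmetry. apply (eq_is_derive W 0 s); [|lra].
    intros t Ht. apply dW. lra. }
  assert (P0 : P 0 = 0) by (apply (radial_0 Om h p r); trivial; now apply (sol_C2 k)).
  assert (PJ0 : PJ 0 = 0)
    by (apply (radial_0 plane (wave k) (0, 0) r);
      [apply plane_open|exact (sol_C2 _ _ _ (wave_sol k))|trivial|apply inner_plane]).
  assert (PM : forall s, 0 <= s <= r -> P s * bessel_mean k s = M s * PJ s).
  { intros s Hs. destruct (Req_dec s 0) as [->|E]; [rewrite P0, PJ0; ring|].
    specialize (W0 s Hs). unfold W in W0. apply (Rmult_eq_reg_l s); trivial. lra. }
  assert (JP : forall s, 0 <= s <= r -> 0 < bessel_mean k s).
  { intros s Hs. apply Rlt_le_trans with PI; trivial. apply bessel_mean_ge; trivial; [lra|nra]. }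
  (* By [PM] the quotient has derivative zero; its value at radius 0 is [h p]. *)
  assert (Hq : M r / bessel_mean k r = M 0 / bessel_mean k 0).
  { symmetry. apply (eq_is_derive (fun s => M s / bessel_mean k s) 0 r); trivial.
    intros s Hs. assert (bessel_mean k s <> 0) by (pose proof (JP s Hs); lra).
    pose proof (is_derive_div M (bessel_mean k) s _ _ (dM s Hs) (dJ s Hs) H) as X.
    match type of X with is_derive _ _ ?x =>
      match goal with |- is_derive _ _ ?y => replace y with x; [exact X|] end end.
    unfold zero; simpl. pose proof (PM s Hs) as Q.
    replace (P s * bessel_mean k s - M s * PJ s) with 0 by lra. apply Rmult_0_l. }
  assert (J0 : bessel_mean k 0 = 2 * PI).
  { unfold bessel_mean. rewrite circ_0. unfold wave. simpl. rewrite Rmult_0_r, cos_0. apply Rmult_1_r. }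
  assert (M0 : M 0 = 2 * PI * h p) by exact (circ_0 h p).
  rewrite M0, J0 in Hq.
  assert (HJ : bessel_mean k r <> 0) by (apply Rgt_not_eq, JP; lra).
  change (M r = h p * bessel_mean k r).
  replace (M r) with (M r / bessel_mean k r * bessel_mean k r) by (field; exact HJ).
  rewrite Hq. field. lra.
Qed.

(** * Interior regularity *)

Definition lin (a : R) (f : pt -> R) (b : R) (g : pt -> R) (q : pt) : R := a * f q + b * g q.

Lemma D1_lin (Om : pt -> Prop) (a b : R) (f g : pt -> R) :
  C1on Om f -> C1on Om g -> eqon Om (D1 (lin a f b g)) (lin a (D1 f) b (D1 g)).
Proof.
  intros Hf Hg p Hp. destruct (Hf p Hp) as (E1 & _). destruct (Hg p Hp) as (E2 & _).
  unfold D1 at 1, lin. apply is_derive_unique. apply Derive_correct in E1, E2.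
  exact (is_derive_plus _ _ _ _ _ (is_derive_scal _ _ a _ E1) (is_derive_scal _ _ b _ E2)).
Qed.

Lemma D2_lin (Om : pt -> Prop) (a b : R) (f g : pt -> R) :
  C1on Om f -> C1on Om g -> eqon Om (D2 (lin a f b g)) (lin a (D2 f) b (D2 g)).
Proof.
  intros Hf Hg p Hp. destruct (Hf p Hp) as (_ & E1 & _). destruct (Hg p Hp) as (_ & E2 & _).
  unfold D2 at 1, lin. apply is_derive_unique. apply Derive_correct in E1, E2.
  exact (is_derive_plus _ _ _ _ _ (is_derive_scal _ _ a _ E1) (is_derive_scal _ _ b _ E2)).
Qed.

Lemma continuous_lin (a b : R) (f g : pt -> R) (p : pt) :
  continuous f p -> continuous g p -> continuous (lin a f b g) p.
Proof.
  intros Hf Hg. unfold lin. apply (continuous_plus (V := R_NormedModule)).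
  - now apply (continuous_scal_r (V := R_NormedModule) a f).
  - now apply (continuous_scal_r (V := R_NormedModule) b g).
Qed.

Lemma C1on_lin (Om : pt -> Prop) (a b : R) (f g : pt -> R) :
  open Om -> C1on Om f -> C1on Om g -> C1on Om (lin a f b g).
Proof.
  intros HO Hf Hg p Hp.
  destruct (Hf p Hp) as (f1 & f2 & f3 & f4 & f5). destruct (Hg p Hp) as (g1 & g2 & g3 & g4 & g5).
  split; [|split; [|split; [|split]]].
  - apply Derive_correct in f1, g1. eexists.
    exact (is_derive_plus _ _ _ _ _ (is_derive_scal _ _ a _ f1) (is_derive_scal _ _ b _ g1)).
  - apply Derive_correct in f2, g2. eexists.
    exact (is_derive_plus _ _ _ _ _ (is_derive_scal _ _ a _ f2) (is_derive_scal _ _ b _ g2)).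
  - now apply continuous_lin.
  - apply (continuous_eqon Om (lin a (D1 f) b (D1 g))); trivial.
    + now apply eqon_sym, D1_lin.
    + now apply continuous_lin.
  - apply (continuous_eqon Om (lin a (D2 f) b (D2 g))); trivial.
    + now apply eqon_sym, D2_lin.
    + now apply continuous_lin.
Qed.

Lemma C2on_lin (Om : pt -> Prop) (a b : R) (f g : pt -> R) :
  open Om -> C2on Om f -> C2on Om g -> C2on Om (lin a f b g).
Proof.
  intros HO (f1 & f2 & f3) (g1 & g2 & g3). split; [|split].
  - now apply C1on_lin.
  - apply (C1on_ext Om (lin a (D1 f) b (D1 g))); trivial.
    + now apply eqon_sym, D1_lin.
    + now apply C1on_lin.
  - apply (C1on_ext Om (lin a (D2 f) b (D2 g))); trivial.
    + now apply eqon_sym, D2_lin.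
    + now apply C1on_lin.
Qed.

Lemma eqon_trans (Om : pt -> Prop) (f g h : pt -> R) : eqon Om f g -> eqon Om g h -> eqon Om f h.
Proof. intros H1 H2 p Hp. now rewrite H1, H2. Qed.

Lemma sol_lin (k : R) (Om : pt -> Prop) (a b : R) (f g : pt -> R) :
  open Om -> sol k Om f -> sol k Om g -> sol k Om (lin a f b g).
Proof.
  intros HO [Hf Ef] [Hg Eg]. split; [now apply C2on_lin|]. intros p Hp.
  destruct Hf as (f1 & f2 & f3). destruct Hg as (g1 & g2 & g3).
  rewrite (eqon_trans Om _ _ _ (eqon_D1 Om _ _ HO (D1_lin Om a b f g f1 g1))
    (D1_lin Om a b (D1 f) (D1 g) f2 g2) p Hp).
  rewrite (eqon_trans Om _ _ _ (eqon_D2 Om _ _ HO (D2_lin Om a b f g f1 g1))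
    (D2_lin Om a b (D2 f) (D2 g) f3 g3) p Hp).
  specialize (Ef p Hp). specialize (Eg p Hp). unfold lin.
  replace (a * D1 (D1 f) p + b * D1 (D1 g) p + (a * D2 (D2 f) p + b * D2 (D2 g) p) +
    k ^ 2 * (a * f p + b * g p)) with (a * (D1 (D1 f) p + D2 (D2 f) p + k ^ 2 * f p)
      + b * (D1 (D1 g) p + D2 (D2 g) p + k ^ 2 * g p)) by ring.
  rewrite Ef, Eg. ring.
Qed.

Lemma sol_ext (k : R) (Om : pt -> Prop) (f g : pt -> R) :
  open Om -> eqon Om f g -> sol k Om f -> sol k Om g.
Proof.
  intros HO H [Hf Ef]. split; [now apply (C2on_ext Om f)|]. intros p Hp.
  rewrite <- (eqon_D1 Om _ _ HO (eqon_D1 Om _ _ HO H) p Hp).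
  rewrite <- (eqon_D2 Om _ _ HO (eqon_D2 Om _ _ HO H) p Hp).
  rewrite <- (H p Hp). now apply Ef.
Qed.

Lemma sol_sub (k : R) (O1 O2 : pt -> Prop) (f : pt -> R) :
  (forall p, O1 p -> O2 p) -> sol k O2 f -> sol k O1 f.
Proof.
  intros H [Hf Ef]. split; [now apply (C2on_sub O1 O2)|]. intros p Hp. now apply Ef, H.
Qed.

Lemma sol_local (k : R) (Om : pt -> Prop) (f : pt -> R) :
  (forall p, Om p -> exists O' : pt -> Prop, O' p /\ sol k O' f) -> sol k Om f.
Proof.
  intros H. split; [split; [|split]|]; intros p Hp; destruct (H p Hp) as (O' & Hp' & HS).
  - exact (proj1 (proj1 HS) p Hp').
  - exact (proj1 (proj2 (proj1 HS)) p Hp').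
  - exact (proj2 (proj2 (proj1 HS)) p Hp').
  - exact (proj2 HS p Hp').
Qed.

(** The Helmholtz operator commutes with translations, hence with integration over translates of a
    fixed circle. *)
Lemma sol_circ (k : R) (Om : pt -> Prop) (h : pt -> R) (r : R) (w : R -> R) :
  open Om -> (forall t, continuous w t) -> (forall t, Rabs (w t) <= 1) -> 0 <= r ->
  sol k Om h -> sol k (inner Om r) (fun q => circ h q r w).
Proof.
  intros HO Hw Hw1 Hr [Hh Eh]. split; [now apply C2on_circ|]. intros p Hp.
  destruct Hh as (A & B & C).
  assert (HI : open (inner Om r)) by apply inner_open.
  assert (Hrr : Rabs r <= r) by (rewrite Rabs_pos_eq; lra).
  rewrite (eqon_trans _ _ _ _ (eqon_D1 _ _ _ HI (D1_circ Om w r HO Hw Hr h A))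
    (D1_circ Om w r HO Hw Hr (D1 h) B) p Hp).
  rewrite (eqon_trans _ _ _ _ (eqon_D2 _ _ _ HI (D2_circ Om w r HO Hw Hr h A))
    (D2_circ Om w r HO Hw Hr (D2 h) C) p Hp).
  rewrite <- (circ_scal Om h p r r); trivial; [|now apply C1on_cont].
  rewrite <- (circ_plus Om _ _ p r r); trivial; [|now apply C1on_cont1|now apply C1on_cont2].
  rewrite <- (circ_plus Om _ _ p r r); trivial.
  - rewrite (circ_ext Om _ (fun _ => 0) p r r); trivial.
    unfold circ. rewrite (RInt_ext_R _ (fun _ => 0)) by (intros; ring).
    rewrite RInt_const. unfold scal; simpl; unfold mult; simpl. apply Rmult_0_r.
  - intros q Hq. apply (continuous_plus (V := R_NormedModule)).
    + now apply (C1on_cont1 Om).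
    + now apply (C1on_cont2 Om).
  - intros q Hq. apply (continuous_scal_r (V := R_NormedModule)). now apply (C1on_cont Om).
Qed.

(** [D1 h] is not yet known to be twice differentiable, so the mean value property of [h] is
    differentiated in the centre instead of being applied to [D1 h]. *)
Lemma D1_mean (k : R) (Om : pt -> Prop) (h : pt -> R) (p : pt) (r : R) :
  0 < k -> open Om -> sol k Om h -> 0 <= r -> k * r <= 1 -> inner Om r p ->
  circ (D1 h) p r cst1 = D1 h p * bessel_mean k r.
Proof.
  intros Hk HO Hh Hr Hkr Hp.
  rewrite <- (D1_circ Om cst1 r HO continuous_cst1 Hr h (sol_C1 _ _ _ Hh) p Hp).
  rewrite (eqon_D1 (inner Om r) _ (fun q => h q * bessel_mean k r)); [|apply inner_open| |exact Hp].
  - unfold D1. apply Derive_scal_l.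
  - intros q Hq. now apply (mean_value k Om).
Qed.

Lemma D2_mean (k : R) (Om : pt -> Prop) (h : pt -> R) (p : pt) (r : R) :
  0 < k -> open Om -> sol k Om h -> 0 <= r -> k * r <= 1 -> inner Om r p ->
  circ (D2 h) p r cst1 = D2 h p * bessel_mean k r.
Proof.
  intros Hk HO Hh Hr Hkr Hp.
  rewrite <- (D2_circ Om cst1 r HO continuous_cst1 Hr h (sol_C1 _ _ _ Hh) p Hp).
  rewrite (eqon_D2 (inner Om r) _ (fun q => h q * bessel_mean k r)); [|apply inner_open| |exact Hp].
  - unfold D2. apply Derive_scal_l.
  - intros q Hq. now apply (mean_value k Om).
Qed.

(** This is 2 PI r J_1 (k r) / k. *)
Definition bessel_moment (k r : R) : R := RInt (fun s => s * bessel_mean k s) 0 r.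

Lemma bessel_mean_continuous (k s : R) : continuous (bessel_mean k) s.
Proof.
  apply (ex_derive_continuous (V := R_NormedModule)). eexists.
  apply (is_derive_mean plane (wave k) (0, 0) s (Rabs s));
    [apply plane_open|exact (sol_C1 _ _ _ (wave_sol k))|apply inner_plane|apply Rle_refl].
Qed.

Lemma weighted_bessel_mean_continuous (k s : R) : continuous (fun s => s * bessel_mean k s) s.
Proof. apply (continuous_prod_R (fun s => s)); [apply continuous_id|apply bessel_mean_continuous]. Qed.

Lemma bessel_moment_ge (k r : R) : 0 < k -> 0 <= r -> k * r <= 1 -> PI * r ^ 2 / 2 <= bessel_moment k r.
Proof.
  intros Hk Hr Hkr. unfold bessel_moment.
  replace (PI * r ^ 2 / 2) with (RInt (fun s => PI * s) 0 r).
  - apply RInt_le; trivial.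
    + apply (ex_RInt_continuous (V := R_CompleteNormedModule)). intros s _.
      apply (continuous_prod_R (fun _ => PI)); [apply continuous_const|apply continuous_id].
    + apply (ex_RInt_continuous (V := R_CompleteNormedModule)). intros s _. apply weighted_bessel_mean_continuous.
    + intros s Hs. assert (PI <= bessel_mean k s) by (apply bessel_mean_ge; [lra|lra|nra]). nra.
  - apply is_RInt_unique.
    replace (PI * r ^ 2 / 2) with (minus (PI * r ^ 2 / 2) (PI * 0 ^ 2 / 2))
      by (unfold minus, plus, opp; simpl; field).
    apply (is_RInt_derive (fun s => PI * s ^ 2 / 2)).
    + intros; auto_derive; trivial; field.
    + intros s _. apply (continuous_prod_R (fun _ => PI)); [apply continuous_const|apply continuous_id].
Qed.

(* Both representations integrate [d/ds (s * circ h p s w)] for [w = cos, sin]; after an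
   integration by parts in the angle the derivative is [s] times a mean of [D1 h], [D2 h]. *)
Lemma D1_repr (k : R) (Om : pt -> Prop) (h : pt -> R) (p : pt) (r : R) :
  0 < k -> open Om -> sol k Om h -> 0 <= r -> k * r <= 1 -> inner Om r p ->
  r * circ h p r cos = D1 h p * bessel_moment k r.
Proof.
  intros Hk HO Hh Hr Hkr Hp. assert (A := sol_C1 _ _ _ Hh).
  assert (HI : is_RInt (fun s => D1 h p * (s * bessel_mean k s)) 0 r
    (minus (r * circ h p r cos) (0 * circ h p 0 cos))).
  { apply (is_RInt_derive (fun s => s * circ h p s cos)).
    - rewrite Rmin_left, Rmax_right by lra. intros s Hs.
      assert (Hsr : Rabs s <= r) by (rewrite Rabs_pos_eq; lra).
      assert (Hid : is_derive (fun s : R => s) s 1) by (auto_derive; trivial).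
      pose proof (is_derive_mult (fun s : R => s) _ s _ _ Hid
        (is_derive_circ_radius Om h p s r cos HO A continuous_cos_R Hp Hsr) Rmult_comm) as X.
      match type of X with is_derive _ _ ?x =>
        match goal with |- is_derive _ _ ?y => replace y with x; [exact X|] end end.
      unfold plus, mult; simpl. unfold mult; simpl.
      rewrite (circ_cos_by_parts Om h p s r); trivial.
      change (circ (D1 h) p s (fun t => cos t * cos t)) with (circ (D1 h) p s wcc).
      change (circ (D2 h) p s (fun t => sin t * cos t)) with (circ (D2 h) p s wsc).
      assert (S : circ (D1 h) p s wcc + circ (D1 h) p s wss = D1 h p * bessel_mean k s).
      { rewrite <- (circ_plus_weight Om (D1 h) p s r); trivial;
          [|now apply C1on_cont1|apply continuous_wcc|apply continuous_wss].
        rewrite <- (D1_mean k Om h p s); trivial; [|lra|nra|now apply (inner_mono Om r)].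
        apply circ_weight_ext. intros t. unfold wcc, wss, cst1.
        pose proof (sin2_cos2 t) as T. unfold Rsqr in T. lra. }
      transitivity (s * (D1 h p * bessel_mean k s)); [rewrite <- S|]; ring.
    - intros s _. apply (continuous_prod_R (fun _ => D1 h p)); [apply continuous_const|].
      apply weighted_bessel_mean_continuous. }
  apply (is_RInt_unique (V := R_CompleteNormedModule)) in HI.
  rewrite (RInt_scal (V := R_CompleteNormedModule) (fun s => s * bessel_mean k s)) in HI.
  2:{ apply (ex_RInt_continuous (V := R_CompleteNormedModule)). intros s _. apply weighted_bessel_mean_continuous. }
  unfold scal, minus, plus, opp in HI; simpl in HI; unfold mult in HI; simpl in HI.
  unfold bessel_moment. lra.
Qed.

Lemma D2_repr (k : R) (Om : pt -> Prop) (h : pt -> R) (p : pt) (r : R) :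
  0 < k -> open Om -> sol k Om h -> 0 <= r -> k * r <= 1 -> inner Om r p ->
  r * circ h p r sin = D2 h p * bessel_moment k r.
Proof.
  intros Hk HO Hh Hr Hkr Hp. assert (A := sol_C1 _ _ _ Hh).
  assert (HI : is_RInt (fun s => D2 h p * (s * bessel_mean k s)) 0 r
    (minus (r * circ h p r sin) (0 * circ h p 0 sin))).
  { apply (is_RInt_derive (fun s => s * circ h p s sin)).
    - rewrite Rmin_left, Rmax_right by lra. intros s Hs.
      assert (Hsr : Rabs s <= r) by (rewrite Rabs_pos_eq; lra).
      assert (Hid : is_derive (fun s : R => s) s 1) by (auto_derive; trivial).
      pose proof (is_derive_mult (fun s : R => s) _ s _ _ Hid
        (is_derive_circ_radius Om h p s r sin HO A continuous_sin_R Hp Hsr) Rmult_comm) as X.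
      match type of X with is_derive _ _ ?x =>
        match goal with |- is_derive _ _ ?y => replace y with x; [exact X|] end end.
      unfold plus, mult; simpl. unfold mult; simpl.
      rewrite (circ_sin_by_parts Om h p s r); trivial.
      rewrite (circ_weight_ext (D1 h) _ _ (fun t => cos t * sin t) wsc)
        by (intros; unfold wsc; ring).
      change (circ (D2 h) p s (fun t => sin t * sin t)) with (circ (D2 h) p s wss).
      assert (S : circ (D2 h) p s wcc + circ (D2 h) p s wss = D2 h p * bessel_mean k s).
      { rewrite <- (circ_plus_weight Om (D2 h) p s r); trivial;
          [|now apply C1on_cont2|apply continuous_wcc|apply continuous_wss].
        rewrite <- (D2_mean k Om h p s); trivial; [|lra|nra|now apply (inner_mono Om r)].
        apply circ_weight_ext. intros t. unfold wcc, wss, cst1.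
        pose proof (sin2_cos2 t) as T. unfold Rsqr in T. lra. }
      transitivity (s * (D2 h p * bessel_mean k s)); [rewrite <- S|]; ring.
    - intros s _. apply (continuous_prod_R (fun _ => D2 h p)); [apply continuous_const|].
      apply weighted_bessel_mean_continuous. }
  apply (is_RInt_unique (V := R_CompleteNormedModule)) in HI.
  rewrite (RInt_scal (V := R_CompleteNormedModule) (fun s => s * bessel_mean k s)) in HI.
  2:{ apply (ex_RInt_continuous (V := R_CompleteNormedModule)). intros s _. apply weighted_bessel_mean_continuous. }
  unfold scal, minus, plus, opp in HI; simpl in HI; unfold mult in HI; simpl in HI.
  unfold bessel_moment. lra.
Qed.

Lemma bessel_moment_pos (k r : R) : 0 < k -> 0 < r -> k * r <= 1 -> 0 < bessel_moment k r.
Proof.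
  intros Hk Hr Hkr. eapply Rlt_le_trans; [|apply bessel_moment_ge; trivial; lra].
  pose proof PI_RGT_0. assert (0 < r ^ 2) by (apply pow_lt; lra). nra.
Qed.

Lemma open_inner_ex (k : R) (Om : pt -> Prop) (p : pt) :
  0 < k -> open Om -> Om p -> exists r, 0 < r /\ k * r <= 1 /\ inner Om r p.
Proof.
  intros Hk HO Hp. destruct (proj1 (locally_box p Om) (HO p Hp)) as (e & He & H).
  exists (Rmin (e / 2) (/ k)).
  pose proof (Rinv_0_lt_compat k Hk).
  pose proof (Rmin_l (e / 2) (/ k)). pose proof (Rmin_r (e / 2) (/ k)).
  split; [apply Rmin_glb_lt; lra|]. split.
  - replace 1 with (k * / k) by (field; lra). apply Rmult_le_compat_l; lra.
  - exists (e / 2). split; [lra|]. intros q Hq. apply H.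
    apply (box_le _ _ (Rmin (e / 2) (/ k) + e / 2)); trivial. lra.
Qed.

Lemma Rabs_cos_le (t : R) : Rabs (cos t) <= 1.
Proof. apply Rabs_le, COS_bound. Qed.

Lemma Rabs_sin_le (t : R) : Rabs (sin t) <= 1.
Proof. apply Rabs_le, SIN_bound. Qed.

(** Near each point [D1 h] is a constant multiple of [circ h q r cos], which is as regular as [h].
    The representation thus gains one derivative, and by iteration solutions are smooth. *)
Lemma sol_D1 (k : R) (Om : pt -> Prop) (h : pt -> R) :
  0 < k -> open Om -> sol k Om h -> sol k Om (D1 h).
Proof.
  intros Hk HO Hh. apply sol_local. intros p Hp.
  destruct (open_inner_ex k Om p Hk HO Hp) as (r & Hr & Hkr & Hi).
  exists (inner Om r). split; trivial.
  pose proof (sol_circ k Om h r cos HO continuous_cos_R Rabs_cos_le (Rlt_le _ _ Hr) Hh) as S.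
  (* [lin] serves as a scalar multiple here: its second term has coefficient 0. *)
  apply (sol_ext k _ (lin (r / bessel_moment k r) (fun q => circ h q r cos) 0 (fun q => circ h q r cos))).
  - apply inner_open.
  - intros q Hq. unfold lin. pose proof (D1_repr k Om h q r Hk HO Hh (Rlt_le _ _ Hr) Hkr Hq) as E.
    assert (HQ := bessel_moment_pos k r Hk Hr Hkr).
    apply (Rmult_eq_reg_r (bessel_moment k r)); [|lra]. rewrite <- E. field. lra.
  - apply sol_lin; trivial. apply inner_open.
Qed.

Lemma sol_D2 (k : R) (Om : pt -> Prop) (h : pt -> R) :
  0 < k -> open Om -> sol k Om h -> sol k Om (D2 h).
Proof.
  intros Hk HO Hh. apply sol_local. intros p Hp.
  destruct (open_inner_ex k Om p Hk HO Hp) as (r & Hr & Hkr & Hi).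
  exists (inner Om r). split; trivial.
  pose proof (sol_circ k Om h r sin HO continuous_sin_R Rabs_sin_le (Rlt_le _ _ Hr) Hh) as S.
  apply (sol_ext k _ (lin (r / bessel_moment k r) (fun q => circ h q r sin) 0 (fun q => circ h q r sin))).
  - apply inner_open.
  - intros q Hq. unfold lin. pose proof (D2_repr k Om h q r Hk HO Hh (Rlt_le _ _ Hr) Hkr Hq) as E.
    assert (HQ := bessel_moment_pos k r Hk Hr Hkr).
    apply (Rmult_eq_reg_r (bessel_moment k r)); [|lra]. rewrite <- E. field. lra.
  - apply sol_lin; trivial. apply inner_open.
Qed.

(** The constant 4 / r is r * 2 PI divided by PI r^2 / 2: the bound on the circle integral against
    the lower bound on [bessel_moment]. *)
Lemma repr_bound (k r d c M : R) :
  0 < k -> 0 < r -> k * r <= 1 -> r * c = d * bessel_moment k r -> Rabs c <= 2 * PI * M ->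
  Rabs d <= 4 / r * M.
Proof.
  intros Hk Hr Hkr E Hc. pose proof PI_RGT_0 as HPI.
  pose proof (bessel_moment_ge k r Hk (Rlt_le _ _ Hr) Hkr) as HQ.
  assert (Hr2 : 0 < r ^ 2) by (apply pow_lt; lra).
  assert (E' : r * Rabs c = Rabs d * bessel_moment k r).
  { apply (f_equal Rabs) in E.
    rewrite !Rabs_mult, (Rabs_pos_eq r), (Rabs_pos_eq (bessel_moment k r)) in E by nra. exact E. }
  pose proof (Rabs_pos d).
  assert (Rabs d * (PI * r ^ 2 / 2) <= r * (2 * PI * M)) by nra.
  apply (Rmult_le_reg_r (PI * r ^ 2 / 2)); [nra|].
  replace (4 / r * M * (PI * r ^ 2 / 2)) with (r * (2 * PI * M)) by (field; lra). trivial.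
Qed.

Lemma D1_bound (k : R) (Om : pt -> Prop) (h : pt -> R) (p : pt) (r M : R) :
  0 < k -> open Om -> sol k Om h -> 0 < r -> k * r <= 1 -> inner Om r p ->
  (forall q, Om q -> Rabs (h q) <= M) -> Rabs (D1 h p) <= 4 / r * M.
Proof.
  intros Hk HO Hh Hr Hkr Hi HM.
  apply (repr_bound k r (D1 h p) (circ h p r cos)); trivial.
  - apply (D1_repr k Om); trivial. lra.
  - apply (circ_bound Om h p r r); trivial.
    + exact (C1on_cont Om h (sol_C1 _ _ _ Hh)).
    + rewrite Rabs_pos_eq; lra.
    + exact continuous_cos_R.
    + exact Rabs_cos_le.
Qed.

Lemma D2_bound (k : R) (Om : pt -> Prop) (h : pt -> R) (p : pt) (r M : R) :
  0 < k -> open Om -> sol k Om h -> 0 < r -> k * r <= 1 -> inner Om r p ->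
  (forall q, Om q -> Rabs (h q) <= M) -> Rabs (D2 h p) <= 4 / r * M.
Proof.
  intros Hk HO Hh Hr Hkr Hi HM.
  apply (repr_bound k r (D2 h p) (circ h p r sin)); trivial.
  - apply (D2_repr k Om); trivial. lra.
  - apply (circ_bound Om h p r r); trivial.
    + exact (C1on_cont Om h (sol_C1 _ _ _ Hh)).
    + rewrite Rabs_pos_eq; lra.
    + exact continuous_sin_R.
    + exact Rabs_sin_le.
Qed.

(** * Unique continuation *)

(** The direction is not normalised: in Taylor's formula (a, b) is the whole displacement, at the
    corner it is a unit vector. *)
Definition dd (a b : R) (h : pt -> R) : pt -> R := lin a (D1 h) b (D2 h).

Definition ddn (n : nat) (a b : R) (h : pt -> R) : pt -> R := Nat.iter n (dd a b) h.

Lemma sol_dd (k : R) (Om : pt -> Prop) (a b : R) (h : pt -> R) :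
  0 < k -> open Om -> sol k Om h -> sol k Om (dd a b h).
Proof. intros Hk HO Hh. apply sol_lin; trivial; [now apply sol_D1|now apply sol_D2]. Qed.

Lemma sol_ddn (k : R) (Om : pt -> Prop) (n : nat) (a b : R) (h : pt -> R) :
  0 < k -> open Om -> sol k Om h -> sol k Om (ddn n a b h).
Proof.
  intros Hk HO Hh. induction n as [|n IH]; [exact Hh|]. simpl. now apply sol_dd.
Qed.

Lemma dd_bound (k : R) (Om : pt -> Prop) (h : pt -> R) (p : pt) (a b r M : R) :
  0 < k -> open Om -> sol k Om h -> 0 < r -> k * r <= 1 -> inner Om r p ->
  (forall q, Om q -> Rabs (h q) <= M) ->
  Rabs (dd a b h p) <= 4 * (Rabs a + Rabs b) / r * M.
Proof.
  intros Hk HO Hh Hr Hkr Hi HM. unfold dd, lin.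
  pose proof (D1_bound k Om h p r M Hk HO Hh Hr Hkr Hi HM).
  pose proof (D2_bound k Om h p r M Hk HO Hh Hr Hkr Hi HM).
  eapply Rle_trans; [apply Rabs_triang|]. rewrite !Rabs_mult.
  pose proof (Rabs_pos a). pose proof (Rabs_pos b).
  replace (4 * (Rabs a + Rabs b) / r * M) with (Rabs a * (4 / r * M) + Rabs b * (4 / r * M))
    by (field; lra).
  apply Rplus_le_compat; now apply Rmult_le_compat_l.
Qed.

(** One Cauchy estimate per derivative, each on a box narrower by [d]. Keeping [n * d] fixed gives a
    growth of order n^n, which the factorial in Taylor's formula compensates. *)
Lemma ddn_bound (k : R) (h : pt -> R) (p : pt) (a b r d M : R) (n : nat) :
  0 < k -> sol k (box p r) h -> 0 < d -> k * d <= 1 ->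
  (forall q, box p r q -> Rabs (h q) <= M) ->
  forall q, box p (r - INR n * d) q ->
  Rabs (ddn n a b h q) <= (4 * (Rabs a + Rabs b) / d) ^ n * M.
Proof.
  intros Hk Hh Hd Hkd HM. induction n as [|n IH]; intros q Hq.
  - simpl in *. rewrite Rmult_1_l. apply HM. apply (box_le p q (r - 0 * d)); [lra|exact Hq].
  - simpl ddn. rewrite S_INR in Hq.
    replace ((4 * (Rabs a + Rabs b) / d) ^ S n * M) with
      (4 * (Rabs a + Rabs b) / d * ((4 * (Rabs a + Rabs b) / d) ^ n * M)) by (simpl; ring).
    apply (dd_bound k (box p (r - INR n * d))); trivial.
    + apply box_open.
    + apply sol_ddn; [exact Hk|apply box_open|].
      apply (sol_sub k _ (box p r)); trivial. intros z Hz. apply (box_le p z (r - INR n * d)); trivial.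
      pose proof (pos_INR n). nra.
    + destruct Hq as [q1 q2].
      set (m := r - (INR n + 1) * d) in *.
      exists (Rmin (m - Rabs (fst q - fst p)) (m - Rabs (snd q - snd p))).
      pose proof (Rmin_l (m - Rabs (fst q - fst p)) (m - Rabs (snd q - snd p))).
      pose proof (Rmin_r (m - Rabs (fst q - fst p)) (m - Rabs (snd q - snd p))).
      split; [apply Rmin_glb_lt; lra|].
      intros z [z1 z2]. split.
      * replace (fst z - fst p) with ((fst z - fst q) + (fst q - fst p)) by ring.
        eapply Rle_lt_trans; [apply Rabs_triang|]. unfold m in *; lra.
      * replace (snd z - snd p) with ((snd z - snd q) + (snd q - snd p)) by ring.
        eapply Rle_lt_trans; [apply Rabs_triang|]. unfold m in *; lra.
Qed.

Lemma abs_le_of_derive_le (f df g dg : R -> R) :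
  (forall t, 0 <= t <= 1 -> is_derive f t (df t)) ->
  (forall t, 0 <= t <= 1 -> is_derive g t (dg t)) ->
  (forall t, 0 <= t <= 1 -> Rabs (df t) <= dg t) -> f 0 = 0 -> g 0 = 0 ->
  forall t, 0 <= t <= 1 -> Rabs (f t) <= g t.
Proof.
  intros Hf Hg Hd f0 g0 t Ht.
  assert (Key : forall c, c = 1 \/ c = -1 -> c * f t <= g t).
  { intros c Hc.
    destruct (MVT_gen (fun s => g s - c * f s) 0 t (fun s => dg s - c * df s)) as (z & Hz & E).
    - rewrite Rmin_left, Rmax_right by lra. intros x Hx.
      apply (is_derive_minus g (fun s => c * f s)); [apply Hg; lra|].
      apply is_derive_scal. apply Hf; lra.
    - rewrite Rmin_left, Rmax_right by lra. intros x Hx.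
      apply continuity_pt_filterlim.
      apply (ex_derive_continuous (V := R_NormedModule) (fun s => g s - c * f s)).
      exists (dg x - c * df x).
      apply (is_derive_minus g (fun s => c * f s)); [apply Hg; lra|].
      apply is_derive_scal. apply Hf; lra.
    - rewrite Rmin_left, Rmax_right in Hz by lra. rewrite f0, g0 in E.
      assert (Hz' : 0 <= z <= 1) by lra. pose proof (Hd z Hz') as B.
      apply Rabs_le_between in B.
      assert (0 <= dg z - c * df z) by (destruct Hc; subst c; lra).
      assert (0 <= (dg z - c * df z) * (t - 0)) by (apply Rmult_le_pos; lra). lra. }
  apply Rabs_le. split.
  - pose proof (Key (-1)). lra.
  - pose proof (Key 1). lra.
Qed.

(** [g j] stands for the j-th derivative along a segment; all of them vanish at 0, so m integrations
    leave only the remainder. *)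
Lemma taylor_flat (m : nat) (B : R) :
  forall g : nat -> R -> R,
  (forall j t, 0 <= t <= 1 -> is_derive (g j) t (g (S j) t)) -> (forall j, g j 0 = 0) ->
  (forall t, 0 <= t <= 1 -> Rabs (g m t) <= B) ->
  forall t, 0 <= t <= 1 -> Rabs (g 0%nat t) <= B * t ^ m / INR (fact m).
Proof.
  induction m as [|m IH]; intros g Hg g0 HB t Ht.
  - simpl. replace (B * 1 / 1) with B by field. now apply HB.
  - assert (IH' := IH (fun j => g (S j)) (fun j => Hg (S j)) (fun j => g0 (S j)) HB).
    pose proof (INR_fact_neq_0 m). pose proof (INR_fact_neq_0 (S m)).
    apply (abs_le_of_derive_le (g 0%nat) (g 1%nat) (fun t => B * t ^ S m / INR (fact (S m)))
      (fun t => B * t ^ m / INR (fact m))); trivial.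
    + intros s Hs. now apply Hg.
    + intros s _.
      assert (HF : INR (fact (S m)) = (INR m + 1) * INR (fact m))
        by (rewrite fact_simpl, mult_INR, S_INR; ring).
      revert HF. generalize (INR (fact (S m))). intros F HF.
      assert (Hm : INR m + 1 <> 0) by (pose proof (pos_INR m); lra).
      assert (HF0 : F <> 0) by (rewrite HF; now apply Rmult_integral_contrapositive).
      evar_last; [apply (is_derive_ext (fun t => (B / F) * t ^ S m)); [intros u; assert (X : B / F * u ^ S m = B * u ^ S m / F) by (field; exact HF0); exact X|]|].
      * apply is_derive_scal. apply is_derive_pow. apply (is_derive_id (K := R_AbsRing)).
      * rewrite HF, S_INR. unfold one; simpl. field. split; trivial.
    + rewrite pow_i by lia. field. trivial.
Qed.

(** The left side is a single term of the series of exp m, and exp 1 <= 3. *)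
Lemma pow_self_le_exp (m : nat) : INR m ^ m / INR (fact m) <= 3 ^ m.
Proof.
  assert (HF : forall j, 0 < INR (fact j)) by (intros; apply INR_fact_lt_0).
  pose proof (exp_ge_taylor (INR m) m (pos_INR m)) as H.
  assert (Hpos : forall n, 0 <= sum_f_R0 (fun k => INR m ^ k / INR (fact k)) n).
  { intros n. apply cond_pos_sum. intros j. apply Rle_mult_inv_pos; [apply pow_le, pos_INR|apply HF]. }
  assert (E : exp (INR m) <= 3 ^ m).
  { clear. induction m as [|m IH].
    - simpl. rewrite exp_0. lra.
    - rewrite S_INR, exp_plus. simpl. pose proof exp_le_3. pose proof (exp_pos 1).
      pose proof (exp_pos (INR m)). nra. }
  destruct m as [|m]; [simpl; lra|].
  rewrite tech5 in H. pose proof (Hpos m). lra.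
Qed.

Lemma locally_zero_dd (a b : R) (h : pt -> R) (p : pt) :
  locally p (fun q => h q = 0) -> locally p (fun q => dd a b h q = 0).
Proof.
  intros H. apply locally_locally in H. revert H. apply filter_imp. intros q Hq.
  unfold dd, lin.
  rewrite (D1_ext_loc h (fun _ => 0) q Hq), (D2_ext_loc h (fun _ => 0) q Hq).
  unfold D1, D2. rewrite !Derive_const. ring.
Qed.

Lemma locally_zero_ddn (n : nat) (a b : R) (h : pt -> R) (p : pt) :
  locally p (fun q => h q = 0) -> ddn n a b h p = 0.
Proof.
  intros H. assert (L : locally p (fun q => ddn n a b h q = 0)).
  { induction n as [|n IH]; [exact H|]. simpl. now apply locally_zero_dd. }
  now apply locally_singleton in L.
Qed.

(* Analyticity in disguise: [D1_bound] on nested boxes gives [|ddn m h| <= (8 c m / r)^m M] with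
   [c = |a| + |b|], and [m^m / m! <= 3^m], so the Taylor remainder at [p] tends to 0. *)
Lemma flat_point_zero (k : R) (h : pt -> R) (p : pt) (r M : R) :
  0 < k -> 0 < r -> k * r <= 1 -> sol k (box p r) h ->
  (forall q, box p r q -> Rabs (h q) <= M) ->
  (forall n a b, ddn n a b h p = 0) ->
  forall q, box p (r / 50) q -> h q = 0.
Proof.
  intros Hk Hr Hkr Hh HM Hflat q [q1 q2].
  set (a := fst q - fst p) in *. set (b := snd q - snd p) in *.
  assert (M0 : 0 <= M).
  { eapply Rle_trans; [apply (Rabs_pos (h p))|]. apply HM. now apply box_center. }
  set (g := fun j t => ddn j a b h (fst p + t * a, snd p + t * b)).
  assert (Hin : forall t, 0 <= t <= 1 -> box p (r / 2) (fst p + t * a, snd p + t * b)).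
  { intros t Ht. split; simpl.
    - replace (fst p + t * a - fst p) with (t * a) by ring.
      rewrite Rabs_mult, (Rabs_pos_eq t) by lra. pose proof (Rabs_pos a). nra.
    - replace (snd p + t * b - snd p) with (t * b) by ring.
      rewrite Rabs_mult, (Rabs_pos_eq t) by lra. pose proof (Rabs_pos b). nra. }
  assert (Hin' : forall t, 0 <= t <= 1 -> box p r (fst p + t * a, snd p + t * b)).
  { intros t Ht. apply (box_le _ _ (r / 2)); [lra|now apply Hin]. }
  assert (Hb : forall m, (1 <= m)%nat -> Rabs (h q) <= (24 / 25) ^ m * M).
  { intros m Hm.
    assert (Hm0 : 1 <= INR m) by (now apply (le_INR 1)).
    (* [m] derivatives at cost [d] each shrink the box from [r] to [r / 2]. *)
    set (d := r / (2 * INR m)).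
    assert (Hd : 0 < d) by (apply Rdiv_lt_0_compat; lra).
    assert (Hmd : INR m * d = r / 2) by (unfold d; field; lra).
    assert (Hkd : k * d <= 1) by nra.
    assert (HB := taylor_flat m ((4 * (Rabs a + Rabs b) / d) ^ m * M) g).
    replace q with (fst p + 1 * a, snd p + 1 * b).
    2:{ destruct q; unfold a, b; simpl; f_equal; ring. }
    eapply Rle_trans; [apply (HB)|]; [| | |lra|].
    - intros j t Ht. unfold g.
      pose proof (sol_C1 _ _ _ (sol_ddn k _ j a b h Hk (box_open p r) Hh)) as HC.
      replace (ddn (S j) a b h (fst p + t * a, snd p + t * b))
        with (a * D1 (ddn j a b h) (fst p + t * a, snd p + t * b)
            + b * D2 (ddn j a b h) (fst p + t * a, snd p + t * b)) by reflexivity.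
      apply (is_derive_curve (box p r) (ddn j a b h) (fun t => fst p + t * a) (fun t => snd p + t * b));
        trivial.
      + apply box_open.
      + now apply Hin'.
      + auto_derive; trivial; ring.
      + auto_derive; trivial; ring.
    - intros j. unfold g. rewrite !Rmult_0_l, !Rplus_0_r. destruct p; apply Hflat.
    - intros t Ht. unfold g. apply (ddn_bound k h p a b r); trivial.
      rewrite Hmd. replace (r - r / 2) with (r / 2) by field. now apply Hin.
    - rewrite pow1, Rmult_1_r.
      set (c := 8 * (Rabs a + Rabs b) / r).
      replace (4 * (Rabs a + Rabs b) / d) with (c * INR m) by (unfold c, d; field; lra).
      rewrite Rpow_mult_distr.
      assert (c0 : 0 <= c).
      { unfold c. pose proof (Rabs_pos a); pose proof (Rabs_pos b). apply Rle_mult_inv_pos; lra. }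
      (* The radius r / 50 gives |a| + |b| < r / 25, so the ratio 24 (|a| + |b|) / r stays below
         1. *)
      assert (c1 : c * 3 <= 24 / 25).
      { unfold c. apply (Rmult_le_reg_r r); trivial.
        replace (8 * (Rabs a + Rabs b) / r * 3 * r) with (24 * (Rabs a + Rabs b)) by (field; lra).
        lra. }
      replace (c ^ m * INR m ^ m * M / INR (fact m))
        with (c ^ m * (INR m ^ m / INR (fact m)) * M) by (field; apply INR_fact_neq_0).
      apply Rmult_le_compat_r; trivial.
      eapply Rle_trans.
      + apply Rmult_le_compat_l; [now apply pow_le|apply pow_self_le_exp].
      + rewrite <- Rpow_mult_distr. apply pow_incr. lra. }
  destruct (Req_dec (h q) 0) as [E|E]; trivial. exfalso.
  apply Rabs_pos_lt in E.
  destruct (pow_lt_1_zero (24 / 25)) with (y := Rabs (h q) / (M + 1)) as [N HN].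
  { rewrite Rabs_pos_eq; lra. }
  { apply Rdiv_lt_0_compat; lra. }
  specialize (HN (S N) ltac:(lia)). specialize (Hb (S N) ltac:(lia)).
  rewrite Rabs_pos_eq in HN by (apply pow_le; lra).
  assert (X : (24 / 25) ^ S N * (M + 1) < Rabs (h q)).
  { apply (Rmult_lt_compat_r (M + 1)) in HN; [|lra].
    replace (Rabs (h q) / (M + 1) * (M + 1)) with (Rabs (h q)) in HN by (field; lra). trivial. }
  assert (0 < (24 / 25) ^ S N) by (apply pow_lt; lra). nra.
Qed.

Lemma sol_nice_box (k : R) (Om : pt -> Prop) (h : pt -> R) (p : pt) :
  0 < k -> open Om -> sol k Om h -> Om p ->
  exists r M, 0 < r /\ k * r <= 1 /\ (forall q, box p r q -> Om q) /\
    (forall q, box p r q -> Rabs (h q) <= M).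
Proof.
  intros Hk HO Hh Hp.
  pose proof (C1on_cont Om h (sol_C1 _ _ _ Hh) p Hp) as HC.
  assert (L : locally p (fun q => Om q /\ Rabs (h q) <= Rabs (h p) + 1)).
  { apply filter_and; [now apply HO|].
    assert (H1 : locally (h p) (fun y => Rabs y <= Rabs (h p) + 1)).
    { exists (mkposreal 1 Rlt_0_1). intros y Hy.
      change (Rabs (y - h p) < 1) in Hy.
      replace y with ((y - h p) + h p) by ring. eapply Rle_trans; [apply Rabs_triang|]. lra. }
    exact (HC _ H1). }
  apply locally_box in L. destruct L as (e & He & L).
  pose proof (Rinv_0_lt_compat k Hk).
  pose proof (Rmin_l e (/ k)). pose proof (Rmin_r e (/ k)).
  exists (Rmin e (/ k)), (Rabs (h p) + 1). split; [apply Rmin_glb_lt; lra|].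
  split; [|split].
  - replace 1 with (k * / k) by (field; lra). apply Rmult_le_compat_l; lra.
  - intros q Hq. apply (L q). now apply (box_le _ _ (Rmin e (/ k))).
  - intros q Hq. apply (L q). now apply (box_le _ _ (Rmin e (/ k))).
Qed.

Lemma flat_zero_near (k : R) (Om : pt -> Prop) (h : pt -> R) (p : pt) :
  0 < k -> open Om -> sol k Om h -> Om p -> (forall n a b, ddn n a b h p = 0) ->
  locally p (fun q => h q = 0).
Proof.
  intros Hk HO Hh Hp Hf.
  destruct (sol_nice_box k Om h p Hk HO Hh Hp) as (r & M & Hr & Hkr & HB & HM).
  apply locally_box. exists (r / 50). split; [lra|].
  apply (flat_point_zero k h p r M); trivial. now apply (sol_sub k _ Om).
Qed.

(** Open and closed argument on [0, 1]. The box on which [flat_point_zero] gives zero has a size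
    dictated by the supremum [t], not by the earlier point [s], so the zero set reaches beyond
    [t]. *)
Lemma unique_continuation_segment (k : R) (Om : pt -> Prop) (h : pt -> R) (p v : pt) :
  0 < k -> open Om -> sol k Om h ->
  (forall t, 0 <= t <= 1 -> Om (fst p + t * fst v, snd p + t * snd v)) ->
  locally p (fun q => h q = 0) ->
  locally (fst p + fst v, snd p + snd v) (fun q => h q = 0).
Proof.
  intros Hk HO Hh Hseg H0.
  set (c := fun t => (fst p + t * fst v, snd p + t * snd v) : pt).
  set (Z := fun q => locally q (fun q => h q = 0)).
  set (E := fun t => 0 <= t <= 1 /\ forall s, 0 <= s <= t -> Z (c s)).
  assert (E0 : E 0).
  { split; [lra|]. intros s Hs. replace s with 0 by lra. unfold Z, c.
    rewrite !Rmult_0_l, !Rplus_0_r. destruct p. exact H0. }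
  destruct (completeness E) as [t [Hub Hlub]].
  { exists 1. intros x [Hx _]. lra. }
  { now exists 0. }
  assert (Ht : 0 <= t <= 1).
  { split; [now apply Hub|]. apply Hlub. intros x [Hx _]. lra. }
  destruct (sol_nice_box k Om h (c t) Hk HO Hh (Hseg t Ht)) as (r & M & Hr & Hkr & HB & HM).
  set (N := Rabs (fst v) + Rabs (snd v) + 1).
  pose proof (Rabs_pos (fst v)). pose proof (Rabs_pos (snd v)).
  assert (HN : 1 <= N) by (unfold N; lra).
  (* A change of parameter below [z] moves the point by less than r / 200. Two such steps make r /
     100 = (r / 2) / 50, the radius that [flat_point_zero] yields on a box of size r / 2. *)
  set (z := r / (200 * N)).
  assert (Hz : 0 < z) by (apply Rdiv_lt_0_compat; lra).
  assert (HzN : z * N = r / 200) by (unfold z; field; lra).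
  assert (Hc : forall s s', Rabs (s' - s) < z -> box (c s) (r / 200) (c s')).
  { intros s s' Hs. pose proof (Rabs_pos (s' - s)). split; simpl.
    - replace (fst p + s' * fst v - (fst p + s * fst v)) with ((s' - s) * fst v) by ring.
      rewrite Rabs_mult. unfold N in HzN. nra.
    - replace (snd p + s' * snd v - (snd p + s * snd v)) with ((s' - s) * snd v) by ring.
      rewrite Rabs_mult. unfold N in HzN. nra. }
  assert (Hs : exists s, E s /\ t - z < s <= t).
  { destruct (classic (exists s, E s /\ t - z < s <= t)) as [Hx|Hx]; trivial. exfalso.
    assert (t <= t - z); [|lra]. apply Hlub. intros x Hx'.
    destruct (Rle_dec x (t - z)) as [l|l]; trivial. exfalso. apply Hx. exists x.
    split; trivial. split; [lra|]. now apply Hub. }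
  destruct Hs as (s & [Hs01 HsE] & Hst).
  assert (Hzero : forall q, box (c t) (r / 200) q -> h q = 0).
  { intros q Hq.
    assert (Hts : box (c t) (r / 200) (c s)) by (apply Hc; apply Rabs_def1; lra).
    assert (Hst' : box (c s) (r / 200) (c t)) by (apply Hc; apply Rabs_def1; lra).
    assert (Hsub : forall q, box (c s) (r / 2) q -> box (c t) r q).
    { intros y Hy. apply (box_le _ _ (r / 200 + r / 2)); [lra|]. now apply (box_trans _ (c s)). }
    apply (flat_point_zero k h (c s) (r / 2) M); trivial; try lra; try nra.
    - apply (sol_sub k _ Om); trivial. intros y Hy. now apply HB, Hsub.
    - intros y Hy. now apply HM, Hsub.
    - intros n a b. apply locally_zero_ddn. apply HsE. lra.
    - apply (box_le _ _ (r / 200 + r / 200)); [lra|]. now apply (box_trans _ (c t)). }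
  assert (Hnear : forall s', Rabs (s' - t) < z -> Z (c s')).
  { intros s' Hs'. unfold Z. generalize (box_open (c t) (r / 200) (c s') (Hc t s' Hs')).
    apply filter_imp. exact Hzero. }
  (* This lies beyond [t] unless the minimum is 1; as [t] bounds [E], it is 1. *)
  assert (HE : E (Rmin 1 (t + z / 2))).
  { pose proof (Rmin_l 1 (t + z / 2)). pose proof (Rmin_r 1 (t + z / 2)).
    split; [split; [apply Rmin_glb; lra|lra]|].
    intros s' Hs'. destruct (Rle_dec s' s); [apply HsE; lra|].
    apply Hnear. apply Rabs_def1; lra. }
  assert (HR : Rmin 1 (t + z / 2) = 1).
  { pose proof (Hub _ HE). unfold Rmin in *. destruct (Rle_dec 1 (t + z / 2)); lra. }
  rewrite HR in HE. destruct HE as [_ HE]. specialize (HE 1 ltac:(lra)). unfold Z, c in HE.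
  rewrite !Rmult_1_l in HE. exact HE.
Qed.

(** * Solutions near an irrational corner *)

(** The Taylor expansion of [h] at [p] starts in degree [N] or later; the recursion lists mixed
    derivatives in every order of differentiation. *)
Fixpoint vanishes (N : nat) (h : pt -> R) (p : pt) : Prop :=
  match N with
  | O => True
  | S n => h p = 0 /\ vanishes n (D1 h) p /\ vanishes n (D2 h) p
  end.

(** With [D1pow_D2] below, these are the two coordinates of a harmonic homogeneous polynomial of
    degree [N]: each of its derivatives of order [N] is plus or minus one of them. *)
Fixpoint D1pow (N : nat) (h : pt -> R) (p : pt) : R :=
  match N with O => h p | S n => D1pow n (D1 h) p end.

(* The junk value at [N = 0] is only ever multiplied by [sin 0]. *)
Definition D1pow_D2 (N : nat) (h : pt -> R) (p : pt) : R :=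
  match N with O => 0 | S n => D1pow n (D2 h) p end.

(** A list of angles rather than a power, since an impedance relation combines one normal derivative
    with tangential ones. *)
Fixpoint dds (l : list R) (h : pt -> R) : pt -> R :=
  match l with nil => h | cons a l' => dds l' (dd (cos a) (sin a) h) end.

Definition lsum (l : list R) : R := fold_right Rplus 0 l.

Definition zero_on_ray (Om : pt -> Prop) (p : pt) (a b : R) (f : pt -> R) : Prop :=
  exists d, 0 < d /\ forall t, 0 < t < d ->
    Om (fst p + t * a, snd p + t * b) /\ f (fst p + t * a, snd p + t * b) = 0.

Section Corner.

Variables (k : R) (Om : pt -> Prop) (p : pt).
Hypothesis Hk : 0 < k.
Hypothesis HO : open Om.
Hypothesis Hp : Om p.

Lemma vanishes_ext (N : nat) : forall f g, eqon Om f g -> vanishes N f p -> vanishes N g p.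
Proof.
  induction N as [|N IH]; intros f g H V; [exact I|].
  destruct V as (V0 & V1 & V2). split; [|split].
  - now rewrite <- (H p Hp).
  - apply (IH (D1 f)); trivial. now apply eqon_D1.
  - apply (IH (D2 f)); trivial. now apply eqon_D2.
Qed.

Lemma vanishes_lin (N : nat) : forall a b f g, sol k Om f -> sol k Om g ->
  vanishes N f p -> vanishes N g p -> vanishes N (lin a f b g) p.
Proof.
  induction N as [|N IH]; intros a b f g Hf Hg Vf Vg; [exact I|].
  destruct Vf as (f0 & f1 & f2). destruct Vg as (g0 & g1 & g2). split; [|split].
  - unfold lin. rewrite f0, g0. ring.
  - apply (vanishes_ext N (lin a (D1 f) b (D1 g))).
    + apply eqon_sym, D1_lin; eapply sol_C1; eassumption.
    + apply IH; trivial; now apply sol_D1.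
  - apply (vanishes_ext N (lin a (D2 f) b (D2 g))).
    + apply eqon_sym, D2_lin; eapply sol_C1; eassumption.
    + apply IH; trivial; now apply sol_D2.
Qed.

Lemma vanishes_pred (N : nat) : forall h, vanishes (S N) h p -> vanishes N h p.
Proof.
  induction N as [|N IH]; intros h H; [exact I|].
  destruct H as (H0 & H1 & H2). split; [exact H0|]. split; now apply IH.
Qed.

Lemma vanishes_dd (N : nat) (a b : R) (h : pt -> R) :
  sol k Om h -> vanishes (S N) h p -> vanishes N (dd a b h) p.
Proof.
  intros Hh (H0 & H1 & H2). apply vanishes_lin; trivial; [now apply sol_D1|now apply sol_D2].
Qed.

Lemma vanishes_ddn (n : nat) (a b : R) : forall h, sol k Om h -> vanishes (S n) h p -> ddn n a b h p = 0.
Proof.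
  induction n as [|n IH]; intros h Hh V; [exact (proj1 V)|].
  unfold ddn. rewrite Nat.iter_succ_r. apply IH; [now apply sol_dd|]. now apply vanishes_dd.
Qed.

Lemma D1pow_ext (n : nat) : forall f g, eqon Om f g -> D1pow n f p = D1pow n g p.
Proof.
  induction n as [|n IH]; intros f g H; [now apply H|]. apply IH. now apply eqon_D1.
Qed.

Lemma D1pow_lin (n : nat) : forall a b f g, sol k Om f -> sol k Om g ->
  D1pow n (lin a f b g) p = a * D1pow n f p + b * D1pow n g p.
Proof.
  induction n as [|n IH]; intros a b f g Hf Hg; [reflexivity|]. simpl.
  rewrite (D1pow_ext n _ _ (D1_lin Om a b f g (sol_C1 _ _ _ Hf) (sol_C1 _ _ _ Hg))).
  apply IH; now apply sol_D1.
Qed.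

Lemma D1pow_vanishes (n : nat) : forall h, vanishes (S n) h p -> D1pow n h p = 0.
Proof.
  induction n as [|n IH]; intros h (H0 & H1 & H2); [exact H0|]. simpl. now apply IH.
Qed.

Lemma D1pow_D21 (n : nat) (h : pt -> R) : sol k Om h -> D1pow n (D2 (D1 h)) p = D1pow (S n) (D2 h) p.
Proof.
  intros Hh. simpl. apply D1pow_ext. apply eqon_sym, D1D2_comm; trivial. exact (sol_C2 _ _ _ Hh).
Qed.

(** The leading part is harmonic: the term k^2 h of the equation is two orders lower, and its
    derivative of order [n] vanishes at [p]. *)
Lemma D1pow_D22 (n : nat) (h : pt -> R) :
  sol k Om h -> vanishes (S n) h p -> D1pow n (D2 (D2 h)) p = - D1pow (S (S n)) h p.
Proof.
  intros Hh V.
  rewrite (D1pow_ext n _ (lin (-1) (D1 (D1 h)) (- k ^ 2) h)).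
  - rewrite D1pow_lin; trivial; [|now apply sol_D1, sol_D1]. rewrite (D1pow_vanishes n h V). simpl. ring.
  - intros q Hq. pose proof (proj2 Hh q Hq). unfold lin. lra.
Qed.

Lemma D1pow_D2_D1 (n : nat) (h : pt -> R) : sol k Om h -> D1pow_D2 (S n) (D1 h) p = D1pow_D2 (S (S n)) h p.
Proof. intros Hh. simpl. now rewrite D1pow_D21. Qed.

(* The leading part of [h] at [p] is harmonic of degree [length l], hence the real part of a
   multiple of [z^N]; its derivative along unit vectors depends only on the sum of their angles. *)
Lemma dds_vanishes (l : list R) : forall h, sol k Om h -> vanishes (length l) h p ->
  dds l h p = cos (lsum l) * D1pow (length l) h p + sin (lsum l) * D1pow_D2 (length l) h p.
Proof.
  induction l as [|a l IH]; intros h Hh V; [simpl; rewrite cos_0, sin_0; ring|].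
  simpl length in *. simpl dds.
  rewrite IH; [|now apply sol_dd|now apply vanishes_dd].
  assert (EA : D1pow (length l) (dd (cos a) (sin a) h) p
    = cos a * D1pow (S (length l)) h p + sin a * D1pow_D2 (S (length l)) h p).
  { unfold dd. rewrite D1pow_lin; trivial; [now apply sol_D1|now apply sol_D2]. }
  rewrite EA. change (lsum (a :: l)) with (a + lsum l). rewrite cos_plus, sin_plus.
  destruct l as [|c l].
  - simpl. rewrite cos_0, sin_0. ring.
  - simpl length in *.
    assert (EB : D1pow_D2 (S (length l)) (dd (cos a) (sin a) h) p
      = cos a * D1pow_D2 (S (S (length l))) h p - sin a * D1pow (S (S (length l))) h p).
    { simpl D1pow_D2. unfold dd.
      rewrite (D1pow_ext _ _ _ (D2_lin Om _ _ _ _ (sol_C1 _ _ _ (sol_D1 k Om h Hk HO Hh))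
        (sol_C1 _ _ _ (sol_D2 k Om h Hk HO Hh)))).
      rewrite D1pow_lin; [|now apply sol_D2, sol_D1|now apply sol_D2, sol_D2].
      rewrite D1pow_D21, D1pow_D22; trivial; [simpl; ring|]. now apply vanishes_pred. }
    rewrite EB. ring.
Qed.

(** By [D1pow_D22] two [D2] can be traded for two [D1], so these two numbers control all derivatives
    of order [N]. *)
Lemma vanishes_succ (N : nat) : forall h, sol k Om h ->
  vanishes N h p -> D1pow N h p = 0 -> D1pow_D2 N h p = 0 -> vanishes (S N) h p.
Proof.
  induction N as [|n IH]; intros h Hh V HA HB; [simpl in *; tauto|].
  destruct V as (V0 & V1 & V2). split; [exact V0|]. split.
  - apply IH; trivial; [now apply sol_D1|]. destruct n as [|m]; [reflexivity|].
    now rewrite D1pow_D2_D1.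
  - apply IH; trivial; [now apply sol_D2|]. destruct n as [|m]; [reflexivity|].
    simpl D1pow_D2. rewrite D1pow_D22; trivial; [|now apply vanishes_pred; split]. rewrite HA. ring.
Qed.

Lemma zero_on_ray_dd (a b : R) (f : pt -> R) :
  sol k Om f -> zero_on_ray Om p a b f -> zero_on_ray Om p a b (dd a b f).
Proof.
  intros Hf (d & Hd & H). exists d. split; trivial. intros t Ht.
  destruct (H t Ht) as [Ht1 _]. split; trivial.
  assert (X : is_derive (fun s => f (fst p + s * a, snd p + s * b)) t
    (a * D1 f (fst p + t * a, snd p + t * b) + b * D2 f (fst p + t * a, snd p + t * b))).
  { apply (is_derive_curve Om f (fun s => fst p + s * a) (fun s => snd p + s * b)); trivial.
    - exact (sol_C1 _ _ _ Hf).
    - auto_derive; trivial; ring.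
    - auto_derive; trivial; ring. }
  apply is_derive_unique in X. unfold dd, lin. rewrite <- X.
  rewrite (Derive_ext_loc _ (fun _ => 0)); [apply Derive_const|].
  assert (Hm : 0 < Rmin t (d - t)) by (apply Rmin_glb_lt; lra).
  exists (mkposreal _ Hm). intros s Hs.
  change (Rabs (s - t) < Rmin t (d - t)) in Hs.
  pose proof (Rmin_l t (d - t)). pose proof (Rmin_r t (d - t)).
  apply Rabs_def2 in Hs. apply H. lra.
Qed.

Lemma zero_on_ray_center (a b : R) (f : pt -> R) : sol k Om f -> zero_on_ray Om p a b f -> f p = 0.
Proof.
  intros Hf (d & Hd & H).
  pose proof (C1on_cont Om f (sol_C1 _ _ _ Hf) p Hp) as HC.
  destruct (Req_dec (f p) 0) as [E|E]; trivial. exfalso.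
  apply Rabs_pos_lt in E.
  assert (L : locally p (fun q => Rabs (f q - f p) < Rabs (f p))).
  { apply (HC (fun y => Rabs (y - f p) < Rabs (f p))). exists (mkposreal _ E).
    intros y Hy. exact Hy. }
  apply locally_box in L. destruct L as (e & He & L).
  pose proof (Rabs_pos a). pose proof (Rabs_pos b).
  set (N := Rabs a + Rabs b + 1).
  set (t := Rmin (d / 2) (e / (2 * N))).
  assert (HN : 0 < N) by (unfold N; lra).
  assert (Ht : 0 < t) by (apply Rmin_glb_lt; [lra|apply Rdiv_lt_0_compat; lra]).
  assert (Ht1 : t <= d / 2) by apply Rmin_l.
  assert (Ht2 : t * N <= e / 2).
  { replace (e / 2) with (e / (2 * N) * N) by (field; lra).
    apply Rmult_le_compat_r; [lra|apply Rmin_r]. }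
  destruct (H t ltac:(lra)) as [_ Hz].
  assert (Hb : box p e (fst p + t * a, snd p + t * b)).
  { unfold N in Ht2. split; simpl.
    - replace (fst p + t * a - fst p) with (t * a) by ring.
      rewrite Rabs_mult, (Rabs_pos_eq t) by lra. nra.
    - replace (snd p + t * b - snd p) with (t * b) by ring.
      rewrite Rabs_mult, (Rabs_pos_eq t) by lra. nra. }
  specialize (L _ Hb). rewrite Hz in L. unfold Rminus in L.
  rewrite Rplus_0_l, Rabs_Ropp in L. lra.
Qed.

Lemma zero_on_ray_ddn (n : nat) (a b : R) (f : pt -> R) :
  sol k Om f -> zero_on_ray Om p a b f -> ddn n a b f p = 0.
Proof.
  intros Hf HV. apply (zero_on_ray_center a b); [now apply sol_ddn|].
  induction n as [|n IH]; [exact HV|]. simpl. apply zero_on_ray_dd; trivial. now apply sol_ddn.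
Qed.

Lemma ddn_lin (n : nat) (c s a b : R) (f g : pt -> R) :
  sol k Om f -> sol k Om g ->
  eqon Om (ddn n c s (lin a f b g)) (lin a (ddn n c s f) b (ddn n c s g)).
Proof.
  intros Hf Hg. induction n as [|n IH]; [now intros q Hq|].
  intros q Hq. simpl ddn. unfold dd at 1, lin at 1.
  rewrite (eqon_D1 Om _ _ HO IH q Hq), (eqon_D2 Om _ _ HO IH q Hq).
  assert (F := sol_C1 _ _ _ (sol_ddn k Om n c s f Hk HO Hf)).
  assert (G := sol_C1 _ _ _ (sol_ddn k Om n c s g Hk HO Hg)).
  rewrite (D1_lin Om a b _ _ F G q Hq), (D2_lin Om a b _ _ F G q Hq).
  unfold dd, lin. ring.
Qed.

Lemma dds_repeat (n : nat) (a : R) : forall h, dds (repeat a n) h = ddn n (cos a) (sin a) h.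
Proof.
  induction n as [|n IH]; intros h; [reflexivity|]. simpl dds. rewrite IH.
  unfold ddn. now rewrite Nat.iter_succ_r.
Qed.

Lemma lsum_repeat (n : nat) (a : R) : lsum (repeat a n) = INR n * a.
Proof.
  induction n as [|n IH]; [simpl; ring|]. change (lsum (repeat a (S n))) with (a + lsum (repeat a n)).
  rewrite IH, S_INR. ring.
Qed.

Lemma dirichlet_row (n : nat) (a : R) (f : pt -> R) :
  sol k Om f -> vanishes n f p -> zero_on_ray Om p (cos a) (sin a) f ->
  cos (INR n * a) * D1pow n f p + sin (INR n * a) * D1pow_D2 n f p = 0.
Proof.
  intros Hf V HR. pose proof (dds_vanishes (repeat a n) f Hf) as D.
  rewrite repeat_length, lsum_repeat, dds_repeat in D. rewrite <- D by trivial.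
  now apply zero_on_ray_ddn.
Qed.

(** After [n] tangential derivatives the terms with [c1] and [c2] have order [n] only and vanish at
    [p]. The normal (sin a, - cos a) is the unit vector of angle [a - PI / 2]. *)
Lemma robin_row (n : nat) (a c1 c2 : R) (f g : pt -> R) :
  sol k Om f -> sol k Om g -> vanishes (S n) f p -> vanishes (S n) g p ->
  zero_on_ray Om p (cos a) (sin a) (lin 1 (dd (sin a) (- cos a) f) 1 (lin c1 f c2 g)) ->
  cos (INR (S n) * a - PI / 2) * D1pow (S n) f p + sin (INR (S n) * a - PI / 2) * D1pow_D2 (S n) f p = 0.
Proof.
  intros Hf Hg Vf Vg HR.
  assert (Sd : sol k Om (dd (sin a) (- cos a) f)) by now apply sol_dd.
  assert (Sl : sol k Om (lin c1 f c2 g)) by now apply sol_lin.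
  pose proof (zero_on_ray_ddn n _ _ _ (sol_lin k Om 1 1 _ _ HO Sd Sl) HR) as E.
  rewrite (ddn_lin n _ _ _ _ _ _ Sd Sl p Hp) in E. unfold lin at 1 in E.
  rewrite (ddn_lin n _ _ _ _ _ _ Hf Hg p Hp) in E. unfold lin in E.
  rewrite (vanishes_ddn n _ _ f Hf Vf), (vanishes_ddn n _ _ g Hg Vg) in E.
  pose proof (dds_vanishes (a - PI / 2 :: repeat a n) f Hf) as D.
  simpl length in D. rewrite repeat_length in D.
  simpl dds in D. rewrite dds_repeat in D.
  change (lsum (a - PI / 2 :: repeat a n)) with (a - PI / 2 + lsum (repeat a n)) in D.
  rewrite lsum_repeat in D.
  replace (INR (S n) * a - PI / 2) with (a - PI / 2 + INR n * a) by (rewrite S_INR; ring).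
  rewrite <- D by trivial.
  replace (cos (a - PI / 2)) with (sin a).
  2:{ rewrite cos_minus, cos_PI2, sin_PI2. ring. }
  replace (sin (a - PI / 2)) with (- cos a).
  2:{ rewrite sin_minus, cos_PI2, sin_PI2. ring. }
  lra.
Qed.

(** [f] and [g] are the real and imaginary parts of one field and c1 + i c2 is the impedance, so the
    second case is the complex Robin condition. *)
Definition bc_on_ray (a : R) (f g : pt -> R) : Prop :=
  (zero_on_ray Om p (cos a) (sin a) f /\ zero_on_ray Om p (cos a) (sin a) g) \/
  (exists c1 c2,
    zero_on_ray Om p (cos a) (sin a) (lin 1 (dd (sin a) (- cos a) f) 1 (lin c1 f (- c2) g)) /\
    zero_on_ray Om p (cos a) (sin a) (lin 1 (dd (sin a) (- cos a) g) 1 (lin c1 g c2 f))).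

(** The row depends only on the type of condition, hence is common to both parts: [j = 0] for
    Dirichlet, [j = 1] for impedance. *)
Lemma bc_on_ray_row (n : nat) (a : R) (f g : pt -> R) :
  sol k Om f -> sol k Om g -> vanishes (S n) f p -> vanishes (S n) g p -> bc_on_ray a f g ->
  exists j : Z,
   (cos (INR (S n) * a - IZR j * (PI / 2)) * D1pow (S n) f p
    + sin (INR (S n) * a - IZR j * (PI / 2)) * D1pow_D2 (S n) f p = 0) /\
   (cos (INR (S n) * a - IZR j * (PI / 2)) * D1pow (S n) g p
    + sin (INR (S n) * a - IZR j * (PI / 2)) * D1pow_D2 (S n) g p = 0).
Proof.
  intros Hf Hg Vf Vg [[B1 B2]|(c1 & c2 & B1 & B2)].
  - exists 0%Z. rewrite Rmult_0_l, Rminus_0_r. split; now apply dirichlet_row.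
  - exists 1%Z. rewrite Rmult_1_l. split.
    + now apply (robin_row n a c1 (- c2) f g).
    + now apply (robin_row n a c1 c2 g f).
Qed.

Lemma rows_zero (x y A B : R) :
  sin (y - x) <> 0 -> cos x * A + sin x * B = 0 -> cos y * A + sin y * B = 0 -> A = 0 /\ B = 0.
Proof.
  intros Hs H1 H2. rewrite sin_minus in Hs. split.
  - apply (Rmult_eq_reg_l (sin y * cos x - cos y * sin x)); trivial.
    replace ((sin y * cos x - cos y * sin x) * A)
      with (sin y * (cos x * A + sin x * B) - sin x * (cos y * A + sin y * B)) by ring.
    rewrite H1, H2. ring.
  - apply (Rmult_eq_reg_l (sin y * cos x - cos y * sin x)); trivial.
    replace ((sin y * cos x - cos y * sin x) * B)
      with (cos x * (cos y * A + sin y * B) - cos y * (cos x * A + sin x * B)) by ring.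
    rewrite H1, H2. ring.
Qed.

(** The two rows have as determinant the sine of the difference of their phases; shifts of the
    phases by multiples of PI / 2 are the reason for the factor 2 in the angle hypothesis. *)
Lemma irrational_corner_vanishes (a b : R) (f g : pt -> R) :
  sol k Om f -> sol k Om g -> f p = 0 -> g p = 0 ->
  bc_on_ray a f g -> bc_on_ray b f g ->
  (forall (n : nat) (m : Z), 2 * INR (S n) * (b - a) <> IZR m * PI) ->
  forall N, vanishes N f p /\ vanishes N g p.
Proof.
  intros Hf Hg f0 g0 Ba Bb Hirr N. induction N as [|n [IHf IHg]]; [split; exact I|].
  (* Order 1 is the hypothesis on the values at [p]; rows are available only from degree 1 on. *)
  destruct n as [|n]; [split; simpl; tauto|].
  destruct (bc_on_ray_row n a f g Hf Hg IHf IHg Ba) as (i & Hi1 & Hi2).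
  destruct (bc_on_ray_row n b f g Hf Hg IHf IHg Bb) as (j & Hj1 & Hj2).
  assert (Hs : sin (INR (S n) * b - IZR j * (PI / 2) - (INR (S n) * a - IZR i * (PI / 2))) <> 0).
  { intros E. apply sin_eq_0_0 in E. destruct E as [m E].
    (* With N = n + 1, the equation reads N (b - a) - (j - i) PI / 2 = m PI; doubling it gives this
       multiple of PI. *)
    apply (Hirr n (2 * m + j - i)%Z). rewrite minus_IZR, plus_IZR, mult_IZR. lra. }
  destruct (rows_zero _ _ _ _ Hs Hi1 Hj1). destruct (rows_zero _ _ _ _ Hs Hi2 Hj2).
  split; now apply vanishes_succ.
Qed.

Lemma irrational_corner_zero (a b : R) (f g : pt -> R) :
  sol k Om f -> sol k Om g -> f p = 0 -> g p = 0 ->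
  bc_on_ray a f g -> bc_on_ray b f g ->
  (forall (n : nat) (m : Z), 2 * INR (S n) * (b - a) <> IZR m * PI) ->
  locally p (fun q => f q = 0) /\ locally p (fun q => g q = 0).
Proof.
  intros Hf Hg f0 g0 Ba Bb Hirr.
  pose proof (irrational_corner_vanishes a b f g Hf Hg f0 g0 Ba Bb Hirr) as V.
  split; apply (flat_zero_near k Om); trivial; intros n c d; apply vanishes_ddn; trivial; apply V.
Qed.

End Corner.

(** * Geometry of the gratings *)

Section Grating.

Variable g : pgrating.
Hypothesis Hadm : admissible g.

Lemma gf_periodic (n : Z) (x : R) : gf g (x + 2 * PI * IZR n) = gf g x.
Proof.
  destruct Hadm as (Hper & _).
  assert (Hn : forall (m : nat) y, gf g (y + 2 * PI * INR m) = gf g y).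
  { induction m as [|m IH]; intros y.
    - simpl. now rewrite Rmult_0_r, Rplus_0_r.
    - rewrite S_INR. replace (y + 2 * PI * (INR m + 1)) with (y + 2 * PI * INR m + 2 * PI) by ring.
      now rewrite Hper. }
  destruct (Z_le_dec 0 n) as [H|H].
  - rewrite <- (Z2Nat.id n H), <- INR_IZR_INZ. apply Hn.
  - replace x with ((x + 2 * PI * IZR n) + 2 * PI * INR (Z.to_nat (- n))) at 2.
    + now rewrite Hn.
    + rewrite INR_IZR_INZ, Z2Nat.id by lia. rewrite opp_IZR. ring.
Qed.

Lemma T_lt (j : nat) : (j < nbp g)%nat -> T g j < T g (S j).
Proof.
  intros Hj. destruct Hadm as (_ & H1 & H2 & _). unfold T.
  rewrite (proj2 (Nat.ltb_lt j (nbp g)) Hj).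
  destruct (S j <? nbp g)%nat eqn:E.
  - apply H2. now apply Nat.ltb_lt.
  - pose proof (H1 j Hj). assert (H0 := H1 0%nat ltac:(lia)). lra.
Qed.

Lemma T_last : T g (nbp g) = nth 0 (bp g) 0 + 2 * PI.
Proof. unfold T. now rewrite Nat.ltb_irrefl. Qed.

Lemma T_0 : (0 < nbp g)%nat -> T g 0 = nth 0 (bp g) 0.
Proof. intros H. unfold T. now rewrite (proj2 (Nat.ltb_lt _ _) H). Qed.

Lemma Z_shift (x t : R) : exists n : Z, t <= x + 2 * PI * IZR n < t + 2 * PI.
Proof.
  pose proof PI_RGT_0 as HPI.
  destruct (archimed ((t - x) / (2 * PI))) as [A1 A2].
  set (n := up ((t - x) / (2 * PI))) in *.
  assert (E : (t - x) = 2 * PI * ((t - x) / (2 * PI))) by (field; lra).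
  (* If the quotient is an integer, [up] exceeds it by a full 1 and would land on the excluded
     endpoint t + 2 PI. *)
  destruct (Req_dec (IZR n - (t - x) / (2 * PI)) 1) as [F|F].
  - exists (n - 1)%Z. rewrite minus_IZR. nra.
  - exists n. nra.
Qed.

Lemma piece_cover (x : R) : (0 < nbp g)%nat ->
  exists j n, (j < nbp g)%nat /\ T g j <= x + 2 * PI * IZR n < T g (S j).
Proof.
  intros H0. destruct (Z_shift x (T g 0)) as [n Hn].
  assert (Hm : forall m, (m <= nbp g)%nat -> T g 0 <= x + 2 * PI * IZR n < T g m ->
    exists j, (j < m)%nat /\ T g j <= x + 2 * PI * IZR n < T g (S j)).
  { induction m as [|m IH]; intros Hm Hx; [lra|].
    destruct (Rle_dec (T g m) (x + 2 * PI * IZR n)) as [C|C].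
    - exists m. split; [lia|lra].
    - destruct IH as (j & Hj & Hj'); [lia|lra|]. exists j. split; [lia|lra]. }
  destruct (Hm (nbp g)) as (j & Hj & Hx); [lia| |].
  - rewrite T_last. rewrite T_0 in * by trivial. lra.
  - now exists j, n.
Qed.

(** The piece to the left of breakpoint [j], cyclically; [jwrap] records the period crossed for
    [j = 0], where that piece is the last one of the preceding period. *)
Definition jprev (j : nat) : nat := if (j =? 0)%nat then (nbp g - 1)%nat else (j - 1)%nat.
Definition jwrap (j : nat) : Z := if (j =? 0)%nat then 1%Z else 0%Z.

Lemma jprev_lt (j : nat) : (j < nbp g)%nat -> (jprev j < nbp g)%nat.
Proof. intros H. unfold jprev. destruct (j =? 0)%nat; lia. Qed.

Lemma T_jprev_succ (j : nat) : (j < nbp g)%nat -> T g (S (jprev j)) = T g j + 2 * PI * IZR (jwrap j).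
Proof.
  intros H. unfold jprev, jwrap. destruct (j =? 0)%nat eqn:E.
  - apply Nat.eqb_eq in E. subst. replace (S (nbp g - 1)) with (nbp g) by lia.
    rewrite T_last, T_0 by lia. ring.
  - apply Nat.eqb_neq in E. replace (S (j - 1)) with j by lia. ring.
Qed.

Lemma Tprev_jprev (j : nat) : (j < nbp g)%nat -> Tprev g j + 2 * PI * IZR (jwrap j) = T g (jprev j).
Proof.
  intros H. unfold Tprev, jprev, jwrap, T. destruct (j =? 0)%nat eqn:E.
  - rewrite (proj2 (Nat.ltb_lt (nbp g - 1) (nbp g))) by lia. ring.
  - apply Nat.eqb_neq in E. rewrite (proj2 (Nat.ltb_lt (j - 1) (nbp g))) by lia. ring.
Qed.

(** Increments eliminate the intercept and make the statement invariant under translation by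
    periods. *)
Lemma piece_affine (j : nat) : (j < nbp g)%nat ->
  exists a, forall x t n, T g j <= x + 2 * PI * IZR n <= T g (S j) ->
    T g j <= x + t + 2 * PI * IZR n <= T g (S j) -> gf g (x + t) = gf g x + a * t.
Proof.
  intros Hj. destruct Hadm as (_ & _ & _ & _ & H). destruct (H j Hj) as (a & c & Hac).
  exists a. intros x t n H1 H2.
  rewrite <- (gf_periodic n x), <- (gf_periodic n (x + t)), (Hac _ H1), (Hac _ H2). ring.
Qed.

Lemma gf_locally_affine (x : R) : exists d aL aR, 0 < d /\
  forall t, 0 <= t <= d -> gf g (x + t) = gf g x + aR * t /\ gf g (x + - t) = gf g x + aL * - t.
Proof.
  destruct (Nat.eq_dec (nbp g) 0) as [E|E].
  - exists 1, 0, 0. split; [lra|]. intros t _.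
    destruct Hadm as (_ & _ & _ & Hc & _).
    rewrite (Hc E (x + t) x), (Hc E (x + - t) x). split; ring.
  - destruct (piece_cover x) as (j & n & Hj & Hx); [lia|].
    destruct (piece_affine j Hj) as [aR HR].
    (* The piece just to the left of [x] differs from [j] exactly when [x] sits on a breakpoint. *)
    assert (HL : exists i m, (i < nbp g)%nat /\ T g i < x + 2 * PI * IZR m <= T g (S i)).
    { destruct (Req_dec (x + 2 * PI * IZR n) (T g j)) as [F|F].
      - exists (jprev j), (n + jwrap j)%Z. split; [now apply jprev_lt|].
        pose proof (T_lt _ (jprev_lt j Hj)). rewrite (T_jprev_succ j Hj) in *.
        rewrite plus_IZR. replace (x + 2 * PI * (IZR n + IZR (jwrap j)))
          with (x + 2 * PI * IZR n + 2 * PI * IZR (jwrap j)) by ring. rewrite F. lra.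
      - exists j, n. split; trivial. lra. }
    destruct HL as (i & m & Hi & Hm). destruct (piece_affine i Hi) as [aL HLa].
    set (d1 := T g (S j) - (x + 2 * PI * IZR n)). set (d2 := x + 2 * PI * IZR m - T g i).
    exists (Rmin d1 d2), aL, aR. pose proof (Rmin_l d1 d2). pose proof (Rmin_r d1 d2).
    unfold d1, d2 in *. split; [apply Rmin_glb_lt; lra|]. intros t Ht. split.
    + apply (HR x t n); lra.
    + apply (HLa x (- t) m); lra.
Qed.

Lemma gf_lipschitz_at (x : R) : exists d K, 0 < d /\ 0 <= K /\
  forall t, Rabs t <= d -> Rabs (gf g (x + t) - gf g x) <= K * Rabs t.
Proof.
  destruct (gf_locally_affine x) as (d & aL & aR & Hd & H).
  pose proof (Rabs_pos aL). pose proof (Rabs_pos aR).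
  exists d, (Rabs aL + Rabs aR). split; trivial. split; [lra|]. intros t Ht.
  destruct (Rle_dec 0 t) as [C|C].
  - rewrite (Rabs_pos_eq t) in * by lra. rewrite (proj1 (H t (conj C Ht))).
    replace (gf g x + aR * t - gf g x) with (aR * t) by ring. rewrite Rabs_mult, (Rabs_pos_eq t) by lra.
    nra.
  - rewrite (Rabs_left t) in * by lra.
    assert (E := proj2 (H (- t) ltac:(lra))). rewrite Ropp_involutive in E. rewrite E.
    replace (gf g x + aL * t - gf g x) with (aL * t) by ring.
    rewrite Rabs_mult, (Rabs_left t) by lra. nra.
Qed.

Lemma gf_continuous (x : R) : forall e, 0 < e -> exists d, 0 < d /\
  forall y, Rabs (y - x) < d -> Rabs (gf g y - gf g x) < e.
Proof.
  intros e He. destruct (gf_lipschitz_at x) as (d & K & Hd & HK & H).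
  exists (Rmin d (e / (K + 1))).
  pose proof (Rmin_l d (e / (K + 1))). pose proof (Rmin_r d (e / (K + 1))).
  assert (He' : 0 < e / (K + 1)) by (apply Rdiv_lt_0_compat; lra).
  split; [apply Rmin_glb_lt; lra|]. intros y Hy.
  specialize (H (y - x) ltac:(lra)). replace (x + (y - x)) with y in H by ring.
  assert (Rabs (y - x) * (K + 1) < e).
  { replace e with (e / (K + 1) * (K + 1)) by (field; lra).
    apply Rmult_lt_compat_r; lra. }
  pose proof (Rabs_pos (y - x)). nra.
Qed.

Lemma Omega_open : open (Omega g).
Proof.
  intros [x y] Hp. unfold Omega in Hp; simpl in Hp. apply locally_box.
  destruct (gf_continuous x ((y - gf g x) / 2)) as (d & Hd & H); [lra|].
  exists (Rmin d ((y - gf g x) / 2)).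
  pose proof (Rmin_l d ((y - gf g x) / 2)). pose proof (Rmin_r d ((y - gf g x) / 2)).
  split; [apply Rmin_glb_lt; lra|]. intros [u v] [Hu Hv]. simpl in Hu, Hv.
  specialize (H u ltac:(lra)). apply Rabs_def2 in H. apply Rabs_def2 in Hv.
  unfold Omega; simpl. lra.
Qed.

Lemma closure_Omega (p : pt) : closure2 (Omega g) p -> gf g (fst p) <= snd p.
Proof.
  intros H. destruct (Rle_dec (gf g (fst p)) (snd p)) as [C|C]; trivial. exfalso.
  set (e := (gf g (fst p) - snd p) / 2).
  destruct (gf_continuous (fst p) e) as (d & Hd & Hc); [unfold e; lra|].
  destruct (H (Rmin d e)) as (q & Hq & Hdist).
  { apply Rmin_glb_lt; unfold e; lra. }
  pose proof (Rmin_l d e). pose proof (Rmin_r d e).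
  unfold dist2 in Hdist.
  assert (B : forall a b r, sqrt (a ^ 2 + b ^ 2) < r -> Rabs a < r /\ Rabs b < r).
  { intros a b r Hr. pose proof (pow2_ge_0 a). pose proof (pow2_ge_0 b). split.
    - eapply Rle_lt_trans; [|exact Hr]. rewrite <- sqrt_Rsqr_abs, Rsqr_pow2. apply sqrt_le_1; lra.
    - eapply Rle_lt_trans; [|exact Hr]. rewrite <- sqrt_Rsqr_abs, Rsqr_pow2. apply sqrt_le_1; lra. }
  apply B in Hdist. destruct Hdist as [D1' D2'].
  rewrite Rabs_minus_sym in D1', D2'.
  specialize (Hc (fst q) ltac:(lra)). apply Rabs_def2 in Hc. apply Rabs_def2 in D2'.
  unfold Omega in Hq. unfold e in *. lra.
Qed.

(** The supremum is attained on a compact period, hence lies strictly below [b]; the gap is the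
    height over which evanescent modes decay. *)
Lemma gf_max (b : R) : (forall t, Rabs (gf g t) < b) -> exists b', b' < b /\ forall t, gf g t < b'.
Proof.
  intros Hb. pose proof PI_RGT_0 as HPI.
  destruct (continuity_ab_maj (gf g) 0 (2 * PI)) as (m & Hm & _); [lra| |].
  - intros c _ e He. destruct (gf_continuous c e He) as (d & Hd & H).
    exists d. split; trivial. intros y [_ Hy]. apply H. exact Hy.
  - pose proof (Hb m) as Hbm. apply Rabs_def2 in Hbm.
    exists ((gf g m + b) / 2). split; [lra|]. intros t.
    destruct (Z_shift t 0) as [n Hn]. rewrite <- (gf_periodic n t).
    assert (gf g (t + 2 * PI * IZR n) <= gf g m) by (apply Hm; lra). lra.
Qed.

(** [acos] answers in [0, PI] whereas [psi] ranges up to 2 PI; either th = psi or th = 2 PI - psi,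
    and irrationality passes from one to the other. *)
Lemma angle_irrational (th psi : R) :
  (forall p q : Z, q <> 0%Z -> th * IZR q <> IZR p * PI) ->
  0 <= psi <= 2 * PI -> th = acos (cos psi) ->
  forall (n : nat) (m : Z), 2 * INR (S n) * psi <> IZR m * PI.
Proof.
  intros Hth Hpsi E n m F.
  assert (Hq : (2 * Z.of_nat (S n))%Z <> 0%Z) by lia.
  destruct (Rle_dec psi PI) as [C|C].
  - rewrite acos_cos in E by lra. subst th. apply (Hth m _ Hq).
    rewrite mult_IZR, <- INR_IZR_INZ. rewrite <- F. ring.
  - replace (cos psi) with (cos (2 * PI - psi)) in E.
    2:{ rewrite cos_minus, cos_2PI, sin_2PI. ring. }
    rewrite acos_cos in E by lra. subst th.
    apply (Hth (2 * (2 * Z.of_nat (S n)) - m)%Z _ Hq).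
    rewrite minus_IZR, !mult_IZR, <- INR_IZR_INZ.
    replace ((2 * (2 * INR (S n)) - IZR m) * PI)
      with (2 * (2 * INR (S n)) * PI - IZR m * PI) by ring.
    rewrite <- F. ring.
Qed.

(** The right edge leaves the corner at angle [atan aR] and the left one at [atan aL + PI]; the
    difference is the angle seen from above the graph. *)
Lemma corner_structure (j : nat) (n : Z) :
  irrational_grating g -> (j < nbp g)%nat ->
  let x := T g j + 2 * PI * IZR n in
  exists aL aR d, 0 < d /\
    (forall t, 0 < t < d -> on_piece g j (x + t) /\ gf g (x + t) = gf g x + aR * t) /\
    (forall t, 0 < t < d -> on_piece g (jprev j) (x - t) /\ gf g (x - t) = gf g x - aL * t) /\
    (forall (N : nat) (m : Z), 2 * INR (S N) * (atan aL + PI - atan aR) <> IZR m * PI).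
Proof.
  intros Hirr Hj x. pose proof PI_RGT_0 as HPI.
  pose proof (T_lt j Hj) as HT. pose proof (T_lt _ (jprev_lt j Hj)) as HT'.
  pose proof (T_jprev_succ j Hj) as HS. pose proof (Tprev_jprev j Hj) as HP.
  destruct (piece_affine j Hj) as [aR HR].
  destruct (piece_affine _ (jprev_lt j Hj)) as [aL HL].
  exists aL, aR, (Rmin (T g (S j) - T g j) (T g j - Tprev g j)).
  pose proof (Rmin_l (T g (S j) - T g j) (T g j - Tprev g j)).
  pose proof (Rmin_r (T g (S j) - T g j) (T g j - Tprev g j)).
  assert (HTp : Tprev g j < T g j) by lra.
  split; [apply Rmin_glb_lt; lra|]. split; [|split].
  - intros t Ht. split.
    + right. split; trivial. exists (- n)%Z. rewrite opp_IZR. unfold x. lra.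
    + apply (HR x t (- n)%Z); rewrite opp_IZR; unfold x; lra.
  - intros t Ht. split.
    + right. split; [now apply jprev_lt|]. exists (- n + jwrap j)%Z.
      rewrite plus_IZR, opp_IZR. unfold x. lra.
    + unfold Rminus. replace (- (aL * t)) with (aL * - t) by ring.
      apply (HL x (- t) (- n + jwrap j)%Z); rewrite plus_IZR, opp_IZR; unfold x; lra.
  - pose proof (atan_bound aL) as BL. pose proof (atan_bound aR) as BR.
    apply (angle_irrational (corner_angle g j)).
    + now apply Hirr.
    + lra.
    + unfold corner_angle. f_equal.
      set (l := T g j - Tprev g j). set (l' := T g (S j) - T g j).
      assert (E1 : gf g (Tprev g j) - gf g (T g j) = aL * - l).
      { replace (Tprev g j) with (T g j + - l) by (unfold l; ring).
        rewrite (HL (T g j) (- l) (jwrap j)) by (unfold l; lra). ring. }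
      assert (E2 : gf g (T g (S j)) - gf g (T g j) = aR * l').
      { replace (T g (S j)) with (T g j + l') by (unfold l'; ring).
        rewrite (HR (T g j) l' 0%Z) by (unfold l'; lra). ring. }
      rewrite E1, E2. replace (Tprev g j - T g j) with (- l) by (unfold l; ring).
      assert (Hl : 0 < l) by (unfold l; lra). assert (Hl' : 0 < l') by (unfold l'; lra).
      assert (S1 : sqrt ((- l) ^ 2 + (aL * - l) ^ 2) = l * sqrt (1 + aL ^ 2)).
      { replace ((- l) ^ 2 + (aL * - l) ^ 2) with (l ^ 2 * (1 + aL ^ 2)) by ring.
        pose proof (pow2_ge_0 aL). rewrite sqrt_mult by nra. now rewrite sqrt_pow2 by lra. }
      assert (S2 : sqrt (l' ^ 2 + (aR * l') ^ 2) = l' * sqrt (1 + aR ^ 2)).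
      { replace (l' ^ 2 + (aR * l') ^ 2) with (l' ^ 2 * (1 + aR ^ 2)) by ring.
        pose proof (pow2_ge_0 aR). rewrite sqrt_mult by nra. now rewrite sqrt_pow2 by lra. }
      rewrite S1, S2.
      replace (atan aL + PI - atan aR) with ((atan aL - atan aR) + PI) by ring.
      rewrite neg_cos, cos_minus, !cos_atan, !sin_atan, <- !Rsqr_pow2.
      assert (0 < sqrt (1 + Rsqr aL)) by (apply sqrt_lt_R0; pose proof (Rle_0_sqr aL); lra).
      assert (0 < sqrt (1 + Rsqr aR)) by (apply sqrt_lt_R0; pose proof (Rle_0_sqr aR); lra).
      field. repeat split; lra.
Qed.

End Grating.

(** * Transfer of the boundary conditions *)

Lemma within_Omega_proper (g : pgrating) (x : R) :
  ProperFilter (within (Omega g) (locally ((x, gf g x) : pt))).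
Proof.
  constructor; [|apply within_filter, locally_filter].
  intros P HP. apply locally_box in HP. destruct HP as (e & He & HP).
  exists (x, gf g x + e / 2). apply HP.
  - split; simpl; apply Rabs_def1; lra.
  - unfold Omega; simpl; lra.
Qed.

(** [h] is continuous across the graph and agrees with [f] on one side, so one-sided limits in the
    boundary condition become plain values of [h]. *)
Lemma limit_transfer (g : pgrating) (f h : pt -> R) (Om : pt -> Prop) (x a : R) :
  open Om -> Om (x, gf g x) -> continuous h (x, gf g x) ->
  (forall q, Omega g q -> Om q -> f q = h q) ->
  filterlim f (within (Omega g) (locally ((x, gf g x) : pt))) (locally a) ->
  a = h (x, gf g x).
Proof.
  intros HO Hp Hc E HL.
  pose proof (within_Omega_proper g x) as PF.
  apply (filterlim_locally_unique (F := within (Omega g) (locally ((x, gf g x) : pt))) f); trivial.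
  apply (filterlim_ext_loc h).
  - generalize (HO _ Hp). unfold within. apply filter_imp. intros q Hq HOm. symmetry. now apply E.
  - apply filterlim_within_ext with h; trivial.
    apply (filterlim_filter_le_1 (F := locally ((x, gf g x) : pt))); [|exact Hc].
    intros P HP. unfold within. revert HP. apply filter_imp. trivial.
Qed.

Lemma helmholtz_sol (k : R) (Om : pt -> Prop) (u : pt -> C) :
  helmholtz_on Om k u -> sol k Om (ReF u) /\ sol k Om (ImF u).
Proof.
  intros H.
  assert (Key : forall h, (forall p, Om p -> C2_at h p) -> C2on Om h).
  { intros h Hh. split; [|split]; intros p Hp;
      destruct (Hh p Hp) as (a1 & a2 & a3 & a4 & a5 & a6 & a7 & a8 & a9 & b1 & b2 & b3 & b4);
      repeat (split; trivial). }
  split; split.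
  - apply Key. intros p Hp. apply (H p Hp).
  - intros p Hp. apply (H p Hp).
  - apply Key. intros p Hp. apply (H p Hp).
  - intros p Hp. apply (H p Hp).
Qed.

(** Real and imaginary parts of the boundary condition; for [a = atan s] the vector (sin a, - cos a)
    is the normal (s, -1) / sqrt (1 + s^2). *)
Definition bc_eq (o : option C) (a : R) (f h : pt -> R) (q : pt) : Prop :=
  match o with
  | None => f q = 0 /\ h q = 0
  | Some eta =>
      dd (sin a) (- cos a) f q + (fst eta * f q - snd eta * h q) = 0 /\
      dd (sin a) (- cos a) h q + (fst eta * h q + snd eta * f q) = 0
  end.

Lemma filterlim_fst_C (T : Type) (F : (T -> Prop) -> Prop) (u : T -> C) (a : C) :
  filterlim u F (locally a) -> filterlim (fun t => fst (u t)) F (locally (fst a)).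
Proof. intros H. apply (filterlim_comp _ _ _ u fst F (locally a)); trivial. apply continuous_fst. Qed.

Lemma filterlim_snd_C (T : Type) (F : (T -> Prop) -> Prop) (u : T -> C) (a : C) :
  filterlim u F (locally a) -> filterlim (fun t => snd (u t)) F (locally (snd a)).
Proof. intros H. apply (filterlim_comp _ _ _ u snd F (locally a)); trivial. apply continuous_snd. Qed.

Lemma bc_transfer (g : pgrating) (j : nat) (u : pt -> C) (k : R) (Om : pt -> Prop)
    (f h : pt -> R) (x s : R) :
  admissible g -> open Om -> sol k Om f -> sol k Om h ->
  (forall q, Omega g q -> Om q -> u q = (f q, h q)) ->
  Om (x, gf g x) -> Derive (gf g) x = s -> bc_at g j u x ->
  bc_eq (geta g j) (atan s) f h (x, gf g x).
Proof.
  intros Hadm HO Hf Hh E Hp Hs Hbc. unfold bc_at in Hbc. rewrite Hs in Hbc.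
  assert (Cf := sol_C1 _ _ _ Hf). assert (Ch := sol_C1 _ _ _ Hh).
  assert (Ef : forall q, Omega g q -> Om q -> ReF u q = f q)
    by (intros q H1 H2; unfold ReF; now rewrite (E q H1 H2)).
  assert (Eh : forall q, Omega g q -> Om q -> ImF u q = h q)
    by (intros q H1 H2; unfold ImF; now rewrite (E q H1 H2)).
  unfold bc_eq. destruct (geta g j) as [eta|].
  - destruct Hbc as (a & d1 & d2 & La & L1 & L2 & Heq).
    (* Derivatives can be compared only where the functions agree on an open set. *)
    set (O' := fun q => Omega g q /\ Om q).
    assert (HO' : open O') by (apply open_and; [now apply Omega_open|trivial]).
    assert (Ef' : eqon O' (ReF u) f) by (intros q [? ?]; now apply Ef).
    assert (Eh' : eqon O' (ImF u) h) by (intros q [? ?]; now apply Eh).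
    assert (A1 := limit_transfer g _ f Om x _ HO Hp (C1on_cont _ _ Cf _ Hp) Ef (filterlim_fst_C _ _ _ _ La)).
    assert (A2 := limit_transfer g _ h Om x _ HO Hp (C1on_cont _ _ Ch _ Hp) Eh (filterlim_snd_C _ _ _ _ La)).
    assert (B1 := limit_transfer g _ (D1 f) Om x _ HO Hp (C1on_cont1 _ _ Cf _ Hp)
      (fun q H1 H2 => eqon_D1 O' _ _ HO' Ef' q (conj H1 H2)) (filterlim_fst_C _ _ _ _ L1)).
    assert (B2 := limit_transfer g _ (D1 h) Om x _ HO Hp (C1on_cont1 _ _ Ch _ Hp)
      (fun q H1 H2 => eqon_D1 O' _ _ HO' Eh' q (conj H1 H2)) (filterlim_snd_C _ _ _ _ L1)).
    assert (B3 := limit_transfer g _ (D2 f) Om x _ HO Hp (C1on_cont2 _ _ Cf _ Hp)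
      (fun q H1 H2 => eqon_D2 O' _ _ HO' Ef' q (conj H1 H2)) (filterlim_fst_C _ _ _ _ L2)).
    assert (B4 := limit_transfer g _ (D2 h) Om x _ HO Hp (C1on_cont2 _ _ Ch _ Hp)
      (fun q H1 H2 => eqon_D2 O' _ _ HO' Eh' q (conj H1 H2)) (filterlim_snd_C _ _ _ _ L2)).
    unfold Cplus, Cmult, RtoC in Heq. simpl fst in Heq. simpl snd in Heq.
    injection Heq as H1 H2. rewrite A1, A2, B1, B3 in H1. rewrite A1, A2, B2, B4 in H2.
    unfold dd, lin. rewrite sin_atan, cos_atan. replace (s * (s * 1)) with (Rsqr s) in H1, H2 by (unfold Rsqr; ring).
    unfold Rdiv in *. split; lra.
  - split; symmetry.
    + apply (limit_transfer g _ f Om x 0 HO Hp (C1on_cont _ _ Cf _ Hp) Ef (filterlim_fst_C _ _ _ _ Hbc)).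
    + apply (limit_transfer g _ h Om x 0 HO Hp (C1on_cont _ _ Ch _ Hp) Eh (filterlim_snd_C _ _ _ _ Hbc)).
Qed.

(** [cre] and [cim] are the real and imaginary parts of a1 (f1 + i h1) + a2 (f2 + i h2). *)
Definition cre (a1 : C) (f1 h1 : pt -> R) (a2 : C) (f2 h2 : pt -> R) : pt -> R :=
  lin 1 (lin (fst a1) f1 (- snd a1) h1) 1 (lin (fst a2) f2 (- snd a2) h2).
Definition cim (a1 : C) (f1 h1 : pt -> R) (a2 : C) (f2 h2 : pt -> R) : pt -> R :=
  lin 1 (lin (fst a1) h1 (snd a1) f1) 1 (lin (fst a2) h2 (snd a2) f2).

Lemma sol_cre (k : R) (Om : pt -> Prop) (a1 a2 : C) (f1 h1 f2 h2 : pt -> R) :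
  open Om -> sol k Om f1 -> sol k Om h1 -> sol k Om f2 -> sol k Om h2 ->
  sol k Om (cre a1 f1 h1 a2 f2 h2).
Proof. intros. unfold cre. apply sol_lin; trivial; apply sol_lin; trivial. Qed.

Lemma sol_cim (k : R) (Om : pt -> Prop) (a1 a2 : C) (f1 h1 f2 h2 : pt -> R) :
  open Om -> sol k Om f1 -> sol k Om h1 -> sol k Om f2 -> sol k Om h2 ->
  sol k Om (cim a1 f1 h1 a2 f2 h2).
Proof. intros. unfold cim. apply sol_lin; trivial; apply sol_lin; trivial. Qed.

Lemma dd_lin (k : R) (Om : pt -> Prop) (c s a b : R) (f g : pt -> R) (q : pt) :
  sol k Om f -> sol k Om g -> Om q ->
  dd c s (lin a f b g) q = a * dd c s f q + b * dd c s g q.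
Proof.
  intros Hf Hg Hq. unfold dd, lin at 1.
  rewrite (D1_lin Om a b f g (sol_C1 _ _ _ Hf) (sol_C1 _ _ _ Hg) q Hq).
  rewrite (D2_lin Om a b f g (sol_C1 _ _ _ Hf) (sol_C1 _ _ _ Hg) q Hq).
  unfold lin. ring.
Qed.

(** The condition is complex linear; a complex impedance couples the two parts, so they have to be
    carried together. *)
Lemma bc_eq_lin (k : R) (Om : pt -> Prop) (o : option C) (a : R) (a1 a2 : C)
    (f1 h1 f2 h2 : pt -> R) (q : pt) :
  open Om -> sol k Om f1 -> sol k Om h1 -> sol k Om f2 -> sol k Om h2 -> Om q ->
  bc_eq o a f1 h1 q -> bc_eq o a f2 h2 q ->
  bc_eq o a (cre a1 f1 h1 a2 f2 h2) (cim a1 f1 h1 a2 f2 h2) q.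
Proof.
  intros HO F1 H1 F2 H2 Hq. unfold bc_eq, cre, cim. destruct o as [eta|].
  - intros [A B] [A' B'].
    rewrite !(dd_lin k Om) by (trivial; now apply sol_lin).
    unfold lin.
    set (x1 := dd (sin a) (- cos a) f1 q) in *. set (x2 := dd (sin a) (- cos a) h1 q) in *.
    set (x3 := dd (sin a) (- cos a) f2 q) in *. set (x4 := dd (sin a) (- cos a) h2 q) in *.
    replace x1 with (- (fst eta * f1 q - snd eta * h1 q)) by lra.
    replace x2 with (- (fst eta * h1 q + snd eta * f1 q)) by lra.
    replace x3 with (- (fst eta * f2 q - snd eta * h2 q)) by lra.
    replace x4 with (- (fst eta * h2 q + snd eta * f2 q)) by lra.
    split; ring.
  - intros [A B] [A' B']. unfold lin. rewrite A, B, A', B'. split; ring.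
Qed.

Lemma ray_in_open (Om : pt -> Prop) (p : pt) (a b : R) :
  open Om -> Om p -> Rabs a <= 1 -> Rabs b <= 1 ->
  exists d, 0 < d /\ forall t, 0 < t < d -> Om (fst p + t * a, snd p + t * b).
Proof.
  intros HO Hp Ha Hb. destruct (proj1 (locally_box p Om) (HO p Hp)) as (e & He & H).
  exists e. split; trivial. intros t Ht. apply H. pose proof (Rabs_pos a). pose proof (Rabs_pos b).
  split; simpl.
  - replace (fst p + t * a - fst p) with (t * a) by ring.
    rewrite Rabs_mult, (Rabs_pos_eq t) by lra. nra.
  - replace (snd p + t * b - snd p) with (t * b) by ring.
    rewrite Rabs_mult, (Rabs_pos_eq t) by lra. nra.
Qed.

(* [c = 1] is the right edge of a corner, [c = -1] the left edge, whose direction is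
   [atan s + PI]; the sign absorbs the orientation of the normal into the impedance. *)
Lemma bc_eq_ray (Om : pt -> Prop) (p : pt) (o : option C) (f h : pt -> R) (s d c a : R) :
  open Om -> Om p -> 0 < d -> c = 1 \/ c = -1 ->
  cos a = c * cos (atan s) -> sin a = c * sin (atan s) ->
  (forall t, 0 < t < d -> bc_eq o (atan s) f h (fst p + c * t, snd p + s * (c * t))) ->
  bc_on_ray Om p a f h.
Proof.
  intros HO Hp Hd Hc Ca Sa H.
  destruct (ray_in_open Om p (cos a) (sin a) HO Hp (Rabs_cos_le a) (Rabs_sin_le a)) as (e & He & HOm).
  set (z := cos (atan s)).
  assert (Hz : 0 < z) by (unfold z; pose proof (atan_bound s); apply cos_gt_0; lra).
  assert (Hz1 : z <= 1) by apply COS_bound.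
  assert (Hs : sin (atan s) = s * z).
  { unfold z. rewrite sin_atan, cos_atan. unfold Rdiv. ring. }
  assert (Pt : forall t, (fst p + t * cos a, snd p + t * sin a)
     = (fst p + c * (t * z), snd p + s * (c * (t * z)))).
  { intros t. rewrite Ca, Sa, Hs. fold z. f_equal; ring. }
  assert (Hmin : 0 < Rmin d e) by (now apply Rmin_glb_lt).
  pose proof (Rmin_l d e). pose proof (Rmin_r d e).
  destruct o as [eta|].
  - right. exists (c * fst eta), (c * snd eta). split; exists (Rmin d e); (split; [trivial|]);
      intros t Ht; (split; [apply HOm; lra|]); rewrite Pt;
      destruct (H (t * z) ltac:(nra)) as [A B]; unfold lin; unfold dd, lin in A, B |- *;
      rewrite Ca, Sa.
    + match type of A with ?x = 0 => match goal with |- ?y = _ =>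
        change (@eq R y 0); assert (Y : @eq R y (c * x)) by ring; rewrite Y end end.
      rewrite A. ring.
    + match type of B with ?x = 0 => match goal with |- ?y = _ =>
        change (@eq R y 0); assert (Y : @eq R y (c * x)) by ring; rewrite Y end end.
      rewrite B. ring.
  - left. split; exists (Rmin d e); (split; [trivial|]);
      intros t Ht; (split; [apply HOm; lra|]); rewrite Pt;
      destruct (H (t * z) ltac:(nra)) as [A B]; trivial.
Qed.

Lemma Derive_locally_affine (f : R -> R) (x s d : R) :
  0 < d -> (forall t, Rabs t < d -> f (x + t) = f x + s * t) -> Derive f x = s.
Proof.
  intros Hd H. rewrite (Derive_ext_loc f (fun y => f x + s * (y - x))).
  - apply is_derive_unique. auto_derive; trivial. ring.
  - exists (mkposreal d Hd). intros y Hy. change (Rabs (y - x) < d) in Hy.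
    rewrite <- H by trivial. apply f_equal.
    assert (E : y = x + (y - x) :> R) by (simpl in y; ring). exact E.
Qed.

(** The pairs (f1, h1) and (f2, h2) are smooth on both sides of the corner and stand for the fields
    of the other grating; [u1] and [u2] supply the boundary conditions on the edges of [g]. *)
Lemma corner_local_zero (g : pgrating) (k : R) (Om : pt -> Prop) (u1 u2 : pt -> C)
    (f1 h1 f2 h2 : pt -> R) (p : pt) (a1 a2 : C) :
  admissible g -> irrational_grating g -> corner g p -> 0 < k -> open Om -> Om p ->
  sol k Om f1 -> sol k Om h1 -> sol k Om f2 -> sol k Om h2 ->
  (forall q, Omega g q -> Om q -> u1 q = (f1 q, h1 q)) ->
  (forall q, Omega g q -> Om q -> u2 q = (f2 q, h2 q)) ->
  (forall j x, on_piece g j x -> bc_at g j u1 x) ->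
  (forall j x, on_piece g j x -> bc_at g j u2 x) ->
  cre a1 f1 h1 a2 f2 h2 p = 0 -> cim a1 f1 h1 a2 f2 h2 p = 0 ->
  locally p (fun q => cre a1 f1 h1 a2 f2 h2 q = 0) /\
  locally p (fun q => cim a1 f1 h1 a2 f2 h2 q = 0).
Proof.
  intros Hadm Hirr (j & n & Hj & Ep) Hk HO Hp F1 H1 F2 H2 E1 E2 B1 B2 Z1 Z2.
  destruct (corner_structure g Hadm j n Hirr Hj) as (aL & aR & d & Hd & HR & HL & Hang).
  set (x := T g j + 2 * PI * IZR n) in *.
  assert (Ep' : p = (x, gf g x)).
  { rewrite Ep. unfold x. now rewrite gf_periodic. }
  clear Ep.
  assert (Edge : forall (i : nat) (s c a : R), c = 1 \/ c = -1 ->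
    cos a = c * cos (atan s) -> sin a = c * sin (atan s) ->
    (forall t, 0 < t < d -> on_piece g i (x + c * t) /\ gf g (x + c * t) = gf g x + s * (c * t)) ->
    bc_on_ray Om p a (cre a1 f1 h1 a2 f2 h2) (cim a1 f1 h1 a2 f2 h2)).
  { intros i s c a Hc Ca Sa HE.
    destruct (ray_in_open Om p (cos a) (sin a) HO Hp (Rabs_cos_le a) (Rabs_sin_le a)) as (e & He & HOm).
    (* A horizontal displacement [t] is a distance [t / z] along the edge. *)
    set (z := cos (atan s)).
    assert (Hz : 0 < z) by (unfold z; pose proof (atan_bound s); apply cos_gt_0; lra).
    assert (Hsz : sin (atan s) = s * z).
    { unfold z. rewrite sin_atan, cos_atan. unfold Rdiv. ring. }
    assert (Hez : 0 < e * z) by (now apply Rmult_lt_0_compat).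
    pose proof (Rmin_l d (e * z)). pose proof (Rmin_r d (e * z)).
    apply (bc_eq_ray Om p (geta g i) _ _ s (Rmin d (e * z)) c a); trivial.
    { now apply Rmin_glb_lt. }
    intros t Ht. destruct (HE t ltac:(lra)) as [Hon Hgf].
    assert (Eq : (fst p + c * t, snd p + s * (c * t)) = (x + c * t, gf g (x + c * t))).
    { rewrite Hgf, Ep'. reflexivity. }
    assert (Hin : Om (fst p + c * t, snd p + s * (c * t))).
    { replace (fst p + c * t, snd p + s * (c * t))
        with (fst p + t / z * cos a, snd p + t / z * sin a).
      - apply HOm. split; [apply Rdiv_lt_0_compat; lra|].
        apply (Rmult_lt_reg_r z); trivial.
        replace (t / z * z) with t by (field; lra). lra.
      - rewrite Ca, Sa, Hsz. fold z. f_equal; field; lra. }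
    assert (HD : Derive (gf g) (x + c * t) = s).
    { assert (Hm : 0 < Rmin t (d - t)) by (apply Rmin_glb_lt; lra).
      apply (Derive_locally_affine _ _ _ (Rmin t (d - t)) Hm).
      intros y Hy. pose proof (Rmin_l t (d - t)). pose proof (Rmin_r t (d - t)).
      apply Rabs_def2 in Hy. rewrite Hgf.
      assert (Ht' : 0 < t + c * y < d) by (destruct Hc; subst c; lra).
      assert (Hcc : c * c = 1) by (destruct Hc; subst c; lra).
      replace (x + c * t + y) with (x + c * (t + c * y)) by (rewrite Rmult_plus_distr_l, <- Rmult_assoc, Hcc; ring).
      rewrite (proj2 (HE _ Ht')). rewrite Rmult_plus_distr_l, <- Rmult_assoc, Hcc. ring. }
    rewrite Eq in Hin |- *.
    apply (bc_eq_lin k Om); trivial.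
    - apply (bc_transfer g i u1 k Om); trivial. now apply B1.
    - apply (bc_transfer g i u2 k Om); trivial. now apply B2. }
  assert (S1 := sol_cre k Om a1 a2 f1 h1 f2 h2 HO F1 H1 F2 H2).
  assert (S2 := sol_cim k Om a1 a2 f1 h1 f2 h2 HO F1 H1 F2 H2).
  apply (irrational_corner_zero k Om p Hk HO Hp (atan aR) (atan aL + PI)); trivial.
  - apply (Edge j aR 1); [now left|ring|ring|]. intros t Ht. rewrite !Rmult_1_l. now apply HR.
  - apply (Edge (jprev g j) aL (-1)); [now right|rewrite neg_cos; ring|rewrite neg_sin; ring|].
    intros t Ht. destruct (HL t Ht) as [X Y].
    replace (x + -1 * t) with (x - t) by ring. split; trivial. rewrite Y. ring.
Qed.

(** * Trigonometric series *)

Definition cis (t : R) : C := (cos t, sin t).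

Lemma cis_plus (a b : R) : cis (a + b) = Cmult (cis a) (cis b).
Proof. unfold cis, Cmult; simpl. rewrite cos_plus, sin_plus. f_equal; ring. Qed.

Lemma cis_0 : cis 0 = RtoC 1.
Proof. unfold cis. now rewrite cos_0, sin_0. Qed.

Lemma Cmod_cis (t : R) : Cmod (cis t) = 1.
Proof.
  unfold Cmod, cis; simpl. pose proof (sin2_cos2 t) as H. unfold Rsqr in H.
  replace (cos t * (cos t * 1) + sin t * (sin t * 1)) with 1 by lra. apply sqrt_1.
Qed.

Lemma cis_PI_shift (n : Z) (t : R) : cis (t + 2 * PI * IZR n) = cis t.
Proof.
  assert (H : forall m : nat, forall s, cis (s + 2 * PI * INR m) = cis s).
  { intros m s. unfold cis. replace (s + 2 * PI * INR m) with (s + 2 * INR m * PI) by ring.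
    now rewrite cos_period, sin_period. }
  destruct (Z_le_dec 0 n) as [C|C].
  - rewrite <- (Z2Nat.id n C), <- INR_IZR_INZ. apply H.
  - rewrite <- (H (Z.to_nat (- n)) (t + 2 * PI * IZR n)).
    rewrite INR_IZR_INZ, Z2Nat.id, opp_IZR by lia. f_equal. ring.
Qed.

Lemma cis_eq_1 (t : R) : cis t = RtoC 1 -> exists m : Z, t = 2 * PI * IZR m.
Proof.
  intros H. injection H as Hc Hs.
  replace t with (2 * (t / 2)) in Hc by field. rewrite cos_2a_sin in Hc.
  assert (Hz : sin (t / 2) = 0) by nra. apply sin_eq_0_0 in Hz. destruct Hz as [m Hm].
  exists m. lra.
Qed.

Lemma cexp_split (a b : R) : cexp (a, b) = Cmult (RtoC (exp a)) (cis b).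
Proof. unfold cexp, Cmult, RtoC, cis; simpl. f_equal; ring. Qed.

(** Limits are measured by the multiplicative [Cmod], while the uniform structure of [C] compares
    coordinates. *)
Definition tlim (s : nat -> C) (l : C) : Prop :=
  forall e, 0 < e -> exists N, forall n, (N <= n)%nat -> Cmod (Cminus (s n) l) < e.

Lemma filterlim_tlim (s : nat -> C) (l : C) :
  filterlim s eventually (locally l) -> tlim s l.
Proof.
  intros H e He.
  assert (H2 : 0 < sqrt 2) by (apply sqrt_lt_R0; lra).
  (* Passing from coordinates to [Cmod] costs a factor sqrt 2. *)
  assert (He2 : 0 < e / sqrt 2) by (now apply Rdiv_lt_0_compat).
  destruct (H (fun z => Cmod (Cminus z l) < e)) as [N HN].
  - exists (mkposreal _ He2). intros z Hz.
    pose proof (C_NormedModule_mixin_compat2 l z _ Hz) as B. simpl in B.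
    replace (sqrt 2 * (e / sqrt 2)) with e in B by (field; lra). exact B.
  - exists N. exact HN.
Qed.

Lemma tlim_scal (s : nat -> C) (l c : C) :
  tlim s l -> tlim (fun n => Cmult c (s n)) (Cmult c l).
Proof.
  intros H e He. pose proof (Cmod_ge_0 c) as Hc.
  destruct (H (e / (Cmod c + 1))) as [N HN]; [apply Rdiv_lt_0_compat; lra|].
  exists N. intros n Hn. specialize (HN n Hn).
  replace (Cminus (Cmult c (s n)) (Cmult c l)) with (Cmult c (Cminus (s n) l)) by ring.
  rewrite Cmod_mult.
  assert (Cmod (Cminus (s n) l) * (Cmod c + 1) < e).
  { replace e with (e / (Cmod c + 1) * (Cmod c + 1)) by (field; lra).
    apply Rmult_lt_compat_r; lra. }
  pose proof (Cmod_ge_0 (Cminus (s n) l)). nra.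
Qed.

Lemma zsum_S (F : Z -> C) (N : nat) :
  zsum F (S N) = Cplus (Cplus (zsum F N) (F (Z.of_nat (S N)))) (F (- Z.of_nat (S N))%Z).
Proof. reflexivity. Qed.

Lemma zsum_ext (F G : Z -> C) (N : nat) : (forall n, F n = G n) -> zsum F N = zsum G N.
Proof. intros H. induction N as [|N IH]; simpl; [apply H|]. now rewrite IH, !H. Qed.

Lemma zsum_scal (c : C) (F : Z -> C) (N : nat) :
  zsum (fun n => Cmult c (F n)) N = Cmult c (zsum F N).
Proof. induction N as [|N IH]; simpl; [reflexivity|]. rewrite IH. ring. Qed.

Definition trig (B : Z -> C) (x : R) (n : Z) : C := Cmult (B n) (cis (IZR n * x)).

Lemma sin_ge_half (x : R) : 0 <= x <= 1 -> x / 2 <= sin x.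
Proof.
  intros Hx. destruct (MVT_gen sin 0 x cos) as (c & Hc & Es).
  - intros t _. auto_derive; trivial. ring.
  - intros t _. apply continuity_sin.
  - rewrite Rmin_left, Rmax_right in Hc by lra. rewrite sin_0 in Es.
    assert (1 / 2 <= cos c) by (apply cos_ge_half; rewrite Rabs_pos_eq; lra). nra.
Qed.

Lemma no_square_twice (n m : nat) : (m * m = 2 * (n * n))%nat -> n = 0%nat.
Proof.
  revert m. induction n as [n IH] using lt_wf_ind. intros m H.
  destruct n as [|n]; trivial. exfalso.
  assert (Hm : Nat.Even m).
  { destruct (Nat.Even_or_Odd m) as [|[k Hk]]; trivial. exfalso. subst m. lia. }
  destruct Hm as [k Hk]. subst m.
  assert (H' : (S n * S n = 2 * (k * k))%nat) by nia.
  assert (k < S n)%nat by nia.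
  assert (k = 0%nat) by (apply (IH k H0 (S n)); exact H'). subst k. lia.
Qed.

(* [sqrt 2] is badly approximable, so no [sin (n * x0)] with [x0 = PI * sqrt 2] is small. *)
Lemma sin_sqrt2_ge (n : nat) : (1 <= n)%nat ->
  1 / (8 * INR n) <= Rabs (sin (INR n * (PI * sqrt 2))).
Proof.
  intros Hn. pose proof PI_RGT_0 as HPI. pose proof PI2_3_2 as HPI2.
  assert (Hn1 : 1 <= INR n) by (now apply (le_INR 1)).
  assert (S2 : sqrt 2 * sqrt 2 = 2) by (apply sqrt_sqrt; lra).
  assert (S0 : 0 <= sqrt 2) by apply sqrt_pos.
  assert (S1 : 1 <= sqrt 2 <= 3 / 2) by nra.
  set (y := INR n * sqrt 2).
  (* [m] is an integer nearest to n * sqrt 2. *)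
  destruct (archimed (y - 1 / 2)) as [A1 A2]. set (m := up (y - 1 / 2)) in *.
  assert (Hy : 1 <= y) by (unfold y; nra).
  assert (Hm0 : (0 <= m)%Z) by (apply le_IZR; lra).
  assert (Hm : exists m', IZR m = INR m').
  { exists (Z.to_nat m). rewrite INR_IZR_INZ, Z2Nat.id; trivial. }
  destruct Hm as [m' Em].
  set (d := y - INR m').
  assert (Hd : Rabs d <= 1 / 2) by (apply Rabs_le; unfold d; lra).
  (* Up to sign, [d] times a factor of at most 4 n is the nonzero integer m^2 - 2 n^2. *)
  assert (Hlow : 1 / (4 * INR n) <= Rabs d).
  { assert (Hint : 1 <= Rabs (INR m' * INR m' - 2 * (INR n * INR n))).
    { assert (Hne : (Z.of_nat m' * Z.of_nat m' - 2 * (Z.of_nat n * Z.of_nat n))%Z <> 0%Z).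
      { intros Hz. assert (n = 0%nat) by (apply (no_square_twice n m'); lia). lia. }
      replace (INR m' * INR m' - 2 * (INR n * INR n))
        with (IZR (Z.of_nat m' * Z.of_nat m' - 2 * (Z.of_nat n * Z.of_nat n))).
      - rewrite <- abs_IZR. apply IZR_le. lia.
      - rewrite minus_IZR, !mult_IZR, <- !INR_IZR_INZ. ring. }
    assert (Hprod : Rabs d * (y + INR m') = Rabs (INR m' * INR m' - 2 * (INR n * INR n))).
    { rewrite <- (Rabs_pos_eq (y + INR m')) by (pose proof (pos_INR m'); lra).
      rewrite <- Rabs_mult, <- Rabs_Ropp. f_equal. unfold d.
      replace (- ((y - INR m') * (y + INR m'))) with (INR m' * INR m' - y * y) by ring.
      unfold y. replace (INR n * sqrt 2 * (INR n * sqrt 2)) with (INR n * INR n * (sqrt 2 * sqrt 2)) by ring.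
      rewrite S2. ring. }
    assert (Hsum : y + INR m' <= 4 * INR n) by (unfold y in *; nra).
    pose proof (Rabs_pos d).
    apply (Rmult_le_reg_r (4 * INR n)); [lra|].
    replace (1 / (4 * INR n) * (4 * INR n)) with 1 by (field; lra). nra. }
  assert (Es : Rabs (sin (INR n * (PI * sqrt 2))) = sin (PI * Rabs d)).
  { replace (INR n * (PI * sqrt 2)) with (PI * d + INR m' * PI) by (unfold d, y; ring).
    assert (Hp : forall q z, Rabs (sin (z + INR q * PI)) = Rabs (sin z)).
    { induction q as [|q IHq]; intros z; [simpl; f_equal; f_equal; ring|].
      rewrite S_INR. replace (z + (INR q + 1) * PI) with ((z + INR q * PI) + PI) by ring.
      now rewrite neg_sin, Rabs_Ropp. }
    rewrite Hp. destruct (Rle_dec 0 d) as [Cd|Cd].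
    - rewrite (Rabs_pos_eq d) by trivial. rewrite Rabs_pos_eq in Hd by trivial.
      apply Rabs_pos_eq. apply sin_ge_0; nra.
    - rewrite (Rabs_left d) in * by lra.
      replace (PI * d) with (- (PI * - d)) by ring. rewrite sin_neg, Rabs_Ropp.
      apply Rabs_pos_eq. apply sin_ge_0; nra. }
  rewrite Es.
  assert (Hs : 0 < 1 / (4 * INR n) <= 1).
  { split; [apply Rdiv_lt_0_compat; lra|]. apply (Rmult_le_reg_r (4 * INR n)); [lra|].
    replace (1 / (4 * INR n) * (4 * INR n)) with 1 by (field; lra). lra. }
  apply Rle_trans with (sin (1 / (4 * INR n))).
  - replace (1 / (8 * INR n)) with (1 / (4 * INR n) / 2) by (field; lra).
    apply sin_ge_half. lra.
  - apply sin_incr_1; nra.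
Qed.

Lemma bounded_initial (f : nat -> R) (N : nat) : exists K, 0 <= K /\ forall n, (n < N)%nat -> f n <= K.
Proof.
  induction N as [|N (K & HK & H)]; [exists 0; split; [lra|lia]|].
  exists (Rmax K (f N)). split; [apply Rle_trans with K; [lra|apply Rmax_l]|].
  intros n Hn. destruct (Nat.eq_dec n N) as [->|Hne]; [apply Rmax_r|].
  apply Rle_trans with K; [apply H; lia|apply Rmax_l].
Qed.

Lemma cis_minus_cis_opp (t : R) : Cminus (cis t) (cis (- t)) = (0, 2 * sin t).
Proof. unfold cis, Cminus, Cplus, Copp; simpl. rewrite cos_neg, sin_neg. f_equal; ring. Qed.

Lemma Cmod_imag (y : R) : Cmod (0, y) = Rabs y.
Proof.
  unfold Cmod. change (sqrt (0 ^ 2 + y ^ 2) = Rabs y). rewrite <- sqrt_Rsqr_abs. f_equal.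
  unfold Rsqr. ring.
Qed.

(** Convergence of symmetric sums bounds only the pairs of terms of index n and -n. Two abscissas, 0
    and PI * sqrt 2, separate the members of a pair, at the price of 1 / |sin (n x0)|, which is at
    most 8 n. *)
Lemma trig_terms_bounded (B : Z -> C) (l : R -> C) :
  (forall x, tlim (fun N => zsum (trig B x) N) (l x)) ->
  exists K, 0 <= K /\ forall n : Z, Cmod (B n) <= K * (1 + INR (Z.abs_nat n)).
Proof.
  intros H.
  assert (Hx : forall x, exists N0, forall N, (N0 <= N)%nat ->
     Cmod (Cplus (trig B x (Z.of_nat (S N))) (trig B x (- Z.of_nat (S N))%Z)) <= 1).
  { intros x. destruct (H x (1 / 2) ltac:(lra)) as [N0 HN]. exists N0. intros N HN0.
    pose proof (HN N HN0) as H1. pose proof (HN (S N) ltac:(lia)) as H2.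
    replace (Cplus (trig B x (Z.of_nat (S N))) (trig B x (- Z.of_nat (S N))%Z))
      with (Cplus (Cminus (zsum (trig B x) (S N)) (l x)) (Copp (Cminus (zsum (trig B x) N) (l x)))).
    - eapply Rle_trans; [apply Cmod_triangle|]. rewrite Cmod_opp. lra.
    - rewrite zsum_S. ring. }
  set (x0 := PI * sqrt 2).
  destruct (Hx 0) as [N1 HN1]. destruct (Hx x0) as [N2 HN2].
  assert (Hbig : forall N, (Nat.max N1 N2 <= N)%nat ->
    Cmod (B (Z.of_nat (S N))) <= 9 * (1 + INR (S N)) /\
    Cmod (B (- Z.of_nat (S N))%Z) <= 9 * (1 + INR (S N))).
  { intros N HN. pose proof (HN1 N ltac:(lia)) as H1. pose proof (HN2 N ltac:(lia)) as H2.
    unfold trig in H1, H2. rewrite opp_IZR, <- INR_IZR_INZ in H1, H2.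
    set (p := B (Z.of_nat (S N))) in *. set (q := B (- Z.of_nat (S N))%Z) in *.
    rewrite !Rmult_0_r, cis_0, !Cmult_1_r in H1.
    (* Subtracting e^(- i n x0) times the pair at 0 from the pair at [x0] eliminates [q] and leaves
       p * 2 i sin (n x0). *)
    assert (Hp : Cmod (Cmult p (Cminus (cis (INR (S N) * x0)) (cis (- (INR (S N) * x0))))) <= 2).
    { replace (Cmult p (Cminus (cis (INR (S N) * x0)) (cis (- (INR (S N) * x0)))))
        with (Cplus (Cplus (Cmult p (cis (INR (S N) * x0))) (Cmult q (cis (- INR (S N) * x0))))
          (Copp (Cmult (cis (- INR (S N) * x0)) (Cplus p q)))).
      - eapply Rle_trans; [apply Cmod_triangle|].
        rewrite Cmod_opp, Cmod_mult, Cmod_cis. lra.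
      - replace (- (INR (S N) * x0)) with (- INR (S N) * x0) by ring. ring. }
    rewrite cis_minus_cis_opp, Cmod_mult in Hp.
    assert (Hc : Cmod (0, 2 * sin (INR (S N) * x0)) = 2 * Rabs (sin (INR (S N) * x0))).
    { rewrite Cmod_imag, Rabs_mult, (Rabs_pos_eq 2) by lra. reflexivity. }
    rewrite Hc in Hp.
    pose proof (sin_sqrt2_ge (S N) ltac:(lia)) as Hs. fold x0 in Hs.
    assert (HSN : 1 <= INR (S N)) by (apply (le_INR 1); lia).
    pose proof (Cmod_ge_0 p) as Hp0.
    assert (Hpb : Cmod p <= 8 * INR (S N)).
    { apply (Rmult_le_reg_r (1 / (8 * INR (S N)))); [apply Rdiv_lt_0_compat; lra|].
      replace (8 * INR (S N) * (1 / (8 * INR (S N)))) with 1 by (field; lra). nra. }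
    split; [lra|].
    replace q with (Cplus (Cplus p q) (Copp p)) by ring.
    eapply Rle_trans; [apply Cmod_triangle|]. rewrite Cmod_opp. lra. }
  destruct (bounded_initial (fun n => Cmod (B (Z.of_nat n)) + Cmod (B (- Z.of_nat n)%Z)) (S (Nat.max N1 N2)))
    as (K & HK & HKb).
  exists (K + 9). split; [lra|]. intros n.
  set (m := Z.abs_nat n).
  assert (Hpm : B n = B (Z.of_nat m) \/ B n = B (- Z.of_nat m)%Z).
  { destruct (Z_le_dec 0 n); [left|right]; f_equal; unfold m; lia. }
  assert (Hb : Cmod (B (Z.of_nat m)) <= (K + 9) * (1 + INR m) /\ Cmod (B (- Z.of_nat m)%Z) <= (K + 9) * (1 + INR m)).
  { pose proof (pos_INR m). destruct (lt_dec m (S (Nat.max N1 N2))) as [Hlt|Hge].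
    - specialize (HKb m Hlt). simpl in HKb.
      pose proof (Cmod_ge_0 (B (Z.of_nat m))). pose proof (Cmod_ge_0 (B (- Z.of_nat m)%Z)).
      split; nra.
    - destruct m as [|m']; [lia|]. destruct (Hbig m' ltac:(lia)). split; nra. }
  destruct Hpm as [-> | ->]; apply Hb.
Qed.

(** * Fourier coefficients as limits of averages over equidistant nodes *)

Definition geom (B : Z -> C) : Prop :=
  exists K q, 0 <= K /\ 0 <= q < 1 /\ forall n, Cmod (B n) <= K * q ^ Z.abs_nat n.

Fixpoint csum (f : nat -> C) (M : nat) : C :=
  match M with O => RtoC 0 | S m => Cplus (csum f m) (f m) end.

Definition node (L j : nat) : R := 2 * PI * INR j / INR (2 * L + 1).

(** A discrete Fourier coefficient: for |m| <= L it is exact on trigonometric polynomials of degree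
    at most [L], and it uses only point values of [F]. *)
Definition avg (L : nat) (m : Z) (F : R -> C) : C :=
  Cmult (RtoC (/ INR (2 * L + 1)))
    (csum (fun j => Cmult (F (node L j)) (cis (- IZR m * node L j))) (2 * L + 1)).

Lemma csum_plus (f g : nat -> C) (M : nat) :
  csum (fun j => Cplus (f j) (g j)) M = Cplus (csum f M) (csum g M).
Proof. induction M as [|M IH]; simpl; [ring|]. rewrite IH. ring. Qed.

Lemma csum_scal (c : C) (f : nat -> C) (M : nat) :
  csum (fun j => Cmult c (f j)) M = Cmult c (csum f M).
Proof. induction M as [|M IH]; simpl; [ring|]. rewrite IH. ring. Qed.

Lemma csum_ext (f g : nat -> C) (M : nat) : (forall j, f j = g j) -> csum f M = csum g M.
Proof. intros H. induction M as [|M IH]; simpl; [reflexivity|]. now rewrite IH, H. Qed.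

Lemma csum_bound (f : nat -> C) (M : nat) (e : R) :
  (forall j, Cmod (f j) <= e) -> Cmod (csum f M) <= INR M * e.
Proof.
  intros H. induction M as [|M IH]; [simpl; rewrite Cmod_0; lra|].
  simpl csum. rewrite S_INR. eapply Rle_trans; [apply Cmod_triangle|].
  specialize (H M). lra.
Qed.

Lemma avg_plus (L : nat) (m : Z) (F G : R -> C) :
  avg L m (fun x => Cplus (F x) (G x)) = Cplus (avg L m F) (avg L m G).
Proof.
  unfold avg. rewrite (csum_ext _ (fun j => Cplus (Cmult (F (node L j)) (cis (- IZR m * node L j)))
    (Cmult (G (node L j)) (cis (- IZR m * node L j))))) by (intros; ring).
  rewrite csum_plus. ring.
Qed.

Lemma avg_scal (L : nat) (m : Z) (c : C) (F : R -> C) :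
  avg L m (fun x => Cmult c (F x)) = Cmult c (avg L m F).
Proof.
  unfold avg. rewrite (csum_ext _ (fun j => Cmult c (Cmult (F (node L j)) (cis (- IZR m * node L j)))))
    by (intros; ring).
  rewrite csum_scal. ring.
Qed.

Lemma avg_ext (L : nat) (m : Z) (F G : R -> C) : (forall x, F x = G x) -> avg L m F = avg L m G.
Proof. intros H. unfold avg. f_equal. apply csum_ext. intros j. now rewrite H. Qed.

Lemma avg_bound (L : nat) (m : Z) (F : R -> C) (e : R) :
  (forall x, Cmod (F x) <= e) -> Cmod (avg L m F) <= e.
Proof.
  intros H. unfold avg. rewrite Cmod_mult, Cmod_R.
  assert (HL : 0 < INR (2 * L + 1)) by (apply lt_0_INR; lia).
  rewrite Rabs_pos_eq by (left; now apply Rinv_0_lt_compat).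
  apply (Rmult_le_reg_l (INR (2 * L + 1))); trivial.
  rewrite <- Rmult_assoc, Rinv_r, Rmult_1_l by lra.
  apply csum_bound. intros j. rewrite Cmod_mult, Cmod_cis, Rmult_1_r. apply H.
Qed.

Lemma csum_geometric (t : R) (M : nat) :
  Cmult (Cminus (cis t) (RtoC 1)) (csum (fun j => cis (INR j * t)) M)
  = Cminus (cis (INR M * t)) (RtoC 1).
Proof.
  induction M as [|K IH].
  - simpl csum. simpl INR. rewrite Rmult_0_l, cis_0. ring.
  - simpl csum. rewrite Cmult_plus_distr_l, IH, S_INR.
    replace ((INR K + 1) * t) with (t + INR K * t) by ring. rewrite cis_plus. ring.
Qed.

(** A geometric sum of roots of unity of order 2 L + 1; the bound on [n - m] rules out aliasing. *)
Lemma avg_cis (L : nat) (m n : Z) : (Z.abs_nat (n - m) <= 2 * L)%nat ->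
  avg L m (fun x => cis (IZR n * x)) = if Z.eq_dec n m then RtoC 1 else RtoC 0.
Proof.
  intros Hd. pose proof PI_RGT_0 as HPI.
  assert (HL : 0 < INR (2 * L + 1)) by (apply lt_0_INR; lia).
  unfold avg. set (M := (2 * L + 1)%nat) in *.
  set (t := 2 * PI * IZR (n - m) / INR M).
  rewrite (csum_ext _ (fun j => cis (INR j * t))).
  2:{ intros j. rewrite <- cis_plus. f_equal. unfold node, t. fold M. rewrite minus_IZR. field. lra. }
  destruct (Z.eq_dec n m) as [e|ne].
  - assert (t0 : t = 0) by (unfold t; subst; rewrite Z.sub_diag; field; lra).
    rewrite (csum_ext _ (fun j => RtoC 1)) by (intros; now rewrite t0, Rmult_0_r, cis_0).
    assert (Hc : forall K, csum (fun _ => RtoC 1) K = RtoC (INR K)).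
    { induction K as [|K IH]; [reflexivity|]. simpl csum. rewrite IH, S_INR.
      unfold RtoC, Cplus; simpl. f_equal; ring. }
    rewrite Hc, <- RtoC_mult. f_equal. field. lra.
  - assert (Htel : Cmult (Cminus (cis t) (RtoC 1)) (csum (fun j => cis (INR j * t)) M)
       = Cminus (cis (INR M * t)) (RtoC 1))
      by apply csum_geometric.
    replace (INR M * t) with (0 + 2 * PI * IZR (n - m)) in Htel by (unfold t; field; lra).
    rewrite cis_PI_shift, cis_0 in Htel.
    assert (Hne : Cminus (cis t) (RtoC 1) <> RtoC 0).
    { intros Hz. assert (He : cis t = RtoC 1).
      { replace (cis t) with (Cplus (Cminus (cis t) (RtoC 1)) (RtoC 1)) by ring. rewrite Hz. ring. }
      destruct (cis_eq_1 t He) as [q Hq].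
      assert (Hq' : (n - m = q * Z.of_nat M)%Z).
      { apply eq_IZR. rewrite mult_IZR, <- INR_IZR_INZ. unfold t in Hq.
        apply (Rmult_eq_reg_l (2 * PI / INR M)).
        - transitivity (2 * PI * IZR (n - m) / INR M); [field; lra|]. rewrite Hq. field. lra.
        - apply Rgt_not_eq. apply Rdiv_lt_0_compat; lra. }
      assert (q <> 0)%Z by (intros ->; lia). unfold M in *. nia. }
    replace (csum (fun j => cis (INR j * t)) M) with (RtoC 0); [ring|].
    transitivity (Cdiv (Cmult (Cminus (cis t) (RtoC 1)) (csum (fun j => cis (INR j * t)) M)) (Cminus (cis t) (RtoC 1))).
    + rewrite Htel. field. exact Hne.
    + field. exact Hne.
Qed.

Lemma avg_zsum (L : nat) (m : Z) (B : Z -> C) : (Z.abs_nat m <= L)%nat ->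
  forall N, (N <= L)%nat ->
  avg L m (fun x => zsum (trig B x) N) = if le_dec (Z.abs_nat m) N then B m else RtoC 0.
Proof.
  intros Hm. induction N as [|N IH]; intros HN.
  - simpl zsum. rewrite (avg_ext _ _ _ (fun x => Cmult (B 0%Z) (cis (IZR 0 * x)))) by reflexivity.
    rewrite avg_scal, avg_cis by lia.
    destruct (Z.eq_dec 0 m) as [e|e]; destruct (le_dec (Z.abs_nat m) 0) as [l|l]; try lia.
    + subst. ring.
    + ring.
  - rewrite (avg_ext _ _ _ _ (fun x => zsum_S (trig B x) N)).
    rewrite avg_plus, avg_plus, IH by lia. unfold trig.
    rewrite !avg_scal, !avg_cis by lia.
    destruct (Z.eq_dec (Z.of_nat (S N)) m) as [e1|e1];
    destruct (Z.eq_dec (- Z.of_nat (S N)) m) as [e2|e2];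
    destruct (le_dec (Z.abs_nat m) N) as [l|l];
    destruct (le_dec (Z.abs_nat m) (S N)) as [l'|l']; try lia;
    try rewrite e1; try rewrite e2; try ring.
Qed.

(** The difference of powers makes the bound telescope in [P], and it stays below a multiple of q^N
    uniformly in [x] and [P]. *)
Lemma geom_tail (B : Z -> C) (K q x : R) (N P : nat) :
  0 <= K -> 0 <= q < 1 -> (forall n, Cmod (B n) <= K * q ^ Z.abs_nat n) ->
  Cmod (Cminus (zsum (trig B x) (N + P)) (zsum (trig B x) N)) <= 2 * K / (1 - q) * (q ^ N - q ^ (N + P)).
Proof.
  intros HK Hq HB. induction P as [|P IH].
  - rewrite Nat.add_0_r. replace (Cminus _ _) with (RtoC 0) by ring. rewrite Cmod_0. lra.
  - rewrite Nat.add_succ_r, zsum_S.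
    set (s := zsum (trig B x) (N + P)) in *. set (s0 := zsum (trig B x) N) in *.
    assert (Ht : forall n : Z, Cmod (trig B x n) <= K * q ^ Z.abs_nat n).
    { intros n. unfold trig. rewrite Cmod_mult, Cmod_cis, Rmult_1_r. apply HB. }
    pose proof (Ht (Z.of_nat (S (N + P)))) as T1. pose proof (Ht (- Z.of_nat (S (N + P)))%Z) as T2.
    replace (Z.abs_nat (Z.of_nat (S (N + P)))) with (S (N + P)) in T1 by lia.
    replace (Z.abs_nat (- Z.of_nat (S (N + P)))) with (S (N + P)) in T2 by lia.
    set (t1 := trig B x (Z.of_nat (S (N + P)))) in *.
    set (t2 := trig B x (- Z.of_nat (S (N + P)))%Z) in *.
    match goal with |- Cmod ?z <= _ => replace z with (Cplus (Cminus s s0) (Cplus t1 t2)) by ring end.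
    eapply Rle_trans; [apply Cmod_triangle|].
    pose proof (Cmod_triangle t1 t2).
    assert (Eq : 2 * K / (1 - q) * (q ^ N - q ^ S (N + P))
      = 2 * K / (1 - q) * (q ^ N - q ^ (N + P)) + 2 * (K * q ^ (N + P))).
    { simpl. field. lra. }
    rewrite Eq. assert (K * q ^ S (N + P) <= K * q ^ (N + P)); [|lra].
    apply Rmult_le_compat_l; trivial. simpl.
    assert (0 <= q ^ (N + P)) by (apply pow_le; lra). nra.
Qed.

Definition coef (m : Z) (F : R -> C) (v : C) : Prop := tlim (fun L => avg L m F) v.

Lemma tlim_plus (s t : nat -> C) (a b : C) :
  tlim s a -> tlim t b -> tlim (fun n => Cplus (s n) (t n)) (Cplus a b).
Proof.
  intros Hs Ht e He. destruct (Hs (e / 2) ltac:(lra)) as [N1 H1].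
  destruct (Ht (e / 2) ltac:(lra)) as [N2 H2]. exists (Nat.max N1 N2). intros n Hn.
  replace (Cminus (Cplus (s n) (t n)) (Cplus a b)) with (Cplus (Cminus (s n) a) (Cminus (t n) b)) by ring.
  eapply Rle_lt_trans; [apply Cmod_triangle|].
  specialize (H1 n ltac:(lia)). specialize (H2 n ltac:(lia)). lra.
Qed.

Lemma tlim_unique (s : nat -> C) (a b : C) : tlim s a -> tlim s b -> a = b.
Proof.
  intros Ha Hb. destruct (Rle_lt_dec (Cmod (Cminus a b)) 0) as [H|H].
  - assert (Hz : Cminus a b = RtoC 0).
    { apply Cmod_eq_0. apply Rle_antisym; trivial. apply Cmod_ge_0. }
    replace a with (Cplus (Cminus a b) b) by ring. rewrite Hz. ring.
  - exfalso. destruct (Ha (Cmod (Cminus a b) / 2) ltac:(lra)) as [N1 H1].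
    destruct (Hb (Cmod (Cminus a b) / 2) ltac:(lra)) as [N2 H2].
    specialize (H1 (Nat.max N1 N2) ltac:(lia)). specialize (H2 (Nat.max N1 N2) ltac:(lia)).
    set (z := s (Nat.max N1 N2)) in *.
    assert (Cmod (Cminus a b) <= Cmod (Cminus z a) + Cmod (Cminus z b)); [|lra].
    replace (Cminus a b) with (Cplus (Cminus z b) (Copp (Cminus z a))) by ring.
    eapply Rle_trans; [apply Cmod_triangle|]. rewrite Cmod_opp. lra.
Qed.

Lemma tlim_ext_from (s t : nat -> C) (l : C) (N0 : nat) :
  (forall n, (N0 <= n)%nat -> s n = t n) -> tlim s l -> tlim t l.
Proof.
  intros H Hs e He. destruct (Hs e He) as [N HN]. exists (Nat.max N N0). intros n Hn.
  rewrite <- H by lia. apply HN. lia.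
Qed.

Lemma coef_plus (m : Z) (F G : R -> C) (a b : C) :
  coef m F a -> coef m G b -> coef m (fun x => Cplus (F x) (G x)) (Cplus a b).
Proof.
  intros HF HG. unfold coef. apply (tlim_ext_from (fun L => Cplus (avg L m F) (avg L m G)) _ _ 0).
  - intros. now rewrite avg_plus.
  - now apply tlim_plus.
Qed.

Lemma coef_scal (m : Z) (c : C) (F : R -> C) (a : C) :
  coef m F a -> coef m (fun x => Cmult c (F x)) (Cmult c a).
Proof.
  intros HF. unfold coef. apply (tlim_ext_from (fun L => Cmult c (avg L m F)) _ _ 0).
  - intros. now rewrite avg_scal.
  - now apply tlim_scal.
Qed.

Lemma coef_ext (m : Z) (F G : R -> C) (a : C) : (forall x, F x = G x) -> coef m F a -> coef m G a.
Proof.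
  intros H. unfold coef. apply (tlim_ext_from _ _ _ 0). intros L _. now apply avg_ext.
Qed.

Lemma coef_cis (m n : Z) : coef m (fun x => cis (IZR n * x)) (if Z.eq_dec n m then RtoC 1 else RtoC 0).
Proof.
  intros e He. exists (Z.abs_nat (n - m)). intros L HL. rewrite avg_cis by lia.
  replace (Cminus _ _) with (RtoC 0) by ring. now rewrite Cmod_0.
Qed.

(** Multiplication by a character translates the spectrum, which aligns the modes of two fields
    whose quasi-periodicities agree. *)
Lemma coef_shift (m n : Z) (F : R -> C) (a : C) :
  coef m F a -> coef (m + n) (fun x => Cmult (cis (IZR n * x)) (F x)) a.
Proof.
  apply (tlim_ext_from _ _ _ 0). intros L _. unfold avg. f_equal. apply csum_ext. intros j.
  rewrite plus_IZR. replace (- IZR m * node L j) with (IZR n * node L j + - (IZR m + IZR n) * node L j) by ring.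
  rewrite cis_plus. ring.
Qed.

(** The partial sum of degree [L] is averaged exactly, and the tail is small uniformly in [x], hence
    so is its average. *)
Lemma coef_series (B : Z -> C) (F : R -> C) (m : Z) :
  geom B -> (forall x, tlim (fun N => zsum (trig B x) N) (F x)) -> coef m F (B m).
Proof.
  intros (K & q & HK & Hq & HB) HF e He.
  set (c := 2 * K / (1 - q)).
  assert (Hc : 0 <= c) by (unfold c; apply Rle_mult_inv_pos; lra).
  destruct (pow_lt_1_zero q ltac:(rewrite Rabs_pos_eq; lra) (e / (2 * (c + 1)))) as [N HN].
  { apply Rdiv_lt_0_compat; lra. }
  exists (Nat.max N (Z.abs_nat m)). intros L HL.
  specialize (HN L ltac:(lia)). rewrite Rabs_pos_eq in HN by (apply pow_le; lra).
  assert (Hcq : c * q ^ L <= e / 2).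
  { assert (0 <= q ^ L) by (apply pow_le; lra).
    assert (q ^ L * (c + 1) <= e / 2); [|nra].
    replace (e / 2) with (e / (2 * (c + 1)) * (c + 1)) by (field; lra).
    apply Rmult_le_compat_r; lra. }
  assert (Hav : avg L m (fun x => zsum (trig B x) L) = B m).
  { rewrite avg_zsum by lia. destruct (le_dec (Z.abs_nat m) L); [reflexivity|lia]. }
  assert (Heq : Cminus (avg L m F) (B m) =
    avg L m (fun x => Cplus (F x) (Cmult (RtoC (-1)) (zsum (trig B x) L)))).
  { rewrite avg_plus, avg_scal, Hav. unfold Cminus. replace (RtoC (-1)) with (Copp (RtoC 1)).
    - ring.
    - unfold RtoC, Copp; simpl. f_equal; ring. }
  rewrite Heq. apply Rle_lt_trans with (3 / 4 * e); [|lra].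
  apply avg_bound. intros x.
  (* [N'] depends on [x], but the bound e / 2 on the block between [L] and [L + N'] does not. *)
  destruct (HF x (e / 4) ltac:(lra)) as [N' HN'].
  specialize (HN' (L + N')%nat ltac:(lia)).
  pose proof (geom_tail B K q x L N' HK Hq HB) as HT. fold c in HT.
  assert (HT' : Cmod (Cminus (zsum (trig B x) (L + N')) (zsum (trig B x) L)) <= e / 2).
  { eapply Rle_trans; [exact HT|].
    assert (0 <= q ^ (L + N')) by (apply pow_le; lra). nra. }
  set (z := zsum (trig B x) (L + N')) in *. set (z0 := zsum (trig B x) L) in *.
  replace (Cplus (F x) (Cmult (RtoC (-1)) z0)) with (Cplus (Copp (Cminus z (F x))) (Cminus z z0)).
  - eapply Rle_trans; [apply Cmod_triangle|]. rewrite Cmod_opp. lra.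
  - replace (RtoC (-1)) with (Copp (RtoC 1)) by (unfold RtoC, Copp; simpl; f_equal; ring). ring.
Qed.

(** * Rayleigh expansions *)

(** The vertical factor e^(i beta_n y) of a Rayleigh mode, written as modulus times phase. *)
Definition Gn (k th : R) (n : Z) (y : R) : C :=
  Cmult (RtoC (exp (- (snd (beta_n k th n) * y)))) (cis (fst (beta_n k th n) * y)).

(** Without its quasi-periodic factor the expansion at a fixed height is a Fourier series in [x]. *)
Lemma rayleigh_split (k th : R) (c : Z -> C) (x y : R) (n : Z) :
  Cmult (cis (- (k * sin th * x))) (rayleigh_term k th c (x, y) n)
  = trig (fun n => Cmult (c n) (Gn k th n y)) x n.
Proof.
  unfold rayleigh_term, trig, Gn.
  set (be := beta_n k th n). simpl fst; simpl snd.
  replace (Cmult Defs.Ci (Cplus (RtoC (alpha_n k th n * x)) (Cmult be (RtoC y))))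
    with ((- (snd be * y), k * sin th * x + IZR n * x + fst be * y) : C).
  2:{ unfold Cmult, Cplus, RtoC, Defs.Ci, alpha_n; simpl. f_equal; ring. }
  rewrite cexp_split, !cis_plus.
  replace (Cmult (cis (- (k * sin th * x)))
    (Cmult (c n) (Cmult (RtoC (exp (- (snd be * y))))
      (Cmult (Cmult (cis (k * sin th * x)) (cis (IZR n * x))) (cis (fst be * y))))))
    with (Cmult (Cmult (cis (- (k * sin th * x))) (cis (k * sin th * x)))
     (Cmult (c n) (Cmult (RtoC (exp (- (snd be * y)))) (Cmult (cis (IZR n * x)) (cis (fst be * y)))))) by ring.
  rewrite <- cis_plus, Rplus_opp_l, cis_0. ring.
Qed.

Lemma uinc_split (k th x y : R) :
  uinc k th (x, y) = Cmult (cis (k * sin th * x)) (cis (- (k * cos th * y))).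
Proof.
  unfold uinc. rewrite cexp_split, exp_0, <- cis_plus. simpl fst; simpl snd.
  replace (k * (sin th * x - cos th * y)) with (k * sin th * x + - (k * cos th * y)) by ring.
  ring.
Qed.

Lemma Gn_plus (k th : R) (n : Z) (y z : R) : Gn k th n (y + z) = Cmult (Gn k th n y) (Gn k th n z).
Proof.
  unfold Gn. rewrite !Rmult_plus_distr_l, cis_plus, Ropp_plus_distr, exp_plus, RtoC_mult. ring.
Qed.

Lemma Cmod_Gn (k th : R) (n : Z) (y : R) : Cmod (Gn k th n y) = exp (- (snd (beta_n k th n) * y)).
Proof.
  unfold Gn. rewrite Cmod_mult, Cmod_cis, Cmod_R, Rabs_pos_eq by (left; apply exp_pos). ring.
Qed.

Lemma Gn_neq_0 (k th : R) (n : Z) (y : R) : Gn k th n y <> RtoC 0.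
Proof. apply Cmod_gt_0. rewrite Cmod_Gn. apply exp_pos. Qed.

Lemma beta_im_ge_0 (k th : R) (n : Z) : 0 <= snd (beta_n k th n).
Proof.
  unfold beta_n. destruct (Rle_dec _ _); simpl; [lra|apply sqrt_pos].
Qed.

(** For |n| >= 3 k one has |alpha_n| >= |n| - k > k, and (|n| - k)^2 - k^2 >= n^2 / 3. *)
Lemma beta_im_growth (k th : R) (n : Z) :
  0 < k -> 3 * k <= INR (Z.abs_nat n) -> INR (Z.abs_nat n) / 2 <= snd (beta_n k th n).
Proof.
  intros Hk Hn. unfold beta_n.
  assert (HN : INR (Z.abs_nat n) = Rabs (IZR n)).
  { rewrite INR_IZR_INZ, <- abs_IZR. f_equal. lia. }
  rewrite HN in *. set (N := Rabs (IZR n)) in *.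
  assert (Hal : N - k <= Rabs (alpha_n k th n)).
  { unfold alpha_n. assert (Hs : Rabs (k * sin th) <= k).
    { rewrite Rabs_mult, (Rabs_pos_eq k) by lra. pose proof (Rabs_sin_le th). nra. }
    pose proof (Rabs_triang (IZR n + k * sin th) (- (k * sin th))) as Ht.
    replace (IZR n + k * sin th + - (k * sin th)) with (IZR n) in Ht by ring.
    rewrite Rabs_Ropp in Ht. fold N in Ht. lra. }
  destruct (Rle_dec (Rabs (alpha_n k th n)) k) as [C|C]; [lra|]. cbn [snd].
  rewrite <- (sqrt_pow2 (N / 2)) by lra. apply sqrt_le_1_alt.
  assert (Hsq : alpha_n k th n ^ 2 = Rabs (alpha_n k th n) ^ 2) by (now rewrite pow2_abs).
  rewrite Hsq. nra.
Qed.

(** A mode with the horizontal wave number of direction [th'] is an upgoing plane wave with vertical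
    wave number k cos th'. *)
Lemma Gn_propagating (k th : R) (n : Z) (th' y : R) :
  0 < k -> -(PI / 2) < th' < PI / 2 -> alpha_n k th n = k * sin th' ->
  Gn k th n y = cis (k * cos th' * y).
Proof.
  intros Hk Hth Ha. unfold Gn, beta_n. rewrite Ha.
  assert (Hc : 0 < cos th') by (apply cos_gt_0; lra).
  destruct (Rle_dec (Rabs (k * sin th')) k) as [C|C].
  - simpl fst; simpl snd. rewrite Rmult_0_l, Ropp_0, exp_0.
    replace (k * (k * 1) - k * sin th' * (k * sin th' * 1)) with ((k * cos th') ^ 2).
    + rewrite sqrt_pow2 by nra. ring.
    + pose proof (sin2_cos2 th') as H. unfold Rsqr in H. simpl.
      replace (k * (k * 1)) with (k * k * (sin th' * sin th' + cos th' * cos th')) by (rewrite H; ring).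
      ring.
  - exfalso. apply C. rewrite Rabs_mult, (Rabs_pos_eq k) by lra. pose proof (Rabs_sin_le th'). nra.
Qed.

(** Half of the decay exp (- N h / 2) absorbs the linear factor and the other half is q^N; indices
    with N < M go into the constant. *)
Lemma geom_of_linear_decay (B : Z -> C) (K h M : R) (d : Z -> R) :
  0 <= K -> 0 < h -> (forall n, 0 <= d n) ->
  (forall n, M <= INR (Z.abs_nat n) -> INR (Z.abs_nat n) / 2 <= d n) ->
  (forall n, Cmod (B n) <= K * (1 + INR (Z.abs_nat n)) * exp (- (d n * h))) -> geom B.
Proof.
  intros HK Hh Hd HdM HB.
  set (q := exp (- (h / 4))).
  assert (Hq0 : 0 < q) by apply exp_pos.
  assert (Hq1 : q < 1) by (unfold q; rewrite <- exp_0; apply exp_increasing; lra).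
  assert (Hqn : forall m, q ^ m = exp (- (INR m * h / 4))).
  { intros m. unfold q. induction m as [|m IH].
    - simpl. rewrite Rmult_0_l. unfold Rdiv. now rewrite Rmult_0_l, Ropp_0, exp_0.
    - simpl pow. rewrite IH, <- exp_plus, S_INR. f_equal. field. }
  (* Chosen so that kap (1 + N) <= 1 + N h / 4 <= exp (N h / 4). *)
  set (kap := Rmin 1 (h / 4)).
  assert (Hkap : 0 < kap) by (apply Rmin_glb_lt; lra).
  assert (Hk1 : kap <= 1) by apply Rmin_l. assert (Hk2 : kap <= h / 4) by apply Rmin_r.
  set (M' := Rmax M 0).
  assert (HM' : M <= M' /\ 0 <= M') by (split; [apply Rmax_l|apply Rmax_r]).
  exists (K * (1 / kap + (1 + M') * exp (M' * h / 4))), q.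
  assert (Hek : 0 < 1 / kap) by (apply Rdiv_lt_0_compat; lra).
  pose proof (exp_pos (M' * h / 4)) as HeM.
  assert (HC : 0 <= (1 + M') * exp (M' * h / 4)) by nra.
  split; [apply Rmult_le_pos; lra|]. split; [lra|]. intros n.
  eapply Rle_trans; [apply HB|]. set (N := INR (Z.abs_nat n)) in *.
  assert (HN0 : 0 <= N) by apply pos_INR.
  rewrite !Rmult_assoc. apply Rmult_le_compat_l; trivial.
  rewrite Hqn. fold N.
  destruct (Rle_lt_dec M N) as [C|C].
  - specialize (HdM n C). fold N in HdM.
    apply Rle_trans with (1 / kap * exp (- (N * h / 4))).
    + apply Rle_trans with ((1 + N) * exp (- (N * h / 2))).
      * apply Rmult_le_compat_l; [lra|].
        destruct (Req_dec (d n * h) (N * h / 2)) as [->|Hne]; [lra|].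
        left. apply exp_increasing. assert (N / 2 * h <= d n * h) by (apply Rmult_le_compat_r; lra). lra.
      * replace (- (N * h / 2)) with (- (N * h / 4) + - (N * h / 4)) by field.
        rewrite exp_plus, <- Rmult_assoc. apply Rmult_le_compat_r; [left; apply exp_pos|].
        pose proof (exp_ineq1_le (N * h / 4)) as He.
        apply (Rmult_le_reg_r (kap * exp (N * h / 4))); [apply Rmult_lt_0_compat; [lra|apply exp_pos]|].
        replace ((1 + N) * exp (- (N * h / 4)) * (kap * exp (N * h / 4)))
          with ((1 + N) * kap * (exp (- (N * h / 4)) * exp (N * h / 4))) by ring.
        rewrite <- exp_plus, Rplus_opp_l, exp_0.
        replace (1 / kap * (kap * exp (N * h / 4))) with (exp (N * h / 4)) by (field; lra). nra.
    + apply Rmult_le_compat_r; [left; apply exp_pos|lra].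
  - apply Rle_trans with ((1 + M') * exp (M' * h / 4) * exp (- (N * h / 4))).
    + apply Rle_trans with (1 + M').
      * assert (exp (- (d n * h)) <= 1).
        { rewrite <- exp_0. destruct (Req_dec (d n * h) 0) as [->|Hne]; [rewrite Ropp_0; lra|].
          left. apply exp_increasing. specialize (Hd n). nra. }
        pose proof (exp_pos (- (d n * h))). nra.
      * rewrite Rmult_assoc, <- exp_plus.
        assert (1 <= exp (M' * h / 4 + - (N * h / 4))).
        { pose proof (exp_ineq1_le (M' * h / 4 + - (N * h / 4))). nra. }
        nra.
    + apply Rmult_le_compat_r; [left; apply exp_pos|lra].
Qed.

(** The linear bound is taken at a height b' < b still above the grating; climbing by y - b' > 0
    multiplies the terms by evanescent factors and makes the series geometric. *)
Lemma field_expansion (g : pgrating) (k th b : R) (u : pt -> C) :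
  admissible g -> 0 < k -> (forall t, Rabs (gf g t) < b) -> total_field g k th u ->
  exists c : Z -> C, forall y, b <= y ->
    geom (fun n => Cmult (c n) (Gn k th n y)) /\
    forall x, tlim (fun N => zsum (trig (fun n => Cmult (c n) (Gn k th n y)) x) N)
      (Cmult (cis (- (k * sin th * x))) (Cminus (u (x, y)) (uinc k th (x, y)))).
Proof.
  intros Hadm Hk Hb (_ & _ & _ & c & Hc). exists c.
  destruct (gf_max g Hadm b Hb) as (b' & Hb' & Hmax).
  assert (Hlim : forall x y, b' <= y ->
    tlim (fun N => zsum (trig (fun n => Cmult (c n) (Gn k th n y)) x) N)
      (Cmult (cis (- (k * sin th * x))) (Cminus (u (x, y)) (uinc k th (x, y))))).
  { intros x y Hy.
    assert (H := filterlim_tlim _ _ (Hc (x, y) (fun t => Rlt_le_trans _ _ _ (Hmax t) Hy))).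
    apply (tlim_scal _ _ (cis (- (k * sin th * x)))) in H.
    revert H. apply (tlim_ext_from _ _ _ 0). intros N _.
    rewrite <- zsum_scal. apply zsum_ext. intros n. apply rayleigh_split. }
  intros y Hy. split; [|intros x; apply Hlim; lra].
  destruct (trig_terms_bounded _ _ (fun x => Hlim x b' (Rle_refl b'))) as (K & HK & HB).
  apply (geom_of_linear_decay _ K (y - b') (3 * k) (fun n => snd (beta_n k th n))); trivial.
  - lra.
  - intros n. apply beta_im_ge_0.
  - intros n Hn. now apply beta_im_growth.
  - intros n. replace y with (b' + (y - b')) at 1 by ring.
    rewrite Gn_plus, Cmult_assoc, Cmod_mult, Cmod_Gn.
    apply Rmult_le_compat_r; [left; apply exp_pos|apply HB].
Qed.

Lemma cis_neq_0 (t : R) : cis t <> RtoC 0.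
Proof. apply Cmod_gt_0. rewrite Cmod_cis. lra. Qed.

Lemma Cmult_reg_l (a x y : C) : a <> RtoC 0 -> Cmult a x = Cmult a y -> x = y.
Proof.
  intros Ha H. replace x with (Cdiv (Cmult a x) a) by (field; exact Ha).
  rewrite H. field. exact Ha.
Qed.

(** Both fields have the same nonzero multiplier, so equality passes to the next and to the
    preceding period. *)
Lemma periodic_line (g gt : pgrating) (k th b : R) (u ut : pt -> C) :
  (forall t, Rabs (gf g t) < b) -> (forall t, Rabs (gf gt t) < b) ->
  total_field g k th u -> total_field gt k th ut ->
  (forall x, 0 <= x <= 2 * PI -> u (x, b) = ut (x, b)) -> forall x, u (x, b) = ut (x, b).
Proof.
  intros Hb Hbt (_ & _ & Hq & _) (_ & _ & Hqt & _) H x.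
  pose proof PI_RGT_0 as HPI.
  assert (HO : forall x, Omega g (x, b)).
  { intros z. unfold Omega; simpl. specialize (Hb z). apply Rabs_def2 in Hb. lra. }
  assert (HOt : forall x, Omega gt (x, b)).
  { intros z. unfold Omega; simpl. specialize (Hbt z). apply Rabs_def2 in Hbt. lra. }
  assert (Hstep : forall z, u (z, b) = ut (z, b) <-> u (z + 2 * PI, b) = ut (z + 2 * PI, b)).
  { intros z. pose proof (Hq (z, b) (HO z)) as A. pose proof (Hqt (z, b) (HOt z)) as B.
    simpl fst in A, B. simpl snd in A, B. rewrite A, B. split; intros Hz.
    - now rewrite Hz.
    - apply Cmult_reg_l in Hz; trivial. rewrite cexp_split, exp_0, Cmult_1_l. apply cis_neq_0. }
  assert (Hnat : forall (n : nat) z, u (z, b) = ut (z, b) <->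
     u (z + 2 * PI * INR n, b) = ut (z + 2 * PI * INR n, b)).
  { induction n as [|n IH]; intros z.
    - simpl. rewrite Rmult_0_r, Rplus_0_r. tauto.
    - rewrite S_INR. replace (z + 2 * PI * (INR n + 1)) with (z + 2 * PI * INR n + 2 * PI) by ring.
      rewrite <- Hstep. apply IH. }
  destruct (Z_shift x 0) as [n Hn].
  assert (Hx : u (x + 2 * PI * IZR n, b) = ut (x + 2 * PI * IZR n, b)) by (apply H; lra).
  destruct (Z_le_dec 0 n) as [C|C].
  - apply (Hnat (Z.to_nat n)). rewrite INR_IZR_INZ, Z2Nat.id; trivial.
  - apply (Hnat (Z.to_nat (- n)) (x + 2 * PI * IZR n)) in Hx.
    rewrite INR_IZR_INZ, Z2Nat.id, opp_IZR in Hx by lia.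
    replace (x + 2 * PI * IZR n + 2 * PI * - IZR n) with x in Hx by ring. exact Hx.
Qed.

Lemma fields_equal_above (g gt : pgrating) (k th b : R) (u ut : pt -> C) :
  admissible g -> admissible gt -> 0 < k ->
  (forall t, Rabs (gf g t) < b) -> (forall t, Rabs (gf gt t) < b) ->
  total_field g k th u -> total_field gt k th ut ->
  (forall x, 0 <= x <= 2 * PI -> u (x, b) = ut (x, b)) ->
  forall x y, b <= y -> u (x, y) = ut (x, y).
Proof.
  intros Ha Hat Hk Hb Hbt Hu Hut Heq.
  pose proof (periodic_line g gt k th b u ut Hb Hbt Hu Hut Heq) as Hline.
  destruct (field_expansion g k th b u Ha Hk Hb Hu) as (c & Hc).
  destruct (field_expansion gt k th b ut Hat Hk Hbt Hut) as (c' & Hc').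
  assert (Hcc : forall n, c n = c' n).
  { intros n. apply (Cmult_reg_l (Gn k th n b)); [apply Gn_neq_0|].
    rewrite (Cmult_comm _ (c n)), (Cmult_comm _ (c' n)).
    destruct (Hc b (Rle_refl b)) as [G1 L1]. destruct (Hc' b (Rle_refl b)) as [G2 L2].
    apply (tlim_unique (fun L => avg L n (fun x =>
      Cmult (cis (- (k * sin th * x))) (Cminus (u (x, b)) (uinc k th (x, b)))))).
    - exact (coef_series _ _ n G1 L1).
    - refine (coef_ext n _ _ _ _ (coef_series _ _ n G2 L2)). intros x. simpl. now rewrite Hline. }
  intros x y Hy. destruct (Hc y Hy) as [_ L1]. destruct (Hc' y Hy) as [_ L2].
  assert (L : Cmult (cis (- (k * sin th * x))) (Cminus (u (x, y)) (uinc k th (x, y)))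
    = Cmult (cis (- (k * sin th * x))) (Cminus (ut (x, y)) (uinc k th (x, y)))).
  { apply (tlim_unique _ _ _ (L1 x)). generalize (L2 x). apply (tlim_ext_from _ _ _ 0).
    intros N _. apply zsum_ext. intros n. unfold trig. now rewrite Hcc. }
  apply Cmult_reg_l in L; [|apply cis_neq_0].
  replace (u (x, y)) with (Cplus (Cminus (u (x, y)) (uinc k th (x, y))) (uinc k th (x, y))) by ring.
  rewrite L. ring.
Qed.

(** The incident wave enters in mode 0 alone, and it is the only downgoing contribution. *)
Lemma field_coef (g : pgrating) (k th b : R) (u : pt -> C) :
  admissible g -> 0 < k -> (forall t, Rabs (gf g t) < b) -> total_field g k th u ->
  exists c : Z -> C, forall y, b <= y -> forall m : Z,
    coef m (fun x => Cmult (cis (- (k * sin th * x))) (u (x, y)))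
      (Cplus (Cmult (cis (- (k * cos th * y))) (if Z.eq_dec 0 m then RtoC 1 else RtoC 0))
        (Cmult (c m) (Gn k th m y))).
Proof.
  intros Hadm Hk Hb Hu. destruct (field_expansion g k th b u Hadm Hk Hb Hu) as (c & Hc).
  exists c. intros y Hy m. destruct (Hc y Hy) as [HG HL].
  apply (coef_ext m (fun x => Cplus (Cmult (cis (- (k * cos th * y))) (cis (IZR 0 * x)))
    (Cmult (cis (- (k * sin th * x))) (Cminus (u (x, y)) (uinc k th (x, y)))))).
  - intros x. rewrite uinc_split, Rmult_0_l, cis_0.
    replace (Cmult (cis (- (k * sin th * x)))
      (Cminus (u (x, y)) (Cmult (cis (k * sin th * x)) (cis (- (k * cos th * y))))))
      with (Cminus (Cmult (cis (- (k * sin th * x))) (u (x, y)))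
        (Cmult (Cmult (cis (- (k * sin th * x))) (cis (k * sin th * x))) (cis (- (k * cos th * y))))) by ring.
    rewrite <- cis_plus, Rplus_opp_l, cis_0. ring.
  - apply coef_plus.
    + apply coef_scal, coef_cis.
    + exact (coef_series _ _ m HG HL).
Qed.

(** * Linear independence of the fields of two directions *)

Lemma downgoing_upgoing (a v : C) (be b : R) :
  0 < be -> (forall y, b <= y -> Cplus (Cmult a (cis (- (be * y)))) (Cmult v (cis (be * y))) = RtoC 0) ->
  a = RtoC 0.
Proof.
  intros Hbe H. pose proof PI_RGT_0 as HPI.
  assert (H' : forall y, b <= y -> Cplus a (Cmult v (cis (2 * be * y))) = RtoC 0).
  { intros y Hy. apply (Cmult_reg_l (cis (- (be * y)))); [apply cis_neq_0|].
    rewrite Cmult_0_r, <- (H y Hy).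
    replace (be * y) with (- (be * y) + 2 * be * y) at 3 by ring. rewrite cis_plus. ring. }
  pose proof (H' b (Rle_refl b)) as H1.
  (* Between the heights b and b + PI / (2 be) the factor e^(2 i be y) changes sign, so adding the
     two relations cancels [v]. *)
  assert (Hp : 0 < PI / (2 * be)) by (apply Rdiv_lt_0_compat; lra).
  pose proof (H' (b + PI / (2 * be)) ltac:(lra)) as H2.
  replace (2 * be * (b + PI / (2 * be))) with (2 * be * b + PI) in H2 by (field; lra).
  assert (EP : cis PI = Copp (RtoC 1)).
  { unfold cis. rewrite cos_PI, sin_PI. unfold RtoC, Copp; simpl. f_equal; ring. }
  rewrite cis_plus, EP in H2.
  assert (H3 : Cmult (RtoC 2) a = RtoC 0).
  { replace (Cmult (RtoC 2) a) with (Cplus (Cplus a (Cmult v (cis (2 * be * b))))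
      (Cplus a (Cmult v (Cmult (cis (2 * be * b)) (Copp (RtoC 1)))))).
    - rewrite H1, H2. ring.
    - replace (RtoC 2) with (Cplus (RtoC 1) (RtoC 1)) by (unfold RtoC, Cplus; simpl; f_equal; ring). ring. }
  apply (Cmult_reg_l (RtoC 2)).
  - intros X. injection X as X. lra.
  - rewrite H3. ring.
Qed.

(** Mode 0 of [u1] contains the downgoing incident wave. If k sin th1 - k sin th2 is an integer m,
    then m is nonzero because the sine is injective on this range, and mode m of [u2], which matches
    mode 0 of [u1], is purely upgoing. Otherwise the Bloch multipliers differ and a1 u1 = 0. *)
Lemma fields_independent_1 (g : pgrating) (k th1 th2 b : R) (u1 u2 : pt -> C) (a1 a2 : C) :
  admissible g -> 0 < k -> (forall t, Rabs (gf g t) < b) ->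
  -(PI / 2) < th1 < PI / 2 -> -(PI / 2) < th2 < PI / 2 -> th1 <> th2 ->
  total_field g k th1 u1 -> total_field g k th2 u2 ->
  (forall x y, b <= y -> Cplus (Cmult a1 (u1 (x, y))) (Cmult a2 (u2 (x, y))) = RtoC 0) ->
  a1 = RtoC 0.
Proof.
  intros Hadm Hk Hb Hth1 Hth2 Hne Hu1 Hu2 H0. pose proof PI_RGT_0 as HPI.
  destruct (field_coef g k th1 b u1 Hadm Hk Hb Hu1) as (c1 & Hc1).
  destruct (field_coef g k th2 b u2 Hadm Hk Hb Hu2) as (c2 & Hc2).
  assert (Hcos : 0 < cos th1) by (apply cos_gt_0; lra).
  assert (HG1 : forall y, Gn k th1 0 y = cis (k * cos th1 * y)).
  { intros y. apply (Gn_propagating k th1 0 th1 y); trivial. unfold alpha_n. ring. }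
  assert (HF1 : forall y, b <= y -> coef 0 (fun x => Cmult (cis (- (k * sin th1 * x))) (u1 (x, y)))
     (Cplus (cis (- (k * cos th1 * y))) (Cmult (c1 0%Z) (cis (k * cos th1 * y))))).
  { intros y Hy. pose proof (Hc1 y Hy 0%Z) as X. rewrite HG1 in X.
    destruct (Z.eq_dec 0 0); [|congruence]. rewrite Cmult_1_r in X. exact X. }
  assert (HZ : coef 0 (fun _ => RtoC 0) (RtoC 0)).
  { apply (coef_ext 0 (fun x => Cmult (RtoC 0) (cis (IZR 0 * x)))); [intros; ring|].
    pose proof (coef_scal 0 (RtoC 0) _ _ (coef_cis 0 0)) as X. rewrite Cmult_0_l in X. exact X. }
  set (mu := fun th => cis (2 * (k * sin th) * PI)).
  destruct (classic (exists m : Z, k * sin th1 - k * sin th2 = IZR m)) as [[m Hm]|Hno].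
  - assert (Hm0 : m <> 0%Z).
    { intros ->. apply Hne. apply sin_inj; try lra.
      apply (Rmult_eq_reg_l k); lra. }
    assert (HG2 : forall y, Gn k th2 m y = cis (k * cos th1 * y)).
    { intros y. apply (Gn_propagating k th2 m th1 y); trivial. unfold alpha_n. lra. }
    apply (downgoing_upgoing a1 (Cplus (Cmult a1 (c1 0%Z)) (Cmult a2 (c2 m))) (k * cos th1) b).
    { now apply Rmult_lt_0_compat. }
    intros y Hy.
    assert (HF2 : coef 0 (fun x => Cmult (cis (- (k * sin th1 * x))) (u2 (x, y)))
       (Cmult (c2 m) (cis (k * cos th1 * y)))).
    { pose proof (Hc2 y Hy m) as X. rewrite HG2 in X.
      destruct (Z.eq_dec 0 m); [congruence|].
      apply (coef_shift m (- m)) in X. rewrite Z.add_opp_diag_r in X.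
      replace (Cplus (Cmult (cis (- (k * cos th2 * y))) (RtoC 0)) (Cmult (c2 m) (cis (k * cos th1 * y))))
        with (Cmult (c2 m) (cis (k * cos th1 * y))) in X by ring.
      revert X. apply coef_ext. intros x. rewrite Cmult_assoc, <- cis_plus, opp_IZR. do 2 f_equal.
      replace (k * sin th1) with (IZR m + k * sin th2) by lra. ring. }
    assert (HS := coef_plus 0 _ _ _ _ (coef_scal 0 a1 _ _ (HF1 y Hy)) (coef_scal 0 a2 _ _ HF2)).
    assert (HS0 : coef 0 (fun _ => RtoC 0) (Cplus (Cmult a1 (Cplus (cis (- (k * cos th1 * y)))
       (Cmult (c1 0%Z) (cis (k * cos th1 * y))))) (Cmult a2 (Cmult (c2 m) (cis (k * cos th1 * y)))))).
    { revert HS. apply coef_ext. intros x.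
      transitivity (Cmult (cis (- (k * sin th1 * x))) (Cplus (Cmult a1 (u1 (x, y))) (Cmult a2 (u2 (x, y))))).
      - ring.
      - rewrite H0 by trivial. ring. }
    rewrite <- (tlim_unique _ _ _ HS0 HZ). ring.
  (* Different multipliers: comparing the relation at x and at x + 2 PI isolates [a1 * u1]. *)
  - assert (Hmu : Cminus (mu th1) (mu th2) <> RtoC 0).
    { intros X.
      assert (X' : cis (2 * (k * sin th1 - k * sin th2) * PI) = RtoC 1).
      { replace (2 * (k * sin th1 - k * sin th2) * PI)
          with (2 * (k * sin th1) * PI + - (2 * (k * sin th2) * PI)) by ring.
        rewrite cis_plus. change (cis (2 * (k * sin th1) * PI)) with (mu th1).
        replace (mu th1) with (mu th2).
        - unfold mu. rewrite <- cis_plus, Rplus_opp_r. apply cis_0.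
        - replace (mu th1) with (Cplus (Cminus (mu th1) (mu th2)) (mu th2)) by ring. rewrite X. ring. }
      destruct (cis_eq_1 _ X') as [m Hm]. apply Hno. exists m.
      apply (Rmult_eq_reg_l (2 * PI)); lra. }
    assert (Hz : forall x y, b <= y -> Cmult a1 (u1 (x, y)) = RtoC 0).
    { intros x y Hy. apply (Cmult_reg_l (Cminus (mu th1) (mu th2))); trivial.
      assert (HO : Omega g (x, y)).
      { unfold Omega; simpl. specialize (Hb x). apply Rabs_def2 in Hb. lra. }
      destruct Hu1 as (_ & _ & Q1 & _). destruct Hu2 as (_ & _ & Q2 & _).
      specialize (Q1 (x, y) HO). specialize (Q2 (x, y) HO). simpl fst in Q1, Q2. simpl snd in Q1, Q2.
      rewrite cexp_split, exp_0, Cmult_1_l in Q1, Q2.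
      pose proof (H0 x y Hy) as E1. pose proof (H0 (x + 2 * PI) y Hy) as E2.
      rewrite Q1, Q2 in E2. fold (mu th1) (mu th2) in E2.
      transitivity (Cminus (Cplus (Cmult a1 (Cmult (mu th1) (u1 (x, y)))) (Cmult a2 (Cmult (mu th2) (u2 (x, y)))))
        (Cmult (mu th2) (Cplus (Cmult a1 (u1 (x, y))) (Cmult a2 (u2 (x, y)))))).
      - ring.
      - rewrite E1, E2. ring. }
    apply (downgoing_upgoing a1 (Cmult a1 (c1 0%Z)) (k * cos th1) b).
    { now apply Rmult_lt_0_compat. }
    intros y Hy.
    assert (HS := coef_scal 0 a1 _ _ (HF1 y Hy)).
    assert (HS0 : coef 0 (fun _ => RtoC 0) (Cmult a1 (Cplus (cis (- (k * cos th1 * y)))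
       (Cmult (c1 0%Z) (cis (k * cos th1 * y)))))).
    { revert HS. apply coef_ext. intros x.
      transitivity (Cmult (cis (- (k * sin th1 * x))) (Cmult a1 (u1 (x, y)))).
      - ring.
      - rewrite Hz by trivial. ring. }
    rewrite <- (tlim_unique _ _ _ HS0 HZ). ring.
Qed.

Lemma fields_independent (g : pgrating) (k th1 th2 b : R) (u1 u2 : pt -> C) (a1 a2 : C) :
  admissible g -> 0 < k -> (forall t, Rabs (gf g t) < b) ->
  -(PI / 2) < th1 < PI / 2 -> -(PI / 2) < th2 < PI / 2 -> th1 <> th2 ->
  total_field g k th1 u1 -> total_field g k th2 u2 ->
  (forall x y, b <= y -> Cplus (Cmult a1 (u1 (x, y))) (Cmult a2 (u2 (x, y))) = RtoC 0) ->
  a1 = RtoC 0 /\ a2 = RtoC 0.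
Proof.
  intros Hadm Hk Hb Hth1 Hth2 Hne Hu1 Hu2 H0. split.
  - now apply (fields_independent_1 g k th1 th2 b u1 u2 a1 a2).
  - apply (fields_independent_1 g k th2 th1 b u2 u1 a2 a1); trivial; [congruence|].
    intros x y Hy. rewrite Cplus_comm. now apply H0.
Qed.

(** * No corner inside the other domain *)

Lemma gf_lt_of_abs (g : pgrating) (b : R) : (forall t, Rabs (gf g t) < b) -> forall t, gf g t < b.
Proof. intros H t. specialize (H t). apply Rabs_def2 in H. lra. Qed.

Lemma sol_total_field (g : pgrating) (k th : R) (u : pt -> C) :
  total_field g k th u -> sol k (Omega g) (ReF u) /\ sol k (Omega g) (ImF u).
Proof. intros (H & _). now apply helmholtz_sol. Qed.

(** [Om] is stable under moving up, so vertical segments join all its points to the region above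
    [b]; this replaces a general connectedness argument. *)
Lemma continuation_down (k b : R) (Om : pt -> Prop) (h : pt -> R) :
  0 < k -> open Om -> sol k Om h ->
  (forall x y y', Om (x, y) -> y <= y' -> Om (x, y')) ->
  (forall x y, b <= y -> Om (x, y)) -> (forall x y, b <= y -> h (x, y) = 0) ->
  forall q, Om q -> h q = 0.
Proof.
  intros Hk HO Hh Hup Hb H0 [x y] Hq.
  destruct (Rle_dec b y) as [C|C]; [now apply H0|].
  (* Starting at height b + 1 leaves a whole box on which [h] is known to vanish. *)
  pose proof (unique_continuation_segment k Om h (x, b + 1) (0, y - (b + 1)) Hk HO Hh) as H.
  simpl fst in H. simpl snd in H.
  replace (x + 0) with x in H by ring. replace (b + 1 + (y - (b + 1))) with y in H by ring.
  apply (locally_singleton (x, y) (fun q => h q = 0)). apply H.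
  - intros t Ht. replace (x + t * 0) with x by ring.
    apply (Hup x y); trivial. nra.
  - apply locally_box. exists 1. split; [lra|]. intros [u v] [_ Hv]. simpl in Hv.
    apply Rabs_def2 in Hv. apply H0. lra.
Qed.

Lemma fields_equal (g gt : pgrating) (k th b : R) (u ut : pt -> C) :
  admissible g -> admissible gt -> 0 < k ->
  (forall t, Rabs (gf g t) < b) -> (forall t, Rabs (gf gt t) < b) ->
  total_field g k th u -> total_field gt k th ut ->
  (forall x, 0 <= x <= 2 * PI -> u (x, b) = ut (x, b)) ->
  forall q, Omega g q -> Omega gt q -> u q = ut q.
Proof.
  intros Ha Hat Hk Hb Hbt Hu Hut Heq q Hq Hqt.
  pose proof (fields_equal_above g gt k th b u ut Ha Hat Hk Hb Hbt Hu Hut Heq) as Habove.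
  set (Om := fun q => Omega g q /\ Omega gt q).
  assert (HO : open Om) by (apply open_and; now apply Omega_open).
  destruct (sol_total_field g k th u Hu) as [S1 S2].
  destruct (sol_total_field gt k th ut Hut) as [S3 S4].
  assert (Hup : forall x y y', Om (x, y) -> y <= y' -> Om (x, y')).
  { intros x y y' [H1 H2] Hy. unfold Om, Omega in *. simpl in *. lra. }
  assert (Hbelow : forall x y, b <= y -> Om (x, y)).
  { intros x y Hy. pose proof (gf_lt_of_abs g b Hb x). pose proof (gf_lt_of_abs gt b Hbt x).
    unfold Om, Omega; simpl; lra. }
  assert (Key : forall f f', sol k (Omega g) f -> sol k (Omega gt) f' ->
    (forall x y, b <= y -> f (x, y) = f' (x, y)) -> f q = f' q).
  { intros f f' Sf Sf' Hff.
    assert (Z : lin 1 f (-1) f' q = 0).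
    { apply (continuation_down k b Om); trivial; [| |now split].
      - apply sol_lin; trivial.
        + apply (sol_sub k _ (Omega g)); trivial. now intros p [? _].
        + apply (sol_sub k _ (Omega gt)); trivial. now intros p [_ ?].
      - intros x y Hy. unfold lin. rewrite Hff by trivial. ring. }
    unfold lin in Z. lra. }
  apply injective_projections.
  - apply (Key (ReF u) (ReF ut)); trivial. intros x y Hy. unfold ReF. now rewrite Habove.
  - apply (Key (ImF u) (ImF ut)); trivial. intros x y Hy. unfold ImF. now rewrite Habove.
Qed.

(** Three segments inside [Omega g] lead to the target: up from [p] to a height above the graph,
    across, then vertically. *)
Lemma continuation_up (g : pgrating) (k b : R) (h : pt -> R) (p : pt) :
  admissible g -> 0 < k -> (forall t, gf g t < b) -> sol k (Omega g) h -> Omega g p ->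
  locally p (fun q => h q = 0) -> forall x y, b <= y -> h (x, y) = 0.
Proof.
  intros Hadm Hk Hb Hh Hp H0 x y Hy. destruct p as [p1 p2]. unfold Omega in Hp. simpl in Hp.
  assert (HO := Omega_open g Hadm).
  pose proof (unique_continuation_segment k (Omega g) h (p1, p2) (0, Rmax p2 b - p2) Hk HO Hh) as A.
  pose proof (unique_continuation_segment k (Omega g) h (p1, Rmax p2 b) (x - p1, 0) Hk HO Hh) as B.
  pose proof (unique_continuation_segment k (Omega g) h (x, Rmax p2 b) (0, y - Rmax p2 b) Hk HO Hh) as D.
  simpl fst in A, B, D. simpl snd in A, B, D.
  pose proof (Rmax_l p2 b). pose proof (Rmax_r p2 b). set (m := Rmax p2 b) in *.
  rewrite Rplus_0_r in A, B, D.
  replace (p2 + (m - p2)) with m in A by ring. replace (p1 + (x - p1)) with x in B by ring.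
  replace (m + (y - m)) with y in D by ring.
  apply (locally_singleton (x, y) (fun q => h q = 0)).
  apply D; [|apply B; [|apply A; trivial]].
  - intros t Ht. unfold Omega; simpl. specialize (Hb (x + t * 0)). nra.
  - intros t Ht. unfold Omega; simpl. specialize (Hb (p1 + t * (x - p1))). nra.
  - intros t Ht. unfold Omega; simpl. replace (p1 + t * 0) with p1 by ring. nra.
Qed.

(** One linear condition on two coefficients has a nontrivial solution; this supplies the order 0
    vanishing at the corner. *)
Lemma exists_vanishing_combination (z1 z2 : C) :
  exists a1 a2 : C, ~ (a1 = RtoC 0 /\ a2 = RtoC 0) /\ Cplus (Cmult a1 z1) (Cmult a2 z2) = RtoC 0.
Proof.
  destruct (classic (z1 = RtoC 0 /\ z2 = RtoC 0)) as [[-> ->]|H].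
  - exists (RtoC 1), (RtoC 0). split.
    + intros [X _]. injection X as X. lra.
    + ring.
  - exists z2, (Copp z1). split.
    + intros [X Y]. apply H. split; trivial.
      replace z1 with (Copp (Copp z1)) by ring. rewrite Y. ring.
    + ring.
Qed.

(** The combination is formed from the fields of [gt], which are smooth near [p]; those of [g]
    transmit their boundary conditions through equality on the common domain. *)
Lemma no_corner_in_Omega (g gt : pgrating) (k th1 th2 b : R) (u1 u2 ut1 ut2 : pt -> C) (p : pt) :
  admissible g -> admissible gt -> irrational_grating g -> 0 < k ->
  -(PI / 2) < th1 < PI / 2 -> -(PI / 2) < th2 < PI / 2 -> th1 <> th2 ->
  (forall t, Rabs (gf g t) < b) -> (forall t, Rabs (gf gt t) < b) ->
  total_field g k th1 u1 -> total_field g k th2 u2 ->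
  total_field gt k th1 ut1 -> total_field gt k th2 ut2 ->
  (forall x, 0 <= x <= 2 * PI -> u1 (x, b) = ut1 (x, b)) ->
  (forall x, 0 <= x <= 2 * PI -> u2 (x, b) = ut2 (x, b)) ->
  corner g p -> ~ Omega gt p.
Proof.
  intros Ha Hat Hirr Hk Hth1 Hth2 Hne Hb Hbt Hu1 Hu2 Hut1 Hut2 Heq1 Heq2 Hc Hp.
  pose proof (fields_equal g gt k th1 b u1 ut1 Ha Hat Hk Hb Hbt Hu1 Hut1 Heq1) as E1.
  pose proof (fields_equal g gt k th2 b u2 ut2 Ha Hat Hk Hb Hbt Hu2 Hut2 Heq2) as E2.
  destruct (sol_total_field gt k th1 ut1 Hut1) as [F1 H1].
  destruct (sol_total_field gt k th2 ut2 Hut2) as [F2 H2].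
  destruct (exists_vanishing_combination (ut1 p) (ut2 p)) as (a1 & a2 & Hnz & Hz).
  assert (HW : forall q, Cplus (Cmult a1 (ut1 q)) (Cmult a2 (ut2 q)) =
    (cre a1 (ReF ut1) (ImF ut1) a2 (ReF ut2) (ImF ut2) q,
     cim a1 (ReF ut1) (ImF ut1) a2 (ReF ut2) (ImF ut2) q)).
  { intros q. unfold cre, cim, lin, ReF, ImF, Cplus, Cmult; simpl. f_equal; ring. }
  rewrite HW in Hz. injection Hz as Z1 Z2.
  assert (HO := Omega_open gt Hat).
  destruct (corner_local_zero g k (Omega gt) u1 u2 (ReF ut1) (ImF ut1) (ReF ut2) (ImF ut2) p a1 a2)
    as [L1 L2]; trivial.
  - intros q Hq Hqt. rewrite (E1 q Hq Hqt). apply surjective_pairing.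
  - intros q Hq Hqt. rewrite (E2 q Hq Hqt). apply surjective_pairing.
  - apply Hu1.
  - apply Hu2.
  - apply Hnz. apply (fields_independent gt k th1 th2 b ut1 ut2); trivial.
    intros x y Hy. rewrite HW.
    rewrite (continuation_up gt k b _ p Hat Hk (gf_lt_of_abs gt b Hbt)
      (sol_cre k _ a1 a2 _ _ _ _ HO F1 H1 F2 H2) Hp L1 x y Hy).
    rewrite (continuation_up gt k b _ p Hat Hk (gf_lt_of_abs gt b Hbt)
      (sol_cim k _ a1 a2 _ _ _ _ HO F1 H1 F2 H2) Hp L2 x y Hy).
    reflexivity.
Qed.

(** Limits of points above the graph lie on or above it, so off the graph they lie in the open
    domain. *)
Lemma boundary_in_Omega (g : pgrating) (G : pt -> Prop) (p : pt) :
  admissible g -> (forall q, G q -> Omega g q) -> boundary2 G p -> ~ Lambda g p -> Omega g p.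
Proof.
  intros Hadm HG [Hcl _] HL.
  assert (Hle : gf g (fst p) <= snd p).
  { apply closure_Omega; trivial. intros e He. destruct (Hcl e He) as (q & Hq & Hd).
    exists q. split; trivial. now apply HG. }
  unfold Lambda in HL. unfold Omega. lra.
Qed.

Theorem theorem8p13
  (g gt : pgrating) (k th1 th2 b : R)
  (u1 u2 ut1 ut2 : pt -> C) (G : pt -> Prop) :
  admissible g -> admissible gt ->
  irrational_grating g -> irrational_grating gt ->
  0 < k ->
  -(PI / 2) < th1 < PI / 2 -> -(PI / 2) < th2 < PI / 2 -> th1 <> th2 ->
  (forall t, Rabs (gf g t) < b) -> (forall t, Rabs (gf gt t) < b) ->
  total_field g k th1 u1 -> total_field g k th2 u2 ->
  total_field gt k th1 ut1 -> total_field gt k th2 ut2 ->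
  (forall x1, 0 <= x1 <= 2 * PI -> u1 (x1, b) = ut1 (x1, b)) ->
  (forall x1, 0 <= x1 <= 2 * PI -> u2 (x1, b) = ut2 (x1, b)) ->
  conn_component (fun p => Omega g p /\ Omega gt p) G -> unbounded2 G ->
  (forall p, corner g p -> ~ (boundary2 G p /\ ~ Lambda gt p)) /\
  (forall p, corner gt p -> ~ (boundary2 G p /\ ~ Lambda g p)).
Proof.
  intros Ha Hat Hirr Hirrt Hk Hth1 Hth2 Hne Hb Hbt Hu1 Hu2 Hut1 Hut2 Heq1 Heq2 (p0 & _ & HG) _.
  assert (Hsub : forall q, G q -> Omega g q /\ Omega gt q).
  { intros q Hq. apply HG in Hq. destruct Hq as (S & _ & HS & _ & HqS). now apply HS. }
  split; intros p Hc [Hbd HL].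
  - apply (no_corner_in_Omega g gt k th1 th2 b u1 u2 ut1 ut2 p); trivial.
    apply (boundary_in_Omega gt G); trivial. intros q Hq. now apply Hsub.
  - apply (no_corner_in_Omega gt g k th1 th2 b ut1 ut2 u1 u2 p); trivial.
    + intros x Hx. symmetry. now apply Heq1.
    + intros x Hx. symmetry. now apply Heq2.
    + apply (boundary_in_Omega g G); trivial. intros q Hq. now apply Hsub.
Qed.
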